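(* Let $0<\varepsilon<B$, and put $\bar\chi=1+\chi$ and $\Lambda=1+\log\frac{B\bar\chi}{\varepsilon}$. The two-point accelerated algorithm described in the context, with the problems in $y$ solved by the center-of-gravity method, returns $(\hat x,\hat y)\in\mathcal X\times\mathcal Y$ with $\operatorname{Gap}(\hat x,\hat y)\le\varepsilon$ after $$T_x=I_0+O\big(\sqrt{\kappa+\chi}\;\Lambda\big),\qquad T_y=O\big(m\sqrt{1+\chi}\;\Lambda^2\big)$$ oracle calls, where $I_0=O\big(\sqrt\kappa\,[1+\log_+\frac{\mu R_x^2}{B}]\big)$ is the cost of initialization. If the problems in $y$ are solved by another method that returns a $\delta$-maximizer after $N_y(\delta)$ calls to $\mathsf O_y$, then $T_y=O\big(\sqrt{1+\chi}\,\Lambda\cdot N_y(\varepsilon/(C\bar\chi^{5/2}))\big)$ for an absolute constant $C$.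
   Context: Setting. $\|\cdot\|$ is the Euclidean norm. $\mathcal X\subseteq\mathbb R^n$ is nonempty, closed, convex, of diameter at most $R_x$. $\mathcal Y\subset\mathbb R^m$ is compact, convex, with nonempty interior in its affine hull, $m=\dim\operatorname{aff}\mathcal Y\ge1$, of diameter at most $R_y$. $f:\mathcal X\times\mathcal Y\to\mathbb R$; for every $y$, $f(\cdot,y)$ is $\mu$-strongly convex and $L$-smooth on $\mathcal X$, $\mu>0$; for every $x$, $f(x,\cdot)$ is $\nu$-strongly concave on $\mathcal Y$, $\nu>0$; and $\|\nabla_xf(x,y)-\nabla_xf(x,y')\|\le\ell\|y-y'\|$ for all $x\in\mathcal X$, $y,y'\in\mathcal Y$. Oracles: $\mathsf O_x(x,y)=\nabla_xf(x,y)$; $\mathsf O_y(x,y)=(f(x,y),g)$ with $g$ a supergradient of $f(x,\cdot)$ at $y$, and the returned $g$ always satisfies $\|g\|\le M_y$. $T_x,T_y$ are the total numbers of calls to $\mathsf O_x,\mathsf O_y$; all other computations (projections, centers of gravity) are free. $\kappa=L/\mu$, $\chi=\ell^2/(\mu\nu)$, $B=M_yR_y$, $\log_+t=\max\{0,\log t\}$, $\log_2^+t=\max\{0,\log_2 t\}$. $P(x)=\max_{y}f(x,y)$, $\phi(y)=\min_xf(x,y)$, $\operatorname{Gap}(x,y)=P(x)-\phi(y)$, $P^\star=\min_{\mathcal X}P$. A $\delta$-maximizer of $h$ on $\mathcal Y$ is $y\in\mathcal Y$ with $\max_{\mathcal Y}h-h(y)\le\delta$. Constants hidden in $O(\cdot)$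 are absolute. Block. For $F$ $\mu_F$-strongly convex and $L_F$-smooth on $\mathcal X$, $\pi(x)=c+\frac\gamma2\|x-\bar x\|^2$ ($\gamma>0$, $\bar x\in\mathcal X$), $k\ge1$, $\mathrm{Block}(F,\pi,k)$: $A_0=0$, $\Gamma_0=\gamma$, $u_0=z_0=\bar x$, $r_0=\gamma\bar x$; for $i=1,\dots,k$: $a_i=\frac{(i+1)\gamma}{2L_F}$, $A_i=A_{i-1}+a_i$, $\Gamma_i=\Gamma_{i-1}+\mu_Fa_i$, $x_i=\frac{A_{i-1}u_{i-1}+a_iz_{i-1}}{A_i}$, $g_i=\nabla F(x_i)$, $r_i=r_{i-1}+a_i(\mu_Fx_i-g_i)$, $z_i=\operatorname{proj}_{\mathcal X}(r_i/\Gamma_i)$, $u_i=\frac{A_{i-1}u_{i-1}+a_iz_i}{A_i}$. Output $(u_k,z_k,A_k)$. Problems in $y$. $\mathsf{MaxY}(x,\delta)$ returns a $\delta$-maximizer of $f(x,\cdot)$ on $\mathcal Y$. The center-of-gravity method: $\mathcal Y_0=\mathcal Y$; for $t=1,2,\dots$ query $\mathsf O_y(x,y_t)$ at the center of gravity $y_t$ of $\mathcal Y_{t-1}$, obtaining the supergradient $g_t$, and set $\mathcal Y_t=\{y\in\mathcal Y_{t-1}:\langle g_t,y-y_t\rangle\ge0\}$; after $\lceil m\log(B/\delta)/\log\frac{e}{e-1}\rceil$ queries return the query point with the largest value. Initialization. Fix $y_0\in\mathcal Y$, $F=f(\cdot,y_0)$, $E_{0}=B$, $k_0=\lceil\sqrt{8\kappa}\,\rceil$.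 A run from $v$ is $\mathrm{Block}(F,\frac\mu4\|\cdot-v\|^2,k_0)$ with $\mu_F=\mu$, $L_F=L$. From an arbitrary $v\in\mathcal X$ perform $1+\lceil\log_2^+\frac{\mu R_x^2}{4E_0}\rceil$ runs, each started at the $u$-output of the previous one, then one more; its $u$-output is the starting point $w$ (which satisfies $P(w)-P^\star\le2B$). Two-point algorithm. Set $\Gamma=\mu\bar\chi$, $L_\Phi=1+\frac{L}{4\Gamma}$, $k=\lceil2\sqrt{L_\Phi}\,\rceil$, $A_\Phi=\frac{k(k+3)}{4L_\Phi}$, $\theta=\frac{A_\Phi}{1+A_\Phi}$, $K=\lceil8\sqrt{\bar\chi/\theta}\,\rceil$, $c_\delta=\frac{\bar\chi}{4K^3}$, $E=2B$, and let $w$ come from the initialization. While $E>\varepsilon/(6\bar\chi^2)$: set $A=0$, $u=z=w$, $\delta=c_\delta E$; repeat $K$ times: find $a>0$ with $a^2=\theta(A+a)/(4\Gamma)$, put $A^+=A+a$, $w_i(p)=(Au+ap)/A^+$, $v=w_i(z)$, $y_i=\mathsf{MaxY}(v,\delta)$, $\Phi_i(p)=\frac{A^+}{\theta}f(w_i(p),y_i)+\frac12\|p-z\|^2$, $(p_i,z^+,\cdot)=\mathrm{Block}(\Phi_i,\frac12\|\cdot-z\|^2,k)$ with $\mu_F=1+\frac{\mu}{4\Gamma}$, $L_F=L_\Phi$, and then replace $u$ by $w_i(p_i)$, $z$ by $z^+$, $A$ by $A^+$. After the $K$ repetitions set $w=u$ and $E\leftarrow E/2$. At the end output $\hat x=w$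 and $\hat y=\mathsf{MaxY}(\hat x,c_\delta E)$. Each gradient of $\Phi_i$ costs one call to $\mathsf O_x$.
   Formalization: For another method, N_y(δ) is assumed nonincreasing in δ (otherwise the bound by N_y at a single accuracy can fail), and μ ≤ L is assumed, which is automatic unless X is a single point, where the O(√κ) bound can fail. *)

(* Defs.v *)
From HB Require Import structures.
From mathcomp Require Import all_boot all_order all_algebra.
From mathcomp Require Import all_classical all_reals all_analysis.

Set Implicit Arguments.
Unset Strict Implicit.
Unset Printing Implicit Defensive.

Import Order.TTheory GRing.Theory Num.Theory numFieldNormedType.Exports.

Local Open Scope classical_set_scope.
Local Open Scope ring_scope.

(* The library norm on ['rV[R]_d] is the max-norm, hence [dot] and [enorm].
   Its topology is the usual one, so the library's [closed], [compact],
   [nbhs] are used as they are. *)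
Section Euclidean.
Variables (R : realType) (d : nat).
Implicit Types (u v x y : 'rV[R]_d) (A : set 'rV[R]_d) (h : 'rV[R]_d -> R).

Definition dot u v : R := \sum_(i < d) u 0 i * v 0 i.
Definition enorm u : R := Num.sqrt (dot u u).

Definition diameter_le A (r : R) :=
  forall x y, A x -> A y -> enorm (x - y) <= r.

Definition strongly_convex A (c : R) h :=
  forall x y (t : R), A x -> A y -> 0 <= t <= 1 ->
    h (t *: x + (1 - t) *: y) <=
      t * h x + (1 - t) * h y - c / 2 * t * (1 - t) * enorm (x - y) ^+ 2.

Definition strongly_concave A (c : R) h :=
  strongly_convex A c (fun y => - h y).

(* Frechet gradient relative to [A]: [h] only matters on [A]. *)
Definition is_gradient A h x g :=
  forall e : R, 0 < e -> \forall y \near within A (nbhs x),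
    `|h y - h x - dot g (y - x)| <= e * enorm (y - x).

Definition smooth A (L : R) h (G : 'rV[R]_d -> 'rV[R]_d) :=
  (forall x, A x -> is_gradient A h x (G x)) /\
  (forall x y, A x -> A y -> enorm (G x - G y) <= L * enorm (x - y)).

Definition is_supergradient A h y g :=
  forall y', A y' -> h y' <= h y + dot g (y' - y).

Definition delta_maximizer A h (delta : R) y :=
  A y /\ sup (h @` A) - h y <= delta.

Definition affine_hull A : set 'rV[R]_d :=
  [set y | exists k (l : 'I_k -> R) (a : 'I_k -> 'rV[R]_d),
    [/\ forall i, A (a i), \sum_i l i = 1 & y = \sum_i l i *: a i]].

Definition relative_interior A : set 'rV[R]_d :=
  [set y | A y /\ \forall y' \near within (affine_hull A) (nbhs y), A y'].

Definition affine_dim A (k : nat) :=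
  exists (p : 'rV[R]_d) (U : 'M[R]_d), \rank U = k /\
    affine_hull A = [set p + u | u in [set u : 'rV[R]_d | (u <= U)%MS]].

Definition proj A x : 'rV[R]_d :=
  get [set p | A p /\ forall q, A q -> enorm (p - x) <= enorm (q - x)].

End Euclidean.

Section LebesgueTuple.
Variable R : realType.
Local Notation RR := (measurableTypeR R).

Let cons_tuple (d : nat) (p : RR * d.-tuple RR) : d.+1.-tuple RR :=
  [tuple of p.1 :: p.2].

(* Lebesgue measure on R^d, as the d-fold product measure. *)
Fixpoint lebesgue_tuple (d : nat) : set (d.-tuple RR) -> \bar R :=
  match d with
  | 0 => \d_ [tuple]
  | d'.+1 => pushforward (lebesgue_measure \x lebesgue_tuple (d := d'))%E
                         (@cons_tuple d')
  end.

Let mcons d : measurable_fun setT (@cons_tuple d).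
Proof. exact: measurable_cons. Qed.

Let lebesgue_tuple_measure d :
  exists2 nu : {measure set (d.-tuple RR) -> \bar R},
    @lebesgue_tuple d = nu & sigma_finite setT nu.
Proof.
elim: d => [|d [nu nuE nufin]].
  exists (\d_ [tuple]) => //; apply: fin_num_fun_sigma_finite.
    by rewrite measure0.
  exact: fin_num_measure.
pose isS := isSFinite.Build _ _ _ _ (sfinite_measure_sigma_finite nufin).
pose isf := isSigmaFinite.Build _ _ _ _ nufin.
pose nu' := HB.pack_for (SigmaFiniteMeasure.type (d.-tuple RR) R)
  (Measure.sort nu) isS isf.
pose P : {measure set (RR * d.-tuple RR) -> \bar R} :=
  (lebesgue_measure \x nu')%E.
pose Q := measure_function_pushforward__canonical__measure_function_Measure
  P (@mcons d).
exists Q; first by rewrite /Q/= nuE.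
have [F FU Ffin] := sigma_finiteT (@lebesgue_measure R).
have [G GU Gfin] := nufin.
pose H k := [set t : d.+1.-tuple RR | F k.1 (thead t) /\ G k.2 [tuple of behead t]].
have mH k : measurable (H k).
  rewrite (_ : H k = (@tnth _ RR ^~ ord0) @^-1` F k.1 `&`
     (fun t : d.+1.-tuple RR => [tuple of behead t]) @^-1` G k.2) //.
  apply: measurableI; rewrite -[X in measurable X]setTI.
    by apply: measurable_tnth => //; case: (Ffin k.1).
  by apply: measurable_behead => //; case: (Gfin k.2).
have QH k : (Q (H k) < +oo)%E.
  have -> : Q (H k) = (lebesgue_measure (F k.1) * nu (G k.2))%E.
    rewrite -[RHS](product_measure1E _ nu' (Ffin k.1).1 (Gfin k.2).1).
    rewrite /Q /= /pushforward /P /=; congr (_ _).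
    apply/seteqP; split=> -[x y] /=; rewrite /H /= theadE.
      by move=> [? Gy]; split => //; rewrite (_ : y = [tuple of behead (cons_tuple (x, y))])//; exact/val_inj.
    by move=> [? Gy]; split => //; rewrite (_ : [tuple of _] = y)//; exact/val_inj.
  by rewrite lte_mul_pinfty //; [rewrite ge0_fin_numE//; exact: (Ffin _).2|exact:(Gfin _).2].
exists (fun i => if unpickle i is Some k then H k else set0).
  apply/esym; rewrite -subTset => t _.
  have : setT (thead t) by []. rewrite FU => -[i _ Fi].
  have : setT [tuple of behead t] by []. rewrite GU => -[j _ Gj].
  by exists (pickle (i, j)) => //=; rewrite pickleK.
by move=> i; case: unpickle => [k|]; split => //; rewrite measure0.
Qed.

Let lebesgue_tuple0 d : @lebesgue_tuple d set0 = 0%E.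
Proof. by have [nu -> _] := lebesgue_tuple_measure d; exact: measure0. Qed.
Let lebesgue_tuple_ge0 d A : (0 <= @lebesgue_tuple d A)%E.
Proof. by have [nu -> _] := lebesgue_tuple_measure d; exact: measure_ge0. Qed.
Let lebesgue_tuple_sigma_additive d : semi_sigma_additive (@lebesgue_tuple d).
Proof.
by have [nu -> _] := lebesgue_tuple_measure d; exact: measure_semi_sigma_additive.
Qed.

HB.instance Definition _ d := isMeasure.Build _ _ _ (@lebesgue_tuple d)
  (lebesgue_tuple0 d) (@lebesgue_tuple_ge0 d) (@lebesgue_tuple_sigma_additive d).

Let lebesgue_tuple_sigma_finite d : sigma_finite setT (@lebesgue_tuple d).
Proof. by have [nu -> ] := lebesgue_tuple_measure d. Qed.

HB.instance Definition _ d := Measure_isSigmaFinite.Build _ _ _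
  (@lebesgue_tuple d) (@lebesgue_tuple_sigma_finite d).

End LebesgueTuple.
Arguments lebesgue_tuple {R} d _.

Section CenterOfGravity.
Variable R : realType.

Definition tuple_set d (A : set 'rV[R]_d) : set (d.-tuple (measurableTypeR R)) :=
  [set t | A (\row_i tnth t i)].

Definition center_of_gravity d (A : set 'rV[R]_d) : 'rV[R]_d :=
  \row_i ((\int[lebesgue_tuple d]_(t in tuple_set A) (tnth t i : R))
          / fine (lebesgue_tuple d (tuple_set A))).

End CenterOfGravity.

Section RealFunctions.
Variable R : realType.

(* Negative reals are sent to 0. *)
Definition ceiln (x : R) : nat := `|Num.max 0%:Z (Num.ceil x)|%N.
Definition log_plus (t : R) : R := Num.max 0 (ln t).
Definition log2_plus (t : R) : R := Num.max 0 (ln t / ln 2).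

End RealFunctions.

(* Algorithms are decision trees whose internal nodes are oracle calls. They
   have no other access to the payoff; everything between two calls is free. *)
Section Programs.
Variables (R : realType) (n m : nat).

Inductive prog (T : Type) : Type :=
| Ret of T
| CallX of 'rV[R]_n & 'rV[R]_m & ('rV[R]_n -> prog T)
| CallY of 'rV[R]_n & 'rV[R]_m & (R * 'rV[R]_m -> prog T).

Fixpoint bind S T (p : prog S) (q : S -> prog T) : prog T :=
  match p with
  | Ret s => q s
  | CallX x y k => CallX x y (fun g => bind (k g) q)
  | CallY x y k => CallY x y (fun a => bind (k a) q)
  end.

Fixpoint repeat S (k : nat) (step : S -> prog S) (s : S) : prog S :=
  match k with
  | 0 => Ret s
  | k'.+1 => bind (step s) (repeat k' step)
  end.

Record outcome (T : Type) :=
  Outcome { output : T; calls_x : nat; calls_y : nat }.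

Fixpoint run T (Ox : 'rV[R]_n -> 'rV[R]_m -> 'rV[R]_n)
    (Oy : 'rV[R]_n -> 'rV[R]_m -> R * 'rV[R]_m) (p : prog T) : outcome T :=
  match p with
  | Ret t => Outcome t 0 0
  | CallX x y k => let o := run Ox Oy (k (Ox x y)) in
      Outcome (output o) (calls_x o).+1 (calls_y o)
  | CallY x y k => let o := run Ox Oy (k (Oy x y)) in
      Outcome (output o) (calls_x o) (calls_y o).+1
  end.

End Programs.

Arguments Ret {R n m T}.
Arguments CallX {R n m T}.
Arguments CallY {R n m T}.

Notation "'let!' x ':=' p 'in' q" := (bind p (fun x => q))
  (at level 200, x pattern, p at level 100, q at level 200).

(* What the algorithm is given besides the two oracles. *)
Record params (R : realType) (n m : nat) := Params {
  dom_x : set 'rV[R]_n;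
  dom_y : set 'rV[R]_m;
  mu : R;
  L : R;
  nu : R;
  ell : R;
  R_x : R;
  R_y : R;
  M_y : R }.

Section Problem.
Variables (R : realType) (n m : nat) (pb : params R n m).
Local Notation X := (dom_x pb).
Local Notation Y := (dom_y pb).

Definition kappa : R := L pb / mu pb.
Definition chi : R := ell pb ^+ 2 / (mu pb * nu pb).
Definition chibar : R := 1 + chi.
Definition B : R := M_y pb * R_y pb.
Definition Lambda (eps : R) : R := 1 + ln (B * chibar / eps).

(* [gx x y] is the answer of the first oracle; the second one answers
   [(f x y, gy x y)].  [mu <= L] follows from the other fields unless the
   domain of [x] is a single point, for which [kappa < 1] is excluded here. *)
Record setting (f : 'rV[R]_n -> 'rV[R]_m -> R)
    (gx : 'rV[R]_n -> 'rV[R]_m -> 'rV[R]_n)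
    (gy : 'rV[R]_n -> 'rV[R]_m -> 'rV[R]_m) : Prop := Setting {
  X_nonempty : X !=set0;
  X_closed : closed X;
  X_convex : convex_set (X : set (convex_lmodType 'rV[R]_n));
  X_diam : diameter_le X (R_x pb);
  m_ge1 : (1 <= m)%N;
  Y_compact : compact Y;
  Y_convex : convex_set (Y : set (convex_lmodType 'rV[R]_m));
  Y_relint : relative_interior Y !=set0;
  Y_dim : affine_dim Y m;
  Y_diam : diameter_le Y (R_y pb);
  mu_gt0 : 0 < mu pb;
  mu_le_L : mu pb <= L pb;
  nu_gt0 : 0 < nu pb;
  f_strongly_convex : forall y, Y y -> strongly_convex X (mu pb) (fun x => f x y);
  f_smooth : forall y, Y y -> smooth X (L pb) (fun x => f x y) (fun x => gx x y);
  f_strongly_concave : forall x, X x -> strongly_concave Y (nu pb) (f x);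
  f_coupling : forall x y y', X x -> Y y -> Y y' ->
    enorm (gx x y - gx x y') <= ell pb * enorm (y - y');
  gy_supergradient : forall x y, X x -> Y y -> is_supergradient Y (f x) y (gy x y);
  gy_bounded : forall x y, X x -> Y y -> enorm (gy x y) <= M_y pb }.

Definition primal (f : 'rV[R]_n -> 'rV[R]_m -> R) (x : 'rV[R]_n) : R :=
  sup (f x @` Y).
Definition dual (f : 'rV[R]_n -> 'rV[R]_m -> R) (y : 'rV[R]_m) : R :=
  inf ((fun x => f x y) @` X).
Definition Gap f x y : R := primal f x - dual f y.

Section Block.

Record block_state := BlockState {
  b_A : R; b_Gamma : R; b_u : 'rV[R]_n; b_z : 'rV[R]_n; b_r : 'rV[R]_n }.

(* [gradF] evaluates the gradient of F; the prox term is
   [c + gamma / 2 * |x - xbar|^2], whose constant [c] plays no role. *)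
Variables (gradF : 'rV[R]_n -> prog R n m 'rV[R]_n).
Variables (xbar : 'rV[R]_n) (gamma muF LF : R).

Definition block_step (i : nat) (s : block_state) : prog R n m block_state :=
  let a := i.+1%:R * gamma / (2 * LF) in
  let A := b_A s + a in
  let Gamma := b_Gamma s + muF * a in
  let x := A^-1 *: (b_A s *: b_u s + a *: b_z s) in
  let! g := gradF x in
  let r := b_r s + a *: (muF *: x - g) in
  let z := proj X (Gamma^-1 *: r) in
  let u := A^-1 *: (b_A s *: b_u s + a *: z) in
  Ret (BlockState A Gamma u z r).

Fixpoint block_iter (k : nat) : prog R n m block_state :=
  match k with
  | 0 => Ret (BlockState 0 gamma xbar xbar (gamma *: xbar))
  | k'.+1 => let! s := block_iter k' in block_step k'.+1 s
  end.

Definition block (k : nat) : prog R n m ('rV[R]_n * 'rV[R]_n * R) :=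
  let! s := block_iter k in Ret (b_u s, b_z s, b_A s).

End Block.

Definition better (best : option (R * 'rV[R]_m)) (q : R * 'rV[R]_m) :=
  match best with
  | Some b => if q.1 <= b.1 then b else q
  | None => q
  end.

(* The state is the current localizer and the best query so far. *)
Definition cog_step (x : 'rV[R]_n) (s : set 'rV[R]_m * option (R * 'rV[R]_m)) :
    prog R n m (set 'rV[R]_m * option (R * 'rV[R]_m)) :=
  let y := center_of_gravity s.1 in
  let! (value, g) := CallY x y Ret in
  Ret (s.1 `&` [set y' | 0 <= dot g (y' - y)], Some (better s.2 (value, y))).

Definition cog_queries (delta : R) : nat :=
  ceiln (m%:R * ln (B / delta) / ln (expR 1 / (expR 1 - 1))).

(* If [B <= delta] there is no query and any point of Y is returned. *)
Definition cog_maxy (x : 'rV[R]_n) (delta : R) : prog R n m 'rV[R]_m :=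
  let! s := repeat (cog_queries delta) (cog_step x) (Y, None) in
  Ret (match s.2 with Some (_, y) => y | None => get Y end).

(* The prox term [mu / 4 * |x - v|^2] is [gamma / 2 * |x - v|^2] for
   [gamma = mu / 2]. *)
Definition init_run (y0 : 'rV[R]_m) (v : 'rV[R]_n) : prog R n m 'rV[R]_n :=
  let! (u, _, _) := block (fun x => CallX x y0 Ret) v (mu pb / 2) (mu pb) (L pb)
                          (ceiln (Num.sqrt (8 * kappa))) in
  Ret u.

Definition initialization (y0 : 'rV[R]_m) (v : 'rV[R]_n) : prog R n m 'rV[R]_n :=
  let E0 := B in
  let! v' := repeat (1 + ceiln (log2_plus (mu pb * R_x pb ^+ 2 / (4 * E0))))
                    (init_run y0) v in
  init_run y0 v'.

Definition Gam : R := mu pb * chibar.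
Definition LPhi : R := 1 + L pb / (4 * Gam).
Definition inner_k : nat := ceiln (2 * Num.sqrt LPhi).
Definition APhi : R := inner_k%:R * (inner_k%:R + 3) / (4 * LPhi).
Definition theta : R := APhi / (1 + APhi).
Definition outer_K : nat := ceiln (8 * Num.sqrt (chibar / theta)).
Definition c_delta : R := chibar / (4 * outer_K%:R ^+ 3).

Section TwoPoint.
Variable maxy : 'rV[R]_n -> R -> prog R n m 'rV[R]_m.

(* The state is [(A, u, z)].  By the chain rule the gradient of
   [Phi p = Ap / theta * f (w p) y + 1 / 2 * |p - z|^2] is [gradPhi p], as
   [w] is affine with linear part [a / Ap]. *)
Definition two_point_step (delta : R) (s : R * 'rV[R]_n * 'rV[R]_n) :
    prog R n m (R * 'rV[R]_n * 'rV[R]_n) :=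
  let: (A, u, z) := s in
  let a := get [set a : R | 0 < a /\ a ^+ 2 = theta * (A + a) / (4 * Gam)] in
  let Ap := A + a in
  let w p := Ap^-1 *: (A *: u + a *: p) in
  let! y := maxy (w z) delta in
  let gradPhi p :=
    let! g := CallX (w p) y Ret in
    Ret ((Ap / theta * (a / Ap)) *: g + (p - z)) in
  let! (p, zp, _) := block gradPhi z 1 (1 + mu pb / (4 * Gam)) LPhi inner_k in
  Ret (Ap, w p, zp).

Definition stage (E : R) (w : 'rV[R]_n) : prog R n m 'rV[R]_n :=
  let! (_, u, _) := repeat outer_K (two_point_step (c_delta * E)) (0, w, w) in
  Ret u.

(* [None] means that the loop was not finished within [fuel] passes. *)
Fixpoint while_loop (eps : R) (fuel : nat) (E : R) (w : 'rV[R]_n) :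
    prog R n m (option (R * 'rV[R]_n)) :=
  if E > eps / (6 * chibar ^+ 2) then
    match fuel with
    | 0 => Ret None
    | fuel'.+1 => let! w' := stage E w in while_loop eps fuel' (E / 2) w'
    end
  else Ret (Some (E, w)).

Definition two_point (eps : R) (y0 : 'rV[R]_m) (v : 'rV[R]_n) (fuel : nat) :
    prog R n m (option ('rV[R]_n * 'rV[R]_m)) :=
  let! w := initialization y0 v in
  let! r := while_loop eps fuel (2 * B) w in
  match r with
  | None => Ret None
  | Some (E, xhat) =>
      let! yhat := maxy xhat (c_delta * E) in Ret (Some (xhat, yhat))
  end.

End TwoPoint.

Section Executions.
Variables (f : 'rV[R]_n -> 'rV[R]_m -> R).
Variables (gx : 'rV[R]_n -> 'rV[R]_m -> 'rV[R]_n).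
Variables (gy : 'rV[R]_n -> 'rV[R]_m -> 'rV[R]_m).

Definition exec T (p : prog R n m T) : outcome T :=
  run gx (fun x y => (f x y, gy x y)) p.

Definition init_cost (y0 : 'rV[R]_m) (v : 'rV[R]_n) : nat :=
  calls_x (exec (initialization y0 v)).

Definition is_maxy (maxy : 'rV[R]_n -> R -> prog R n m 'rV[R]_m)
    (N_y : R -> nat) :=
  forall x delta, X x -> 0 < delta ->
    let o := exec (maxy x delta) in
    [/\ delta_maximizer Y (f x) delta (output o),
        calls_x o = 0%N & (calls_y o <= N_y delta)%N].

(* The algorithm stops with an [eps]-saddle point, with [T_x] within [tx] of
   the cost of initialization and [T_y] at most [ty]. *)
Definition two_point_succeeds maxy (eps : R) y0 v (tx ty : R) :=
  exists fuel xhat yhat,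
    let o := exec (two_point maxy eps y0 v fuel) in
    [/\ output o = Some (xhat, yhat),
        X xhat /\ Y yhat,
        Gap f xhat yhat <= eps,
        `|(calls_x o)%:R - (init_cost y0 v)%:R| <= tx &
        (calls_y o)%:R <= ty].

End Executions.
End Problem.

(* Main.v *)
(* A block is an accelerated gradient method: its estimate function, an
   explicit quadratic, lies below [A F + pi] and above [A F(u)] at its minimizer
   [z], which gives
     A F(u_k) + (gamma + mu_F A) / 2 |x - z_k|^2
       <= A F(x) + gamma / 2 |x - xbar|^2   for all x in X.
   If [y] is a delta-maximizer of [f v] then
     f(x, y) <= P(x) <= f(x, y) + 2 delta + mu chi |x - v|^2,
   and the quadratic error is what the proximal term of [Phi_i] pays for because
   [Gamma = mu (1 + chi)]. Hence every inner block decreases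
   [A (P(u) - P(x)) + |x - z|^2 / 2] up to [2 delta A^+], and one stage halves
   the accuracy [E]. The gap at the end is bounded by testing
   the same inequality at points of the segment from [xhat] to a competitor, so
   no minimax theorem is needed.

   For the center of gravity: Prekopa-Leindler, by induction on the dimension,
   gives Brunn-Minkowski at midpoints, hence log-concavity of the tails
   [s |-> vol {y in K | s <= g.(y - c)}]. Comparing a log-concave sequence with
   a geometric one having the same ratio at [c] yields Gruenbaum's inequality:
   a cut through the center of gravity discards at least a fraction [1 / e] of
   the volume. When the remaining volume is below
   [(delta / B)^m vol Y], the copy of [Y] shrunk by [a > delta / B] towards any [z]
   has a point outside the remaining set, and concavity of [f x] finishes. *)

Require Import Defs.
From mathcomp Require Import all_boot all_order all_algebra.
From mathcomp Require Import all_classical all_reals all_analysis.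
From mathcomp Require Import measurable_realfun.
From mathcomp Require Import ring lra zify.

Set Implicit Arguments.
Unset Strict Implicit.
Unset Printing Implicit Defensive.

Import Order.TTheory GRing.Theory Num.Theory numFieldNormedType.Exports.
Local Open Scope classical_set_scope.
Local Open Scope ring_scope.

(** * Prekopa-Leindler and Brunn-Minkowski *)

(** The obstacle is that [P] is seen only through inexact maximizers [y_i], each giving another
    smooth model. The step equation [a^2 = theta A^+ / (4 Gamma)] is built for this. The map [w_i]
    contracts displacements by [a / A^+], so with the weight [A^+ / theta] the curvature of
    [f(., y_i)] enters [Phi_i] divided by [4 Gamma]. A block therefore costs about
    [sqrt(1 + L / (4 Gamma))] gradients, and the model error [mu chi |w_i(p) - w_i(z)|^2], weighted
    by [A^+], is at most [theta / 4 |p - z|^2], half of what the proximal term pays. A stage needs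
    [A_K >= 4 / mu], which [K] of order [sqrt(chibar)] achieves. Since [chibar (1 + L / (4 Gamma)) =
    1 + chi + kappa / 4], the product [K k] is of order [sqrt(kappa + chi)]. With [c_delta] of order
    [chibar / K^3], hence at least of order [chibar^(-1/2)], and [E] never below
    [eps / (12 chibar^2)], the smallest accuracy requested has order [eps / chibar^(5/2)]. On the
    volume side Brunn-Minkowski is kept as a product, [vol A vol B <= (vol C)^2], because this form
    passes through slicing and is already log-concavity of the tails at midpoints. *)

Section LebesgueLine.
Context {R : realType}.
Local Notation RR := (measurableTypeR R).
Local Notation leb := (@lebesgue_measure R).
Implicit Types (A B C : set RR) (a b : R).

Lemma measurable_affine a b : measurable_fun setT (fun x : RR => a * x + b : RR).
Proof.
by apply: measurable_funD => //; exact: measurable_funM.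
Qed.

(** Both sides are measures that agree on half-open intervals, so uniqueness of Lebesgue measure
    settles every Borel set. *)
Lemma lebesgue_affine a b A : 0 < a -> measurable A ->
  leb A = (a%:E * leb [set x | A (a * x + b)%R])%E.
Proof.
move=> a0 mA.
have mf := measurable_affine a b.
pose P := measure_function_pushforward__canonical__measure_function_Measure leb mf.
pose Q : {measure set RR -> \bar R} := mscale (NngNum (ltW a0)) P.
rewrite (@lebesgue_measure_unique _ Q)// => _ [[c d]] _ <- /=.
rewrite /mscale /= /pushforward /=.
rewrite (_ : _ @^-1` _ = `](c - b) / a, (d - b) / a]%classic); last first.
  apply/seteqP; split=> x /=; rewrite !in_itv/= ltr_pdivrMr// ler_pdivlMr// ltrBlDr lerBrDr;
    by rewrite mulrC.
rewrite !lebesgue_measure_itv/= !lte_fin ltr_pM2r ?invr_gt0// ltrD2r.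
case: ifP => _; last by rewrite mule0.
by rewrite -EFinM; congr (_%:E); field; rewrite gt_eqF.
Qed.

(* Translates of [A] and of [B] by half an extreme point of the other set meet
   in at most one point of the midpoint set. *)
Lemma brunn_minkowski_line A B C (M : R) :
  measurable A -> measurable B -> measurable C ->
  A !=set0 -> B !=set0 ->
  (forall x, A x -> x <= M) -> (forall x, B x -> - M <= x) ->
  (forall x y, A x -> B y -> C ((x + y) / 2)) ->
  (leb A + leb B <= 2%:E * leb C)%E.
Proof.
move=> mA mB mC A0 B0 AM BM ABC.
have supA : has_sup A by split=> //; exists M => x /AM.
have infB : has_inf B by split=> //; exists (- M) => x /BM.
apply/lee_addgt0Pr => _/posnumP[e].
have e2 : 0 < e%:num / 2 :> R by [].
have [a0 Aa0 a0P] := sup_adherent e2 supA.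
have [b0 Bb0 b0P] := inf_adherent e2 infB.
pose A1 := A `&` `]-oo, a0]; pose B1 := B `&` `]b0, +oo[.
have mA1 : measurable A1 by apply: measurableI => //; exact: measurable_itv.
have mB1 : measurable B1 by apply: measurableI => //; exact: measurable_itv.
have Ale : (leb A <= leb A1 + (e%:num / 2)%:E)%E.
  apply: (@le_trans _ _ (leb (A1 `|` `[a0, sup A]))).
    apply: le_measure; rewrite ?inE//; first exact: measurableU.
    move=> x Ax; rewrite /A1 /= !in_itv /=; case: (leP x a0) => xa; first by left.
    by right; rewrite ltW//=; apply: sup_upper_bound.
  apply: (le_trans (measureU2 _ _ _)) => //.
  apply: leeD => //; rewrite [leLHS]lebesgue_measure_itv/= lte_fin.
  by case: ifP => _; rewrite lee_fin//; lra.
have Ble : (leb B <= leb B1 + (e%:num / 2)%:E)%E.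
  apply: (@le_trans _ _ (leb (B1 `|` `[inf B, b0]))).
    apply: le_measure; rewrite ?inE//; first exact: measurableU.
    move=> x Bx; rewrite /B1 /= !in_itv /=; case: (ltP b0 x) => xa; first by left.
    by right; rewrite andbT; apply: ge_inf => //; case: infB.
  apply: (le_trans (measureU2 _ _ _)) => //.
  apply: leeD => //; rewrite [leLHS]lebesgue_measure_itv/= lte_fin.
  by case: ifP => _; rewrite lee_fin//; lra.
pose P : set RR := [set x | A1 (2 * x + - b0)].
pose Q : set RR := [set x | B1 (2 * x + - a0)].
have mP : measurable P by rewrite -[P]setTI; exact: (measurable_affine 2 (- b0)).
have mQ : measurable Q by rewrite -[Q]setTI; exact: (measurable_affine 2 (- a0)).
have PQ : [disjoint P & Q].
  apply/eqP; rewrite predeqE => x; split=> // -[[_ /=]].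
  rewrite in_itv/= => h1 [_ /=]; rewrite in_itv/= => h2; lra.
have PQC : P `|` Q `<=` C.
  move=> x [] [Hx _]; [have := ABC _ _ Hx Bb0|have := ABC _ _ Aa0 Hx];
  by rewrite (_ : _ / 2 = x)//; field.
have : (leb P + leb Q <= leb C)%E.
  rewrite -measureU//; last exact/eqP.
  by apply: le_measure; rewrite ?inE//; exact: measurableU.
have := lebesgue_affine (- b0) (ltr0Sn R 1) mA1; rewrite -/P => A1E.
have := lebesgue_affine (- a0) (ltr0Sn R 1) mB1; rewrite -/Q => B1E.
move=> PQle.
apply: (@le_trans _ _ ((leb A1 + (e%:num / 2)%:E) + (leb B1 + (e%:num / 2)%:E)))%E.
  exact: leeD.
rewrite addeACA -EFinD -splitr leeD2r// A1E B1E -ge0_muleDr//.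
by rewrite lee_pmul2l.
Qed.

End LebesgueLine.

(** * Prekopa-Leindler on the line *)

Section PrekopaLeindlerLine.
Context {R : realType}.
Local Notation RR := (measurableTypeR R).
Local Notation leb := (@lebesgue_measure R).
Implicit Types (f g h : RR -> R).

Lemma measurable_superlevel f (r : R) : measurable_fun setT f ->
  measurable [set x : RR | r < f x].
Proof.
move=> mf; have := mf measurableT _ (measurable_itv `]r, +oo[).
by rewrite setTI; congr (measurable _); apply/seteqP; split=> x /=; rewrite in_itv/= andbT.
Qed.

Lemma measurable_hypograph f : measurable_fun setT f ->
  measurable [set p : RR * RR | p.2 < f p.1].
Proof.
move=> mf.
have -> : [set p : RR * RR | p.2 < f p.1] = setT `&` (fun p => f p.1 - p.2) @^-1` `]0, +oo[.
  by apply/seteqP; split=> -[x r] /=; rewrite in_itv/= andbT subr_gt0// => -[].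
have m : measurable_fun setT (fun p : RR * RR => f p.1 - p.2).
  apply: measurable_funB; last exact: measurable_snd.
  by apply: measurableT_comp => //; exact: measurable_fst.
by apply: m => //; exact: measurable_itv.
Qed.

(** Tonelli for the region [D] under the graph: its vertical sections have length [f x], its
    horizontal sections are the superlevel sets. *)
Lemma layer_cake f : measurable_fun setT f -> (forall x, 0 <= f x) ->
  (\int[leb]_x (f x)%:E = \int[leb]_(r in `[0%R, +oo[) leb [set x | (r < f x)%R])%E.
Proof.
move=> mf f0.
pose D : set (RR * RR) := [set p | 0 <= p.2 < f p.1].
have mD : measurable D.
  have -> : D = (setT `&` snd @^-1` `[0, +oo[) `&` [set p | p.2 < f p.1].
    apply/seteqP; split=> -[x r]; rewrite /D /= !in_itv /= !andbT.
      by move=> /andP[].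
    by move=> [[_ ->] ->].
  apply: measurableI; last exact: measurable_hypograph.
  by apply: measurable_snd => //; exact: measurable_itv.
have := indic_fubini_tonelli leb leb mD.
rewrite indic_fubini_tonelli_FE// indic_fubini_tonelli_GE//= => DE.
transitivity (\int[leb]_x (leb \o xsection D) x)%E.
  apply: eq_integral => x _ /=.
  rewrite (_ : xsection D x = `[0, f x[%classic).
    by rewrite [RHS]lebesgue_measure_itv/= lte_fin -EFinB subr0; case: (ltgtP 0 (f x)) (f0 x) => // <-.
  by rewrite xsectionE; apply/seteqP; split=> r; rewrite /D /= in_itv.
rewrite DE [RHS]integral_mkcond; apply: eq_integral => r _.
rewrite patchE; case: ifPn => [/set_mem|/negP r0]; rewrite /= ?in_itv/= ?andbT.
  move=> r0; by rewrite ysectionE; congr (leb _); apply/seteqP; split=> x; rewrite /D /= r0.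
rewrite (_ : ysection D r = set0) ?measure0//.
by rewrite ysectionE -subset0 => x; rewrite /D /= => /andP[r0' _]; apply: r0; apply/mem_set; rewrite /= in_itv /= r0'.
Qed.

(** Since [f] and [g] both have supremum 1, their superlevel sets are nonempty at exactly the same
    levels, those below 1. There [brunn_minkowski_line] applies, with the superlevel set of [h] as
    midpoint set, and the layer-cake formula integrates the result over the level. *)
Lemma prekopa_leindler_normalized f g h (M : R) :
  measurable_fun setT f -> measurable_fun setT g -> measurable_fun setT h ->
  (forall x, 0 <= f x <= 1) -> (forall x, 0 <= g x <= 1) -> (forall x, 0 <= h x) ->
  (forall r, r < 1 -> exists x, r < f x) ->
  (forall r, r < 1 -> exists x, r < g x) ->
  (forall x, M < `|x| -> f x = 0) -> (forall x, M < `|x| -> g x = 0) ->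
  (forall x y, f x * g y <= h ((x + y) / 2) ^+ 2) ->
  (\int[leb]_x (f x)%:E + \int[leb]_x (g x)%:E <= 2%:E * \int[leb]_x (h x)%:E)%E.
Proof.
move=> mf mg mh f01 g01 h0 supf supg fM gM fgh.
have f0 x : 0 <= f x by case/andP: (f01 x).
have g0 x : 0 <= g x by case/andP: (g01 x).
have mlev (k : RR -> R) : measurable_fun setT k -> (forall x, 0 <= k x) ->
    measurable_fun (`[0%R, +oo[ : set RR) ((fun r => leb [set x | (r < k x)%R]) : RR -> \bar R).
  move=> mk k0.
  have mD := measurable_hypograph mk.
  apply: measurable_funTS.
  have := measurable_fun_ysection leb mD.
  congr (measurable_fun _ _); by apply/funext => r /=; rewrite ysectionE.
rewrite !layer_cake// -ge0_integralZl//; last exact: mlev.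
rewrite -ge0_integralD//; [|exact: mlev..].
apply: ge0_le_integral => //=.
- by move=> r _; rewrite adde_ge0.
- exact: emeasurable_funD (mlev _ mf f0) (mlev _ mg g0).
- exact: measurable_funeM (mlev _ mh h0).
move=> r; rewrite in_itv/= andbT => r0.
have [r1|r1] := ltP r 1; last first.
  rewrite (_ : [set x | r < f x] = set0); last first.
    by rewrite -subset0 => x /=; have := f01 x; lra.
  rewrite (_ : [set x | r < g x] = set0); last first.
    by rewrite -subset0 => x /=; have := g01 x; lra.
  by rewrite measure0 adde0 mule_ge0.
apply: (@brunn_minkowski_line _ _ _ _ M); try exact: measurable_superlevel.
- exact: supf.
- exact: supg.
- move=> x /= rf; rewrite leNgt; apply/negP => Mx.
  by move: rf; rewrite fM; [rewrite ltNge r0|exact: lt_le_trans Mx (ler_norm _)].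
- move=> x /= rg; rewrite leNgt; apply/negP => Mx.
  move: rg; rewrite gM; first by rewrite ltNge r0.
  by have := ler_norm (- x); rewrite normrN; lra.
move=> x y /= rf rg; have := fgh x y.
have : r * r < f x * g y by apply: ltr_pM.
rewrite -expr2 => lt1 le1; have := lt_le_trans lt1 le1.
by rewrite ltr_pXn2r// nnegrE.
Qed.

(** Dividing [f], [g], [h] by [a = sup f], [b = sup g] and [sqrt(a b)] preserves the pointwise
    hypothesis and reduces to the normalized case. *)
Lemma prekopa_leindler_line f g h (M Q : R) :
  measurable_fun setT f -> measurable_fun setT g -> measurable_fun setT h ->
  (forall x, 0 <= f x <= Q) -> (forall x, 0 <= g x <= Q) -> (forall x, 0 <= h x) ->
  (forall x, M < `|x| -> f x = 0) -> (forall x, M < `|x| -> g x = 0) ->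
  (forall x y, f x * g y <= h ((x + y) / 2) ^+ 2) ->
  (\int[leb]_x (f x)%:E * \int[leb]_x (g x)%:E <=
   (\int[leb]_x (h x)%:E) * (\int[leb]_x (h x)%:E))%E.
Proof.
move=> mf mg mh fQ gQ h0 fM gM fgh.
have f0 x : 0 <= f x by case/andP: (fQ x).
have g0 x : 0 <= g x by case/andP: (gQ x).
have hass (k : RR -> R) : (forall x, 0 <= k x <= Q) -> has_sup (range k).
  move=> kQ; split; first by exists (k point); exists point.
  by exists Q => _ [x _ <-]; case/andP: (kQ x).
have int0 (k : RR -> R) : (forall x, 0 <= k x <= Q) -> sup (range k) <= 0 -> (\int[leb]_x (k x)%:E = 0)%E.
  move=> kQ k0; rewrite integral0_eq// => x _.
  congr (_%:E); apply/eqP; rewrite eq_le; case/andP: (kQ x) => -> _; rewrite andbT.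
  apply: le_trans k0; apply: sup_upper_bound; first exact: hass.
  by exists x.
have hI : (0 <= \int[leb]_x (h x)%:E)%E by apply: integral_ge0 => x _; rewrite lee_fin.
set a := sup (range f); set b := sup (range g).
have [a0|a0] := leP a 0; first by rewrite (int0 f)// mul0e mule_ge0.
have [b0|b0] := leP b 0; first by rewrite (int0 g)// mule0 mule_ge0.
have ab0 : 0 < a * b by rewrite mulr_gt0.
set c := Num.sqrt (a * b); have c0 : 0 < c by rewrite sqrtr_gt0.
have c2 : c ^+ 2 = a * b by rewrite sqr_sqrtr ?ltW.
have nrm (k : RR -> R) s : (forall x, 0 <= k x) -> measurable_fun setT k -> 0 < s ->
    (\int[leb]_x (s^-1 * k x)%:E = (s^-1)%:E * \int[leb]_x (k x)%:E)%E.
  move=> k0 mk s0; under eq_integral do rewrite EFinM.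
  rewrite ge0_integralZl//; last by rewrite lee_fin invr_ge0 ltW.
    exact/measurable_EFinP.
  by move=> x _; rewrite lee_fin.
have key : (\int[leb]_x (a^-1 * f x)%:E + \int[leb]_x (b^-1 * g x)%:E <=
            2%:E * \int[leb]_x (c^-1 * h x)%:E)%E.
  apply: (@prekopa_leindler_normalized _ _ _ M);
    try by apply: measurable_funM.
  - move=> x; rewrite mulr_ge0 ?invr_ge0 ?(ltW a0)//= mulrC ler_pdivrMr// mul1r.
    by apply: sup_upper_bound; [exact: hass|exists x].
  - move=> x; rewrite mulr_ge0 ?invr_ge0 ?(ltW b0)//= mulrC ler_pdivrMr// mul1r.
    by apply: sup_upper_bound; [exact: hass|exists x].
  - by move=> x; rewrite mulr_ge0 ?invr_ge0 ?(ltW c0).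
  - move=> r r1; have : 0 < (1 - r) * a by rewrite mulr_gt0 ?subr_gt0.
    move=> /sup_adherent -/(_ _ (hass _ fQ)) [_ [x _ <-]].
    rewrite -/a => rx; exists x; rewrite mulrC ltr_pdivlMr//.
    by apply: le_lt_trans rx; lra.
  - move=> r r1; have : 0 < (1 - r) * b by rewrite mulr_gt0 ?subr_gt0.
    move=> /sup_adherent -/(_ _ (hass _ gQ)) [_ [x _ <-]].
    rewrite -/b => rx; exists x; rewrite mulrC ltr_pdivlMr//.
    by apply: le_lt_trans rx; lra.
  - by move=> x /fM ->; rewrite mulr0.
  - by move=> x /gM ->; rewrite mulr0.
  - move=> x y; rewrite exprMn exprVn c2 mulrACA -invfM.
    by apply: ler_wpM2l => //; rewrite invr_ge0 ltW.
move: key; rewrite !nrm//.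
have fI : (0 <= \int[leb]_x (f x)%:E)%E by apply: integral_ge0 => x _; rewrite lee_fin.
have gI : (0 <= \int[leb]_x (g x)%:E)%E by apply: integral_ge0 => x _; rewrite lee_fin.
move: hI fI gI.
case: (\int[leb]_x (h x)%:E)%E => [z||]//; last first.
  by move=> _ _ _ _; rewrite mulyy leey.
case: (\int[leb]_x (f x)%:E)%E => [x||]//; case: (\int[leb]_x (g x)%:E)%E => [y||]//; last 3 first.
- by rewrite gt0_muley ?lte_fin ?invr_gt0.
- by rewrite gt0_muley ?lte_fin ?invr_gt0.
- by rewrite !gt0_muley ?lte_fin ?invr_gt0.
rewrite -!EFinM -EFinD !lee_fin => z0 x0 y0 key.
(* The arithmetic-geometric mean inequality turns the sum into a product; the scaling factors cancel
   because [c ^+ 2 = a * b]. *)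
have sq : (a^-1 * x + b^-1 * y) ^+ 2 <= (2 * (c^-1 * z)) ^+ 2.
  by rewrite ler_pXn2r// nnegrE ?addr_ge0 ?mulr_ge0 ?invr_ge0// ltW.
have : 4 * ((a^-1 * x) * (b^-1 * y)) <= 4 * (c^-1 * z) ^+ 2.
  by have := sqr_ge0 (a^-1 * x - b^-1 * y); nra.
rewrite ler_pM2l// exprMn exprVn c2 mulrACA -invfM ler_pM2l ?invr_gt0//.
Qed.

End PrekopaLeindlerLine.

(** * Volumes of sets of tuples, by slicing along the first coordinate *)

Section LebesgueTuple.
Context {R : realType}.
Local Notation RR := (measurableTypeR R).
Local Notation leb := (@lebesgue_measure R).
Local Notation vol := (@lebesgue_tuple R).

Definition slice d (A : set (d.+1.-tuple RR)) (x : RR) : set (d.-tuple RR) :=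
  [set t : d.-tuple RR | A [tuple of x :: t]].

Implicit Types M : R.

Lemma measurable_tuple_slice d (A : set (d.+1.-tuple RR)) (x : RR) :
  measurable A -> measurable (slice A x).
Proof.
move=> mA.
have := @measurable_cons _ _ (d.-tuple RR) RR (fun=> x) d id
  (measurable_cst _) (@measurable_id _ _ _).
by move=> /(_ measurableT _ mA); rewrite setTI.
Qed.

Lemma measurable_tuple_uncurry d (A : set (d.+1.-tuple RR)) :
  measurable A ->
  measurable [set p : RR * d.-tuple RR | A [tuple of p.1 :: p.2]].
Proof.
move=> mA.
have := @measurable_cons _ _ (RR * d.-tuple RR)%type RR fst d snd
  measurable_fst measurable_snd.
by move=> /(_ measurableT _ mA); rewrite setTI.
Qed.

Lemma lebesgue_tupleS d (A : set (d.+1.-tuple RR)) :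
  vol d.+1 A = (\int[leb]_x vol d (slice A x))%E.
Proof.
rewrite /= /pushforward /= /product_measure1; apply: eq_integral => x _ /=.
by rewrite xsectionE.
Qed.

Lemma measurable_fun_slice d (A : set (d.+1.-tuple RR)) : measurable A ->
  measurable_fun setT (fun x : RR => vol d (slice A x)).
Proof.
move=> /measurable_tuple_uncurry /(measurable_fun_xsection (vol d)).
by congr (measurable_fun _ _); apply/funext => x /=; rewrite xsectionE.
Qed.

Definition tuple_bounded d (M : R) (A : set (d.-tuple RR)) :=
  forall t, A t -> forall i, `|tnth t i| <= M.

Lemma tuple_bounded_slice d M (A : set (d.+1.-tuple RR)) x :
  tuple_bounded M A -> tuple_bounded M (slice A x).
Proof.
move=> bA t /bA /= bt i; have := bt (lift ord0 i).
by rewrite tnthS (tnth_nth 0).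
Qed.

Lemma tuple_bounded_slice0 d M (A : set (d.+1.-tuple RR)) x :
  tuple_bounded M A -> M < `|x| -> (slice A x) = set0.
Proof.
move=> bA xM; rewrite -subset0 => t /bA /(_ ord0).
by rewrite tnth0 leNgt xM.
Qed.

Lemma lebesgue_tuple_le d M (A : set (d.-tuple RR)) : 0 <= M -> measurable A ->
  tuple_bounded M A -> (vol d A <= ((2 * M) ^+ d)%:E)%E.
Proof.
move=> M0; elim: d A => [|d IH] A mA bA.
  by rewrite expr0 /= diracE lee_fin; case: (_ \in _).
rewrite lebesgue_tupleS.
pose J : set RR := `[- M, M]%classic.
pose I : \bar R := (\int[leb]_(x in J) ((2 * M) ^+ d)%:E)%E.
apply: (@le_trans _ _ I); last first; rewrite /I.
  rewrite integral_cst/=; last exact: measurable_itv.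
  rewrite [X in (_ * X)%E]lebesgue_measure_itv/= lte_fin.
  case: ifP => _; last by rewrite mule0 lee_fin exprn_ge0// mulr_ge0.
  by rewrite -EFinD -EFinM lee_fin exprSr opprK le_eqVlt; apply/orP; left; apply/eqP; ring.
rewrite [leRHS]integral_mkcond; apply: ge0_le_integral => //.
- exact: measurable_fun_slice.
- apply/(measurable_restrictT _ _).1 => //; exact: measurable_itv.
move=> x _; rewrite patchE; case: ifPn => xM.
  apply: IH; [exact: measurable_tuple_slice|exact: tuple_bounded_slice].
rewrite (tuple_bounded_slice0 bA) ?measure0//.
rewrite ltNge; apply: contra xM => xM; apply/mem_set.
by rewrite /J /= in_itv/= -ler_norml.
Qed.

Lemma lebesgue_tuple_fin_num d M (A : set (d.-tuple RR)) : measurable A ->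
  tuple_bounded M A -> vol d A \is a fin_num.
Proof.
move=> mA bA; rewrite ge0_fin_numE//.
apply: (@le_lt_trans _ _ ((2 * `|M|) ^+ d)%:E); last exact: ltry.
by apply: lebesgue_tuple_le => // t /bA + i => /(_ i) /le_trans; apply; exact: ler_norm.
Qed.

(** By the induction hypothesis, the volumes of the slices of [A] at [x], of [B] at [y] and of [C]
    at [(x + y) / 2] satisfy the pointwise hypothesis of [prekopa_leindler_line], and the integrals
    of slice volumes are the volumes. Boundedness keeps slice volumes finite and uniformly
    bounded. *)
Lemma brunn_minkowski_midpoint d M (A B C : set (d.-tuple RR)) :
  measurable A -> measurable B -> measurable C ->
  tuple_bounded M A -> tuple_bounded M B -> tuple_bounded M C ->
  (forall s t, A s -> B t ->
    C [tuple (tnth s i + tnth t i) / 2 | i < d]) ->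
  (vol d A * vol d B <= vol d C * vol d C)%E.
Proof.
elim: d A B C => [|d IH] A B C mA mB mC bA bB bC ABC.
  have t0 (t : 0.-tuple RR) : t = [tuple] by apply: tuple0.
  rewrite /= !diracE.
  have [A0|] := boolP (_ \in A); last by rewrite mul0e => _; rewrite mule_ge0 ?lee_fin.
  have [B0|] := boolP (_ \in B); last by rewrite mule0 => _; rewrite mule_ge0 ?lee_fin.
  rewrite (_ : _ \in C = true) ?mule1//; apply/mem_set.
  have := ABC _ _ (set_mem A0) (set_mem B0).
  by rewrite [X in C X]t0.
pose s (X : set (d.+1.-tuple RR)) (x : RR) := vol d (slice X x).
have sfin X x : measurable X -> tuple_bounded M X -> s X x \is a fin_num.
  move=> mX bX; apply: (@lebesgue_tuple_fin_num _ M).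
    exact: measurable_tuple_slice.
  exact: tuple_bounded_slice.
have sE X : measurable X -> tuple_bounded M X ->
    vol d.+1 X = (\int[leb]_x (fine (s X x))%:E)%E.
  move=> mX bX; rewrite lebesgue_tupleS; apply: eq_integral => x _.
  by rewrite fineK//; exact: sfin.
have ms X : measurable X -> measurable_fun setT (fine \o s X).
  move=> mX; apply: measurableT_comp; first exact: fine_measurable.
  exact: measurable_fun_slice.
have s0 X x : 0 <= fine (s X x) by exact: fine_ge0.
have sQ X x : measurable X -> tuple_bounded M X -> 0 <= fine (s X x) <= (2 * `|M|) ^+ d.
  move=> mX bX; rewrite s0/= -lee_fin fineK; last exact: sfin.
  apply: lebesgue_tuple_le => //; first exact: measurable_tuple_slice.
  by move=> t /(tuple_bounded_slice bX) + i => /(_ i) /le_trans; apply; exact: ler_norm.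
have sM X x : tuple_bounded M X -> M < `|x| -> fine (s X x) = 0.
  by move=> bX xM; rewrite /s (tuple_bounded_slice0 bX)// measure0.
rewrite !sE//.
apply: (@prekopa_leindler_line _ _ _ _ M ((2 * `|M|) ^+ d)); try exact: ms.
- by move=> x; exact: sQ.
- by move=> x; exact: sQ.
- by move=> x.
- by move=> x; exact: sM.
- by move=> x; exact: sM.
move=> x y; rewrite -lee_fin expr2 !EFinM !fineK; [|exact: sfin..].
apply: IH; [exact: measurable_tuple_slice..| | | |];
  try exact: tuple_bounded_slice.
move=> t u At Bu; rewrite /=.
have := ABC _ _ At Bu; congr (C _); apply/eq_from_tnth => i.
rewrite tnth_mktuple.
case: (unliftP ord0 i) => [j|] ->; last by rewrite !tnth0.
by rewrite !tnthS !tnth_mktuple; congr ((_ + _) / 2); rewrite (tnth_nth 0) [RHS](tnth_nth 0).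
Qed.

End LebesgueTuple.

Section LebesgueTupleAffine.
Context {R : realType}.
Local Notation RR := (measurableTypeR R).
Local Notation leb := (@lebesgue_measure R).
Local Notation vol := (@lebesgue_tuple R).

Lemma ge0_integral_affine (a b : R) (F : RR -> \bar R) : 0 < a ->
  measurable_fun setT F -> (forall x, 0 <= F x)%E ->
  (\int[leb]_x F x = a%:E * \int[leb]_x F (a * x + b)%R)%E.
Proof.
move=> a0 mF F0.
have mf := measurable_affine a b.
pose P := measure_function_pushforward__canonical__measure_function_Measure leb mf.
pose Q : {measure set RR -> \bar R} := mscale (NngNum (ltW a0)) P.
rewrite (@eq_measure_integral _ _ _ _ Q); last first.
  by move=> A mA _; exact: (lebesgue_affine b a0 mA).
rewrite ge0_integral_mscale//=; congr (_ * _)%E.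
by rewrite ge0_integral_pushforward//= preimage_setT.
Qed.

Definition tuple_affine d (a : R) (b : 'I_d -> R) (t : d.-tuple RR) : d.-tuple RR :=
  [tuple a * tnth t i + b i | i < d].

Lemma measurable_tuple_affine d a (b : 'I_d -> R) : measurable_fun setT (tuple_affine a b).
Proof.
apply/measurable_fun_tnthP => i.
rewrite (_ : _ \o _ = fun t => a * tnth t i + b i); last first.
  by apply/funext => t /=; rewrite tnth_mktuple.
apply: measurable_funD => //; apply: measurable_funM => //.
exact: measurable_tnth.
Qed.

Lemma lebesgue_tuple_affine d a (b : 'I_d -> R) (A : set (d.-tuple RR)) :
  0 < a -> measurable A ->
  vol d A = ((a ^+ d)%:E * vol d (tuple_affine a b @^-1` A))%E.
Proof.
move=> a0; elim: d b A => [|d IH] b A mA.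
  rewrite expr0 mul1e /= !diracE; have e : tuple_affine a b [tuple] = [tuple] by apply: tuple0.
  suff -> : ([tuple] \in tuple_affine a b @^-1` A) = ([tuple] \in A) by [].
  by apply/idP/idP => /set_mem h; apply/mem_set; move: h; rewrite /preimage /= e.
have mpA : measurable (tuple_affine a b @^-1` A).
  by rewrite -[X in measurable X]setTI; exact: measurable_tuple_affine.
have sliceE x : tuple_affine a (fun i => b (lift ord0 i)) @^-1` slice A (a * x + b ord0) =
    slice (tuple_affine a b @^-1` A) x.
  apply/seteqP; split=> t; rewrite /slice /tuple_affine /=;
  congr (A _); apply/eq_from_tnth => i;
  case: (unliftP ord0 i) => [j|] ->; rewrite ?tnthS ?tnth0 ?tnth_mktuple ?tnthS ?tnth0//.
rewrite !lebesgue_tupleS (ge0_integral_affine (b ord0) a0)//; last first.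
  exact: measurable_fun_slice.
under eq_integral => x _.
  rewrite (IH (fun i => b (lift ord0 i))); last exact: measurable_tuple_slice.
  rewrite sliceE; over.
rewrite ge0_integralZl//; last 2 first.
- exact: (measurable_fun_slice mpA).
- by rewrite lee_fin exprn_ge0// ltW.
by rewrite muleA -EFinM -exprS.
Qed.

End LebesgueTupleAffine.

(** * Null hyperplanes, boxes, and measurability of open and closed sets *)

Section LebesgueTupleSets.
Context {R : realType}.
Local Notation RR := (measurableTypeR R).
Local Notation leb := (@lebesgue_measure R).
Local Notation vol := (@lebesgue_tuple R).

Definition tuple_dot d (g : 'I_d -> R) (t : d.-tuple RR) : R := \sum_i g i * tnth t i.

Lemma measurable_tuple_dot d (g : 'I_d -> R) : measurable_fun setT (tuple_dot g).
Proof.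
apply: measurable_sum => i; apply: measurable_funM => //.
exact: measurable_tnth.
Qed.

Lemma measurable_tuple_dot_preimage d (g : 'I_d -> R) (B : set RR) :
  measurable B -> measurable [set t | B (tuple_dot g t)].
Proof. by move=> mB; rewrite -[X in measurable X]setTI; exact: measurable_tuple_dot. Qed.

Lemma tuple_dot_cons d (g : 'I_d.+1 -> R) (x : RR) (t : d.-tuple RR) :
  tuple_dot g [tuple of x :: t] = g ord0 * x + tuple_dot (fun i => g (lift ord0 i)) t.
Proof.
rewrite /tuple_dot big_ord_recl tnth0; congr (_ + _).
by apply: eq_bigr => i _; rewrite tnthS.
Qed.

(** If a later coefficient is nonzero, every slice is again a hyperplane and is null by induction.
    Otherwise only the slice at [x = c / g ord0] is nonempty, and one point is negligible. *)
Lemma lebesgue_tuple_hyperplane d (g : 'I_d -> R) (c : R) :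
  (exists i, g i != 0) -> vol d [set t | tuple_dot g t = c] = 0%E.
Proof.
elim: d g c => [|d IH] g c; first by case=> -[].
move=> [i gi]; rewrite lebesgue_tupleS.
pose H := [set t : d.+1.-tuple RR | tuple_dot g t = c].
have mH : measurable H by exact: (@measurable_tuple_dot_preimage _ _ [set c]).
have sliceE x : slice H x = [set t | tuple_dot (fun i => g (lift ord0 i)) t = c - g ord0 * x].
  by apply/seteqP; split=> t; rewrite /slice /H /= tuple_dot_cons; lra.
have [[j gj]|g0] := pselect (exists j, g (lift ord0 j) != 0).
  rewrite integral0_eq// => x _; rewrite -/H sliceE; apply: IH.
  by exists j.
have {}g0 j : g (lift ord0 j) = 0 by apply/eqP/negPn/negP => gj; apply: g0; exists j.
have g00 : g ord0 != 0.
  by move: gi; case: (unliftP ord0 i) => [j|] -> //; rewrite g0 eqxx.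
have : (\int[leb]_x vol d (slice H x) = \int[leb]_(x in [set: RR] `\` [set (c / g ord0)%R]) vol d (slice H x))%E.
  apply: ge0_negligible_integral => //; first exact: measurable_fun_slice.
  exact: lebesgue_measure_set1.
move=> ->; rewrite integral0_eq// => x [_ /= xc].
rewrite (_ : slice H x = set0) ?measure0//.
rewrite -subset0 sliceE => t /= /eqP; rewrite /tuple_dot big1; last first.
  by move=> j _; rewrite g0 mul0r.
rewrite eq_sym subr_eq0 => /eqP cE; apply: xc.
by rewrite cE mulrC mulKf.
Qed.

Lemma lebesgue_tuple_box_gt0 d (b : 'I_d -> R) (r : R) (A : set (d.-tuple RR)) :
  0 < r -> measurable A ->
  (forall t, (forall i, `|tnth t i - b i| <= r) -> A t) -> (0 < vol d A)%E.
Proof.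
move=> r0; suff H : forall A : set (d.-tuple RR), measurable A ->
    (forall t, (forall i, `|tnth t i - b i| <= r) -> A t) ->
    (((2 * r) ^+ d)%:E <= vol d A)%E.
  move=> mA bA; apply: lt_le_trans (H _ mA bA); rewrite lte_fin exprn_gt0//.
  by rewrite mulr_gt0.
elim: d b {A} => [|d IH] b A mA bA.
  by rewrite /= diracE mem_set ?expr0//; apply: bA => -[].
pose J : set RR := `[b ord0 - r, b ord0 + r]%classic.
pose I : \bar R := (\int[leb]_(x in J) ((2 * r) ^+ d)%:E)%E.
rewrite lebesgue_tupleS; apply: (@le_trans _ _ I); rewrite /I.
  rewrite integral_cst/=; last exact: measurable_itv.
  rewrite [X in (_ * X)%E]lebesgue_measure_itv/= lte_fin ifT; last lra.
  rewrite -EFinD -EFinM lee_fin exprSr le_eqVlt; apply/orP; left; apply/eqP; ring.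
rewrite integral_mkcond; apply: ge0_le_integral => //.
- move=> x _; rewrite patchE; case: ifPn => // _.
  by rewrite lee_fin exprn_ge0// mulr_ge0 ?ltW.
- by apply/(measurable_restrictT _ _).1 => //; exact: measurable_itv.
- exact: measurable_fun_slice.
move=> x _; rewrite patchE; case: ifPn => xM; last exact: measure_ge0.
apply: (IH (fun i => b (lift ord0 i))); first exact: measurable_tuple_slice.
move=> t bt; apply: bA => i; case: (unliftP ord0 i) => [j|] ->.
  by rewrite tnthS.
rewrite tnth0; move/set_mem: xM; rewrite /J /= in_itv/= => /andP[h1 h2].
by rewrite ler_norml; lra.
Qed.

(** The sigma-algebra on tuples comes from the coordinates, openness from the norm of row vectors.
    The bridge is that an open set is a countable union of cubes with rational centers and radii
    [1 / (k + 1)]. *)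
Lemma open_tuple_set_measurable d (A : set 'rV[R]_d) : open A -> measurable (tuple_set A).
Proof.
move=> oA.
pose box (q : d.-tuple rat * nat) : set (d.-tuple RR) :=
  [set t | forall i, `|tnth t i - ratr (tnth q.1 i)| < q.2.+1%:R^-1].
have mbox q : measurable (box q).
  have -> : box q = \bigcap_(i in [set: 'I_d])
      (setT `&` (fun t => tnth t i) @^-1` (ball (ratr (tnth q.1 i) : R) q.2.+1%:R^-1 : set RR)).
    apply/seteqP; split=> [t bt i _|t bt i].
      by split=> //=; rewrite /ball /= distrC; exact: bt.
    by have [_] := bt i I; rewrite /ball /= distrC.
  apply: fin_bigcap_measurable => // i _.
  by apply: measurable_tnth => //; exact: measurable_ball.
have -> : tuple_set A = \bigcup_(q in [set q | box q `<=` tuple_set A]) box q.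
  apply/seteqP; split; last by move=> t [q /= qA /qA].
  move=> t At; have := oA; rewrite openE => /(_ _ At) /nbhs_ballP [e e0 eA].
  pose n := Num.truncn (2 / e).
  (* The factor 2 accounts for the distance from [t] to the rational center plus the radius of the
     cube. *)
  have ne : 2 * n.+1%:R^-1 < e :> R.
    rewrite ltr_pdivrMr// mulrC -ltr_pdivrMr//.
    exact: truncnS_gt.
  have n0 : 0 < n.+1%:R^-1 :> R by rewrite invr_gt0.
  have /choice[q qP] (i : 'I_d) : exists q : rat, `|tnth t i - ratr q| < n.+1%:R^-1.
    have lt : (tnth t i : R) - n.+1%:R^-1 < tnth t i + n.+1%:R^-1.
      by rewrite ltrBlDr -addrA ltrDl addr_gt0.
    have [q] := rat_in_itvoo lt.
    by rewrite in_itv/= => /andP[h1 h2]; exists q; rewrite ltr_distlC h1 h2.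
  exists ([tuple q i | i < d], n); last by move=> i /=; rewrite tnth_mktuple.
  move=> u /= bu; apply: eA; split=> // i j; rewrite ord1 !mxE /=.
  have := bu j; rewrite /= tnth_mktuple => h1; have h2 := qP j.
  apply: le_lt_trans ne; rewrite /ball /=.
  rewrite -(subrKA (ratr (q j))) (le_trans (ler_normD _ _))// mulr_natl mulr2n.
  by rewrite lerD// ltW// distrC.
rewrite bigcup_mkcond; apply: countable_bigcupT_measurable; first exact: countableP.
by move=> q; case: ifP.
Qed.

Lemma closed_tuple_set_measurable d (A : set 'rV[R]_d) : closed A -> measurable (tuple_set A).
Proof.
rewrite -openC => /open_tuple_set_measurable /measurableC.
by rewrite (_ : ~` tuple_set (~` A) = tuple_set A)//; exact: setCK.
Qed.

End LebesgueTupleSets.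

(** * Gruenbaum's inequality *)

Section LogConcaveSequences.
Context {R : realType}.

(** Log-concavity makes the ratios [a j.+1 / a j] nonincreasing: at most [q = a N.+1 / a N] from [N]
    on ([up]) and at least [q] before ([down]). The conclusion, multiplied by [q ^+ N] to treat both
    sides at once, says that the geometric sequence agreeing at [N] and [N.+1] dominates.
    Monotonicity handles terms that vanish. *)
Lemma log_concave_geometric (a : nat -> R) (N : nat) :
  (forall j, 0 <= a j) -> (forall j, a j.+1 <= a j) ->
  (forall j, a j.+2 * a j <= a j.+1 ^+ 2) -> 0 < a N.+1 ->
  forall j, a j * (a N.+1 / a N) ^+ N <= a N * (a N.+1 / a N) ^+ j.
Proof.
move=> a0 adec alc aN1.
have aN : 0 < a N by apply: lt_le_trans aN1 (adec N).
set q := a N.+1 / a N; have q0 : 0 < q by rewrite divr_gt0.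
have qaN : a N.+1 = q * a N by rewrite /q; field; rewrite gt_eqF.
have amono m k : a (m + k)%N <= a m.
  by elim: k => [|k IH]; rewrite ?addn0// addnS (le_trans (adec _)).
have up k : a (N + k).+1 <= q * a (N + k)%N.
  elim: k => [|k IH]; first by rewrite addn0 qaN.
  rewrite addnS; have := alc (N + k)%N.
  have [z|z] := eqVneq (a (N + k).+1) 0.
    by rewrite z mulr0 => _; have := adec (N + k).+1; rewrite z.
  have z0 : 0 < a (N + k).+1 by rewrite lt_def z a0.
  have w0 : 0 < a (N + k)%N by apply: lt_le_trans z0 (adec _).
  move=> h; rewrite -(ler_pM2r w0) (le_trans h)// expr2 -mulrA mulrCA ler_pM2l//.
have down k : (k <= N)%N -> q * a (N - k)%N <= a (N - k).+1.
  elim: k => [|k IH] kN; first by rewrite subn0 qaN.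
  have := IH (ltnW kN); have e : (N - k = (N - k.+1).+1)%N by lia.
  rewrite {}e; set m := (N - k.+1)%N => IHk.
  have := alc m; have z0 : 0 < a m.+1.
    by have := amono m.+1 k; rewrite (_ : m.+1 + k = N)%N /m; [lra|lia].
  have w0 : 0 < a m.+2.
    by have := amono m.+2 k; rewrite (_ : m.+2 + k = N.+1)%N /m; [lra|lia].
  move=> h; rewrite -(ler_pM2l w0) mulrCA.
  apply: (@le_trans _ _ (q * a m.+1 ^+ 2)); first by rewrite ler_pM2l.
  by rewrite expr2 mulrA ler_pM2r.
have upk k : a (N + k)%N <= a N * q ^+ k.
  elim: k => [|k IH]; first by rewrite addn0 mulr1.
  rewrite addnS (le_trans (up k))// exprS mulrCA ler_pM2l//.
have downk k : (k <= N)%N -> a (N - k)%N * q ^+ k <= a N.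
  elim: k => [|k IH] kN; first by rewrite subn0 mulr1.
  apply: le_trans (IH (ltnW kN)); rewrite exprSr mulrA mulrAC ler_wpM2r//.
    by rewrite exprn_ge0// ltW.
  by rewrite mulrC (le_trans (down k.+1 kN))// subnSK.
move=> j; case: (leqP N j) => jN.
  have -> : j = (N + (j - N))%N by lia.
  by rewrite exprD (mulrCA (a N)) mulrC ler_pM2l ?exprn_gt0.
have [k kN ->] : exists2 k, (k <= N)%N & j = (N - k)%N.
  by exists (N - j)%N; lia.
have -> : q ^+ N = q ^+ k * q ^+ (N - k) by rewrite -exprD subnKC.
by rewrite mulrA ler_pM2r ?exprn_gt0// downk.
Qed.

Lemma geometric_sum_le (q : R) n : 0 <= q -> (1 - q) * \sum_(j < n) q ^+ j <= 1.
Proof. by move=> q0; rewrite -opprB mulNr -subrX1 opprB gerBl exprn_ge0. Qed.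

(** A discrete layer cake: the sum counts the multiples [j * h] below [y], which later turns the
    mean of a linear form into a sum of tail volumes. *)
Lemma step_function_bound (h y : R) (J : nat) : 0 < h -> y <= h * J%:R ->
  y <= h * \sum_(j < J) (j%:R * h <= y)%R%:R.
Proof.
move=> h0; elim: J => [|J IH]; first by rewrite big_ord0.
rewrite big_ord_recr /=; have [yJ|yJ] := leP y (h * J%:R) => yJ1.
  by rewrite mulrDr (le_trans (IH yJ))// lerDl mulr_ge0// ltW.
rewrite (eq_bigr (fun=> 1)); last first.
  move=> j _; rewrite (_ : (_ <= y) = true)//; apply/idP.
  by rewrite (le_trans _ (ltW yJ))// mulrC ler_pM2l// ler_nat ltnW.
rewrite sumr_const card_ord (_ : (_ <= y) = true); last by apply/idP; lra.
by rewrite (le_trans yJ1)// -natr1.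
Qed.

(* Optimizing [N q^N (1 - q)] over [N] as [q] tends to [1] yields [1 / e]. *)
Lemma le_expR1_of_geometric (V F : R) : 0 <= V ->
  (forall t, 0 < t < 1 -> exists q, 1 - t < q < 1 /\
     forall N, N%:R * V * q ^+ N * (1 - q) <= F) ->
  V <= expR 1 * F.
Proof.
move=> V0 H.
have H1 t : 0 < t < 1 -> V * (1 - t) * expR (- (1 - t)^-1) <= F.
  move=> /[dup] /andP[t0 t1] /H [q [/andP[q1 q2] Hq]].
  set s := 1 - q; have s0 : 0 < s by rewrite /s; lra.
  have st : s < t by rewrite /s; lra.
  have q0 : 0 < q by lra.
  (* [N] is the integer part of [1 / (1 - q)], so [N * s] is within [s] of 1. As
     [1 / q = 1 + s / q <= expR (s / q)], the power [q ^+ N] is at least [expR (- 1 / q)], hence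
     close to [1 / e]. *)
  pose N := Num.truncn s^-1.
  have Ns : N%:R * s <= 1.
    by rewrite -ler_pdivlMr// mul1r; rewrite -truncn_ge_nat// invr_ge0 ltW.
  have Ns1 : 1 - s <= N%:R * s.
    have : s^-1 < N.+1%:R by exact: truncnS_gt.
    rewrite -natr1 -(ltr_pM2r s0) mulVf ?gt_eqF// mulrDl mul1r; lra.
  have qe : expR (- (s / q)) <= q.
    rewrite expRN invf_ple ?posrE ?expR_gt0//.
    apply: le_trans (expR_ge1Dx _); rewrite /s le_eqVlt; apply/orP; left.
    by apply/eqP; field; rewrite gt_eqF.
  have qN : expR (- (1 - t)^-1) <= q ^+ N.
    apply: (@le_trans _ _ (expR (- (s / q)) ^+ N)); last first.
      by apply: lerXn2r => //; rewrite nnegrE ?expR_ge0// ltW.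
    rewrite -expRM_natl ler_expR mulrN lerN2 mulrA.
    apply: (@le_trans _ _ q^-1); first by rewrite ler_pdivrMr// mulVf ?gt_eqF.
    by rewrite lef_pV2 ?posrE; lra.
  apply: le_trans (Hq N); rewrite -/s.
  have -> : N%:R * V * q ^+ N * s = V * (N%:R * s) * q ^+ N by ring.
  apply: ler_pM => //; first by rewrite mulr_ge0//; lra.
  by rewrite ler_wpM2l//; lra.
have E0 : 0 < expR 1 :> R by exact: expR_gt0.
apply/ler_addgt0Pr => e e0.
(* Chosen so that [t < 1 / 2] and the first-order loss [3 * t * V] in [V * (1 - t) * (1 - 2 * t)]
   stays below [e]. *)
pose t := e / (2 * e + 3 * V + 3).
have t0 : 0 < t by rewrite divr_gt0//; lra.
have t2 : t < 1 / 2 by rewrite /t ltr_pdivrMr; lra.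
have tV : 3 * t * V <= e.
  rewrite mulrAC mulrA ler_pdivrMr; last lra.
  by rewrite mulrC ler_pM2l//; lra.
have := H1 t; rewrite t0 (lt_trans t2) => [/(_ isT) VF|]; last lra.
have : expR (-1) * (1 - 2 * t) <= expR (- (1 - t)^-1).
  apply: (@le_trans _ _ (expR (-1) * expR (- (2 * t)))).
    by rewrite ler_pM2l ?expR_gt0// expR_ge1Dx.
  rewrite -expRD ler_expR -opprD lerN2.
  by rewrite -[leLHS]mul1r ler_pdivrMr; nra.
have E1 : expR 1 * expR (-1) = 1 :> R by rewrite -expRD subrr expR0.
move=> le1.
have : expR 1 * (V * (1 - t) * (expR (-1) * (1 - 2 * t))) <= expR 1 * F.
  rewrite ler_pM2l//; apply: le_trans VF; apply: ler_wpM2l => //.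
  by rewrite mulr_ge0//; lra.
have -> : expR 1 * (V * (1 - t) * (expR (-1) * (1 - 2 * t))) =
  (expR 1 * expR (-1)) * (V - 3 * t * V + 2 * (V * t ^+ 2)) by ring.
have : 0 <= V * t ^+ 2 by rewrite mulr_ge0// sqr_ge0.
by rewrite E1; lra.
Qed.
End LogConcaveSequences.

(** * Tail volumes of a bounded midpoint-convex set in a fixed direction *)

Section Grunbaum.
Context {R : realType}.
Local Notation RR := (measurableTypeR R).
Local Notation vol := (@lebesgue_tuple R).

Lemma integrable_tuple_bounded d M (A : set (d.-tuple RR)) (f : d.-tuple RR -> R) (Q : R) :
  measurable A -> tuple_bounded M A -> measurable_fun setT f ->
  (forall t, A t -> `|f t| <= Q) -> (vol d).-integrable A (EFin \o f).
Proof.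
move=> mA bA mf fQ; apply: measurable_bounded_integrable => //.
- by rewrite -ge0_fin_numE//; exact: lebesgue_tuple_fin_num mA bA.
- exact: measurable_funTS.
exists Q; split; first exact: num_real.
by move=> x Qx t At; rewrite /= (le_trans (fQ t At))// ltW.
Qed.

Lemma norm_sum_indic_le T (D : nat -> set T) J (t : T) :
  `|\sum_(j < J) \1_(D j) t| <= J%:R :> R.
Proof.
apply: le_trans (ler_norm_sum _ _ _) _.
apply: (@le_trans _ _ (\sum_(j < J) 1)); last by rewrite sumr_const card_ord.
by apply: ler_sum => j _; rewrite indicE; case: (_ \in _); rewrite ?normr0 ?normr1.
Qed.

Lemma Rintegral_sum_indic d M (A : set (d.-tuple RR)) (D : nat -> set (d.-tuple RR)) J :
  measurable A -> tuple_bounded M A -> (forall j, measurable (D j)) ->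
  \int[vol d]_(t in A) (\sum_(j < J) \1_(D j) t) = \sum_(j < J) fine (vol d (D j `&` A)).
Proof.
move=> mA bA mD; elim: J => [|J IH].
  under eq_Rintegral do rewrite big_ord0.
  by rewrite Rintegral_cst// mul0r big_ord0.
under eq_Rintegral do rewrite big_ord_recr /=.
rewrite RintegralD//.
- by rewrite IH big_ord_recr /= /Rintegral integral_indic.
- apply: (@integrable_tuple_bounded _ M _ _ J%:R) => //.
    by apply: measurable_sum => j; exact: measurable_indic.
  by move=> t _; exact: norm_sum_indic_le.
- apply: (@integrable_tuple_bounded _ M _ _ 1) => // t _.
  by rewrite indicE; case: (_ \in _); rewrite ?normr0 ?normr1.
Qed.

Lemma tuple_dot_bounded d M (A : set (d.-tuple RR)) (g : 'I_d -> R) :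
  tuple_bounded M A -> forall t, A t -> `|tuple_dot g t| <= \sum_i `|g i| * `|M|.
Proof.
move=> bA t At; apply: le_trans (ler_norm_sum _ _ _) _; apply: ler_sum => i _.
by rewrite normrM ler_wpM2l// (le_trans (bA t At i))// ler_norm.
Qed.

Section Tail.
Context (d : nat) (M : R) (A : set (d.-tuple RR)) (g : 'I_d -> R) (c : R).
Context (mA : measurable A) (bA : tuple_bounded M A).
Context (midA : forall s t, A s -> A t -> A [tuple (tnth s i + tnth t i) / 2 | i < d]).

Let level (s : R) := [set t : d.-tuple RR | s <= tuple_dot g t - c].
Let tail (s : R) : R := fine (vol d (level s `&` A)).

Let mlevel s : measurable (level s).
Proof.
have := @measurable_tuple_dot_preimage _ _ g `[s + c, +oo[%classic (measurable_itv _).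
by congr (measurable _); apply/seteqP; split=> t; rewrite /level /= in_itv/= andbT lerBrDr.
Qed.

Let mIA s : measurable (level s `&` A). Proof. exact: measurableI. Qed.
Let bIA s : tuple_bounded M (level s `&` A). Proof. by move=> t [_ /bA]. Qed.
Let finIA s : vol d (level s `&` A) \is a fin_num.
Proof. exact: lebesgue_tuple_fin_num (mIA s) (@bIA s). Qed.

Let tail_ge0 s : 0 <= tail s. Proof. exact: fine_ge0. Qed.

Let tail_dec s t : s <= t -> tail t <= tail s.
Proof.
move=> st; apply: fine_le => //; apply: le_measure; rewrite ?inE//.
by apply: setSI => u /=; rewrite /level/=; exact: le_trans.
Qed.

Let tail_log_concave s t : tail s * tail t <= tail ((s + t) / 2) ^+ 2.
Proof.
rewrite expr2 -lee_fin !EFinM /tail !fineK//.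
apply: (@brunn_minkowski_midpoint _ _ M) => //.
move=> u v [su Au] [tv Av]; split; last exact: midA.
rewrite /level /=; move: su tv; rewrite /level /=.
suff -> : tuple_dot g [tuple (tnth u i + tnth v i) / 2 | i < d] =
          (tuple_dot g u + tuple_dot g v) / 2 by lra.
rewrite /tuple_dot -big_split mulr_suml; apply: eq_bigr => i _ /=.
by rewrite tnth_mktuple; field.
Qed.

Context (mean0 : \int[vol d]_(t in A) tuple_dot g t = c * fine (vol d A)).

(** This is where [mean0] enters: raised by [N * h], the centered height has mean [N * h], and
    [step_function_bound] majorizes it on [A] by [h] times the sum of the indicators of the levels
    [(j - N) * h]. *)
Let tail_sum (h : R) (N : nat) : 0 < h ->
  exists J0, forall J, (J0 <= J)%N ->
  N%:R * fine (vol d A) <= \sum_(j < J) tail ((j%:R - N%:R) * h).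
Proof.
move=> h0; pose Q := \sum_i `|g i| * `|M| + `|c| + N%:R * h.
exists (Num.truncn (Q / h)).+1 => J JQ.
have QJ : Q <= h * J%:R.
  rewrite mulrC -ler_pdivrMr// ltW// (lt_le_trans (truncnS_gt _))//.
  by rewrite ler_nat.
have imd : (vol d).-integrable A (EFin \o tuple_dot g).
  apply: (@integrable_tuple_bounded _ M _ _ (\sum_i `|g i| * `|M|)) => //.
    exact: measurable_tuple_dot.
  exact: tuple_dot_bounded.
have Nh0 : 0 <= N%:R * h by rewrite mulr_ge0// ltW.
pose f t := tuple_dot g t + (N%:R * h - c).
pose D j := level ((j%:R - N%:R) * h).
have icst (k : R) : (vol d).-integrable A (EFin \o (fun=> k)).
  by apply: (@integrable_tuple_bounded _ M _ _ `|k|).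
have fE : \int[vol d]_(t in A) f t = N%:R * h * fine (vol d A).
  rewrite (RintegralD mA imd (icst (N%:R * h - c))).
  by rewrite mean0 Rintegral_cst//; ring.
have isum : (vol d).-integrable A (EFin \o (fun t => \sum_(j < J) \1_(D j) t : R)).
  apply: (@integrable_tuple_bounded _ M _ _ J%:R) => //.
    by apply: measurable_sum => j; apply: measurable_indic; exact: mlevel.
  by move=> t _; exact: norm_sum_indic_le.
have : \int[vol d]_(t in A) f t <=
       \int[vol d]_(t in A) (h * \sum_(j < J) \1_(D j) t).
  apply: le_Rintegral => //.
  - apply: (@integrable_tuple_bounded _ M _ _ Q) => //.
      by apply: measurable_funD => //; exact: measurable_tuple_dot.
    move=> t At; rewrite /f /Q (le_trans (ler_normD _ _))// -addrA lerD//.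
      exact: (tuple_dot_bounded _ bA).
    by rewrite (le_trans (ler_normB _ _))// ger0_norm// addrC.
  - exact: (integrableZl mA h isum).
  move=> t At; have yQ : f t <= h * J%:R.
    apply: le_trans QJ; rewrite /f /Q.
    have h1 := le_trans (ler_norm _) (tuple_dot_bounded g bA At).
    by have := ler_norm (- c); rewrite normrN; lra.
  apply: le_trans (step_function_bound h0 yQ) _.
  rewrite ler_pM2l//; apply: ler_sum => j _.
  rewrite indicE; case: (boolP (_ <= f t)) => [le1|_]; last exact: ler0n.
  by rewrite mem_set// /D /level /=; move: le1; rewrite /f; lra.
rewrite fE RintegralZl// (Rintegral_sum_indic _ mA bA); last by move=> j; exact: mlevel.
by rewrite mulrAC mulrC ler_pM2l.
Qed.

(** Sampling the tail at [(j - N) * h] puts height 0 at index [N]; the geometric comparison then has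
    the same ratio [tail h / tail 0] for every [N]. *)
Let tail_grid (h : R) : 0 < h -> 0 < tail h ->
  forall j N, tail ((j%:R - N%:R) * h) * (tail h / tail 0) ^+ N <=
              tail 0 * (tail h / tail 0) ^+ j.
Proof.
move=> h0 Fh j N.
have := @log_concave_geometric R (fun j => tail ((j%:R - N%:R) * h)) N.
rewrite subrr mul0r -natr1 addrAC subrr add0r mul1r; apply=> //.
- by move=> i; apply: tail_dec; rewrite ler_pM2r// lerD2r ler_nat.
move=> i; have := tail_log_concave ((i.+2%:R - N%:R) * h) ((i%:R - N%:R) * h).
rewrite (_ : (_ + _) / 2 = (i.+1%:R - N%:R) * h)//.
by rewrite -addn2 -addn1 !natrD; field.
Qed.

Let tail_null : (forall s, 0 < s -> tail s = 0) -> tail 0 = 0 -> forall s, 0 < s ->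
  fine (vol d A) <= tail (- s).
Proof.
move=> tp t0 s s0; have [J0 /(_ J0.+1) ] := tail_sum 1 s0.
rewrite leqnSn mul1r => /(_ isT) /le_trans; apply.
rewrite big_ord_recl sub0r mulN1r big1 ?addr0// => i _.
rewrite lift0 -natr1 addrK; case: (posnP i) => [->|i0]; first by rewrite mul0r.
by apply: tp; rewrite mulr_gt0// ltr0n.
Qed.

Let tail_full : exists s, forall s', s <= s' -> tail (- s') = fine (vol d A).
Proof.
exists (\sum_i `|g i| * `|M| + `|c|) => s' ss'; congr (fine (vol d _)).
apply/setIidr => t At; rewrite /level /=.
have := tuple_dot_bounded g bA At; rewrite ler_norml => /andP[h1 _].
have := ler_norm c; lra.
Qed.

Let tail0_ge (h0 : R) : 0 < h0 -> 0 < tail h0 -> fine (vol d A) <= expR 1 * tail 0.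
Proof.
move=> h00 Fh0; have F0 : 0 < tail 0 by apply: lt_le_trans Fh0 _; apply: tail_dec; exact: ltW.
have [VF|FV] := leP (fine (vol d A)) (tail 0).
  apply: le_trans VF _; rewrite ler_peMl//.
  by rewrite -expR0 ler_expR.
apply: le_expR1_of_geometric => [|t /andP[t0 t1]]; first exact: fine_ge0.
pose r := tail h0 / tail 0; have r0 : 0 < r by rewrite divr_gt0.
(* Refining the mesh to [h0 / n] pushes the ratio [q] towards 1: the grid bound at index [n] gives
   [r <= q ^+ n], incompatible with [q <= 1 - t]. *)
have [n n0 nr] : exists2 n, (0 < n)%N & (1 - t) ^+ n < r.
  have /cvgrPdist_lt /(_ r r0) [n _ nP] := @cvg_expr R (1 - t) ltac:(rewrite ltr_norml; lra).
  exists n.+1 => //; have := nP n.+1 (leqnSn n); rewrite /= sub0r normrN.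
  by apply: le_lt_trans; exact: ler_norm.
pose h := h0 / n%:R; have h1 : 0 < h by rewrite divr_gt0// ltr0n.
have nh : n%:R * h = h0 by rewrite mulrC divfK// pnatr_eq0 -lt0n.
have Fh : 0 < tail h.
  apply: lt_le_trans Fh0 _; apply: tail_dec; rewrite -nh ler_peMl//; first exact: ltW.
  by rewrite ler1n.
pose q := tail h / tail 0; have q0 : 0 < q by rewrite divr_gt0.
have grid := tail_grid h1 Fh; rewrite -/q in grid.
have qt : 1 - t < q.
  have := grid n 0; rewrite subr0 nh expr0 mulr1 => le1.
  rewrite ltNge; apply/negP => q1.
  have : q ^+ n < r.
    by apply: le_lt_trans nr; apply: lerXn2r => //; rewrite nnegrE ltW//; lra.
  by rewrite /r ltr_pdivlMr// mulrC ltNge le1.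
(* If [q] were 1, the grid bound would put every tail below [tail 0], in particular one low enough
   to contain all of [A], against [FV]. *)
have q1 : q < 1.
  rewrite lt_neqAle ler_pdivrMr// mul1r tail_dec ?ltW// andbT.
  apply/eqP => q1; have : fine (vol d A) <= tail 0; last by rewrite leNgt FV.
  have grid1 j N : tail ((j%:R - N%:R) * h) <= tail 0.
    by have := grid j N; rewrite q1 !expr1n !mulr1.
  have [s sP] := tail_full; pose N := (Num.truncn (s / h)).+1.
  have <- : tail ((0%:R - N%:R) * h) = fine (vol d A); last exact: grid1.
  rewrite sub0r mulNr; apply: sP.
  by rewrite -ler_pdivrMr// ltW// truncnS_gt.
exists q; split; first by rewrite qt.
move=> N; have [J0 /(_ J0 (leqnn _)) NV] := tail_sum N h1.
have qN : 0 <= q ^+ N * (1 - q) by rewrite mulr_ge0 ?exprn_ge0 ?subr_ge0 ?ltW.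
rewrite -mulrA; apply: le_trans (ler_wpM2r qN NV) _.
rewrite mulrA mulr_suml.
apply: (@le_trans _ _ ((\sum_(j < J0) tail 0 * q ^+ j) * (1 - q))).
  by apply: ler_wpM2r; [rewrite subr_ge0 ltW|apply: ler_sum => j _; exact: grid].
rewrite -mulr_sumr -mulrA ler_piMr// mulrC; apply: geometric_sum_le; exact: ltW.
Qed.

(** Stated for the open half-space because, applied to the opposite direction, that is what a closed
    cut discards. The boundary hyperplane is null, so [tail 0] is the same volume. *)
Lemma grunbaum : (exists i, g i != 0) ->
  fine (vol d A) <= expR 1 * fine (vol d ([set t | c < tuple_dot g t] `&` A)).
Proof.
move=> g0; set pos := _ `&` A.
have mpos : measurable pos.
  apply: measurableI => //.
  have := @measurable_tuple_dot_preimage _ _ g `]c, +oo[%classic (measurable_itv _).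
  by congr (measurable _); apply/seteqP; split=> t; rewrite /= in_itv/= andbT.
have Fpos : tail 0 = fine (vol d pos).
  pose H := [set t : d.-tuple RR | tuple_dot g t = c].
  have mH : measurable H by exact: (@measurable_tuple_dot_preimage _ _ _ [set c]).
  have HA0 : vol d (H `&` A) = 0%E.
    apply/eqP; rewrite -measure_le0 -(lebesgue_tuple_hyperplane c g0).
    by apply: le_measure; rewrite ?inE//; exact: measurableI.
  have -> : tail 0 = fine (vol d ((H `&` A) `|` pos)).
    congr (fine (vol d _)); apply/seteqP; split=> t; rewrite /level /pos /H /= subr_ge0.
      by move=> [+ At]; rewrite le_eqVlt => /orP[/eqP <-|]; [left|right].
    by move=> [[-> At]|[/ltW]].
  congr fine; rewrite measureU//; [|exact: measurableI|].
    by rewrite [X in (X + _)%E]HA0 add0e.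
  by rewrite -subset0 => t [[/= tc _] [/= ct _]]; move: ct; rewrite tc ltxx.
have countable_null (D : nat -> set (d.-tuple RR)) : (forall k, measurable (D k)) ->
    (forall k, fine (vol d (D k `&` A)) = 0) -> fine (vol d ((\bigcup_k D k) `&` A)) = 0.
  move=> mD D0; suff -> : vol d ((\bigcup_k D k) `&` A) = 0%E by [].
  apply/eqP; rewrite -measure_le0 setI_bigcupl.
  have mDA k : measurable (D k `&` A) by exact: measurableI.
  apply: (le_trans (measure_sigma_subadditive _ mDA _ (@subset_refl _ _))).
    exact: bigcupT_measurable.
  rewrite eseries0// => k _ _.
  have fD : vol d (D k `&` A) \is a fin_num.
    by apply: (lebesgue_tuple_fin_num (mDA k) (M := M)) => t [_ /bA].
  by move: (fineK fD); rewrite D0 => /esym.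
rewrite -Fpos.
have [[h /andP[h0 Fh]]|noh] := pselect (exists h, (0 < h) && (0 < tail h)).
  exact: tail0_ge Fh.
(* Degenerate case: no volume lies above the mean height. Then none lies below it either, by
   [tail_null], and [A] itself is null. *)
have tp s : 0 < s -> tail s = 0.
  move=> s0; apply/eqP; rewrite eq_le tail_ge0 andbT leNgt; apply/negP => Fs.
  by apply: noh; exists s; rewrite s0.
have t0 : tail 0 = 0.
  rewrite Fpos (_ : pos = (\bigcup_k level k.+1%:R^-1) `&` A).
    by apply: countable_null => [k|k]; [exact: mlevel|exact: tp].
  congr (_ `&` A); apply/seteqP; split=> t; rewrite /level /=.
    rewrite -subr_gt0 => X0; exists (Num.truncn (tuple_dot g t - c)^-1) => //=.
    by rewrite invf_ple ?posrE// ltW// truncnS_gt.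
  by move=> [k _ /= h]; rewrite -subr_gt0; apply: lt_le_trans h.
rewrite t0 mulr0; have full := tail_null tp t0.
have fV := lebesgue_tuple_fin_num mA bA.
have null k : fine (vol d (~` level (- k.+1%:R^-1) `&` A)) = 0.
  have mC : measurable (~` level (- k.+1%:R^-1) `&` A).
    by apply: measurableI => //; apply: measurableC; exact: mlevel.
  have fC : vol d (~` level (- k.+1%:R^-1) `&` A) \is a fin_num.
    by apply: (lebesgue_tuple_fin_num mC (M := M)) => t [_ /bA].
  have : fine (vol d A) = tail (- k.+1%:R^-1) + fine (vol d (~` level (- k.+1%:R^-1) `&` A)).
    rewrite /tail -fineD//; congr fine; rewrite -measureU//.
      by rewrite -setIUl setUv setTI.
    by rewrite setIACA setICr set0I.
  have := full k.+1%:R^-1; rewrite invr_gt0 ltr0n => /(_ isT).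
  have : 0 <= fine (vol d (~` level (- k.+1%:R^-1) `&` A)) by exact: fine_ge0.
  lra.
have -> : fine (vol d A) = tail 0 + fine (vol d (~` level 0 `&` A)).
  have mC : measurable (~` level 0 `&` A).
    by apply: measurableI => //; apply: measurableC; exact: mlevel.
  have fC : vol d (~` level 0 `&` A) \is a fin_num.
    by apply: (lebesgue_tuple_fin_num mC (M := M)) => t [_ /bA].
  rewrite /tail -fineD//; congr fine; rewrite -measureU//.
    by rewrite -setIUl setUv setTI.
  by rewrite setIACA setICr set0I.
rewrite t0 add0r (_ : ~` level 0 = \bigcup_k ~` level (- k.+1%:R^-1)).
  by rewrite countable_null// => k; apply: measurableC; exact: mlevel.
apply/seteqP; split=> t; rewrite /level /=.
  move=> /negP; rewrite -ltNge => X0.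
  exists (Num.truncn (- (tuple_dot g t - c))^-1) => //=; apply/negP; rewrite -ltNge ltrNr.
  by rewrite invf_plt ?posrE ?oppr_gt0// truncnS_gt.
move=> [k _ /= /negP h]; apply/negP; move: h; rewrite -!ltNge => /lt_trans; apply.
by rewrite oppr_lt0 invr_gt0.
Qed.

End Tail.
End Grunbaum.

(** * Euclidean geometry and volumes *)

Section EuclideanSpace.
Context {R : realType} {d : nat}.
Implicit Types (u v w x y : 'rV[R]_d) (a b : R).

Lemma dotC u v : dot u v = dot v u.
Proof. by apply: eq_bigr => i _; rewrite mulrC. Qed.

Lemma dotDl u v w : dot (u + v) w = dot u w + dot v w.
Proof. by rewrite /dot -big_split; apply: eq_bigr => i _; rewrite mxE mulrDl. Qed.

Lemma dotZl a u w : dot (a *: u) w = a * dot u w.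
Proof. by rewrite /dot mulr_sumr; apply: eq_bigr => i _; rewrite mxE mulrA. Qed.

Lemma dotNl u w : dot (- u) w = - dot u w.
Proof. by rewrite -scaleN1r dotZl mulN1r. Qed.

Lemma dotDr u v w : dot w (u + v) = dot w u + dot w v.
Proof. by rewrite !(dotC w) dotDl. Qed.

Lemma dotZr a u w : dot w (a *: u) = a * dot w u.
Proof. by rewrite !(dotC w) dotZl. Qed.

Lemma dotNr u w : dot w (- u) = - dot w u.
Proof. by rewrite !(dotC w) dotNl. Qed.

Definition dotE := (dotDl, dotDr, dotNl, dotNr, dotZl, dotZr).

Lemma dot0l w : dot 0 w = 0.
Proof. by rewrite -(scale0r 0) dotZl mul0r. Qed.

Lemma dot0r w : dot w 0 = 0. Proof. by rewrite dotC dot0l. Qed.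

Lemma dot_ge0 u : 0 <= dot u u.
Proof. by apply: sumr_ge0 => i _; rewrite -expr2 sqr_ge0. Qed.

Lemma enorm_sq u : enorm u ^+ 2 = dot u u.
Proof. by rewrite sqr_sqrtr// dot_ge0. Qed.

Lemma enorm_ge0 u : 0 <= enorm u. Proof. exact: sqrtr_ge0. Qed.

Lemma enormZ a u : enorm (a *: u) = `|a| * enorm u.
Proof.
by rewrite /enorm dotZl dotZr mulrA -expr2 sqrtrM ?sqr_ge0// sqrtr_sqr.
Qed.

Lemma enorm0 : enorm (0 : 'rV[R]_d) = 0.
Proof. by rewrite /enorm dot0l sqrtr0. Qed.

Lemma enorm_eq0 u : enorm u = 0 -> u = 0.
Proof.
move=> u0; have : dot u u = 0 by rewrite -enorm_sq u0 expr0n.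
move=> /eqP; rewrite psumr_eq0; last by move=> i _; rewrite -expr2 sqr_ge0.
move=> /allP h; apply/rowP => i; rewrite mxE; apply/eqP.
by have := h i (mem_index_enum i); rewrite /= mulf_eq0 orbb.
Qed.

Lemma cauchy_schwarz u v : dot u v <= enorm u * enorm v.
Proof.
have [v0|v0] := eqVneq (enorm v) 0.
  by rewrite (enorm_eq0 v0) dot0r enorm0 mulr0.
have pv : 0 < enorm v by rewrite lt_def v0 enorm_ge0.
have := dot_ge0 (enorm v *: u - enorm u *: v).
rewrite !dotE (dotC v u) -!enorm_sq => h.
have [u0|u0] := eqVneq (enorm u) 0.
  by rewrite (enorm_eq0 u0) dot0l enorm0 mul0r.
have pu : 0 < enorm u by rewrite lt_def u0 enorm_ge0.
have puv : 0 < enorm u * enorm v by rewrite mulr_gt0.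
by rewrite -(ler_pM2l puv); nra.
Qed.

Lemma coord_le_enorm u i : `|u 0 i| <= enorm u.
Proof.
rewrite -(@ler_pXn2r _ 2) ?nnegrE ?enorm_ge0// enorm_sq real_normK ?num_real//.
rewrite /dot (bigD1 i)//= expr2 lerDl sumr_ge0// => j _.
by rewrite -expr2 sqr_ge0.
Qed.

Lemma continuous_dot u : continuous (fun v => dot u v).
Proof.
rewrite /dot; apply: continuous_big => [|i _ v]; first exact: add_continuous.
apply: (@continuousM R _ (fun=> u 0 i) (fun v => v 0 i)).
  exact: cst_continuous.
exact: coord_continuous.
Qed.

Lemma continuous_sqnorm x : continuous (fun v => dot (v - x) (v - x)).
Proof.
rewrite /dot; apply: continuous_big => [|i _ v]; first exact: add_continuous.
have H : {for v, continuous (fun w : 'rV[R]_d => (w - x) 0 i)}.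
  have -> : (fun w : 'rV[R]_d => (w - x) 0 i) = (fun w => w 0 i) - (fun=> x 0 i).
    by apply/funext => w; rewrite fctE !mxE.
  by apply: continuousB; [exact: coord_continuous|exact: cst_continuous].
exact: (continuousM H H).
Qed.

Lemma diameter_bounded_set (A : set 'rV[R]_d) r : diameter_le A r -> bounded_set A.
Proof.
move=> Ar; have [->|/set0P[x0 Ax0]] := eqVneq A set0.
  by exists 0; split=> // M _ x.
exists (`|x0| + r); split; first exact: num_real.
move=> M Mr x Ax; apply: le_trans (ltW Mr).
rewrite -(subrK x0 x) (le_trans (ler_normD _ _))// addrC lerD2l.
have r0 : 0 <= r by apply: le_trans (Ar _ _ Ax0 Ax0); exact: enorm_ge0.
rewrite (_ : `|x - x0| = mx_norm (x - x0))// mx_normrE; apply/bigmax_leP; split=> // -[i j] _ /=.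
by rewrite ord1; apply: le_trans (coord_le_enorm _ _) (Ar _ _ Ax Ax0).
Qed.

Lemma convex_setP (A : set 'rV[R]_d) : convex_set (A : set (convex_lmodType 'rV[R]_d)) ->
  forall x y t, A x -> A y -> 0 <= t <= 1 -> A (t *: x + (1 - t) *: y).
Proof.
move=> cA x y t Ax Ay t01.
have := cA x y (Itv01 (proj1 (andP t01)) (proj2 (andP t01))) (mem_set Ax) (mem_set Ay).
by move=> /set_mem.
Qed.

End EuclideanSpace.

Section Projection.
Context {R : realType} {d : nat} (A : set 'rV[R]_d).
Context (A0 : A !=set0) (cptA : compact A).
Context (cvxA : convex_set (A : set (convex_lmodType 'rV[R]_d))).

(** [proj] is a [get], so a minimizer must exist before it means anything; compactness supplies it.
    The variational inequality is the first-order condition along segments of [A]. *)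
Lemma projP x : A (Defs.proj A x) /\ forall q, A q -> 0 <= dot (Defs.proj A x - x) (q - Defs.proj A x).
Proof.
have [p Ap pmin] : exists2 p, A p & forall q, A q -> enorm (p - x) <= enorm (q - x).
  have [|p /set_mem Ap pmin] := @EVT_min_rV R d (fun v => dot (v - x) (v - x)) A A0 cptA.
    by apply: continuous_subspaceT; exact: continuous_sqnorm.
  exists p => // q Aq; rewrite /enorm ler_sqrt ?dot_ge0//.
  by apply: pmin; exact: mem_set.
have ex : (exists p, A p /\ forall q, A q -> enorm (p - x) <= enorm (q - x)) by exists p.
rewrite /Defs.proj; have /= [] := @getPex _ [set p | A p /\ forall q, A q -> enorm (p - x) <= enorm (q - x)] ex.
move: (get _) => {ex Ap pmin}p Ap pmin; split=> // q Aq; rewrite leNgt; apply/negP => neg.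
set b := dot _ _ in neg; set D := dot (q - p) (q - p).
have D0 : 0 <= D by exact: dot_ge0.
(* Moving by [t] towards [q] changes the squared distance by [2 * t * b + t ^+ 2 * D], which is
   negative for this [t]. *)
pose t := Num.min 1 (- b / (D + 1)).
have D1 : 0 < D + 1 by lra.
have bD : 0 < - b / (D + 1) by rewrite divr_gt0//; lra.
have t0 : 0 < t by rewrite /t lt_min ltr01.
have t1 : t <= 1 by rewrite /t ge_min lexx.
have tb : t * (D + 1) <= - b.
  by rewrite -ler_pdivlMr// /t ge_min lexx orbT.
have t01 : 0 <= t <= 1 by rewrite ltW.
have := pmin _ (convex_setP cvxA Aq Ap t01).
rewrite -(@ler_pXn2r _ 2) ?nnegrE ?enorm_ge0// !enorm_sq.
have -> : t *: q + (1 - t) *: p - x = (p - x) + t *: (q - p).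
  by apply/rowP => i; rewrite !mxE; ring.
rewrite !(dotDl (p - x)) !(dotDr (p - x)) !dotZl !dotZr (dotC (q - p)) -/b -/D.
by nra.
Qed.

End Projection.

(** * Volumes, centers of gravity and half-space cuts *)

Section Volume.
Context {R : realType} {d : nat}.
Local Notation RR := (measurableTypeR R).
Local Notation vol := (@lebesgue_tuple R d).
Implicit Types (K S : set 'rV[R]_d) (g : 'rV[R]_d).

Definition volume K : R := fine (vol (tuple_set K)).

Lemma tuple_dotE g (t : d.-tuple RR) : tuple_dot (g 0) t = dot g (\row_i tnth t i).
Proof. by apply: eq_bigr => i _; rewrite mxE. Qed.

Lemma tuple_set_bounded K (M : R) : (forall x, K x -> `|x| <= M) ->
  tuple_bounded M (tuple_set K).
Proof.
move=> KM t /KM tM i; apply: le_trans tM.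
rewrite (_ : `|\row_j tnth t j : 'rV[R]_d| = mx_norm (\row_j tnth t j : 'rV[R]_d))// mx_normrE.
by apply: le_trans (le_bigmax _ _ (ord0, i)); rewrite /= mxE.
Qed.

Lemma compact_tuple_set K : compact K ->
  measurable (tuple_set K) /\ exists M, tuple_bounded M (tuple_set K).
Proof.
move=> cK; split.
  apply: closed_tuple_set_measurable; apply: compact_closed cK.
  exact: norm_hausdorff.
have [M [_ KM]] := compact_bounded cK.
by exists (M + 1); apply: tuple_set_bounded => x Kx; apply: (KM (M + 1)) => //; rewrite ltrDl.
Qed.

Lemma volume_fin K : compact K -> vol (tuple_set K) \is a fin_num.
Proof. by move=> /compact_tuple_set[mK [M KM]]; exact: lebesgue_tuple_fin_num mK KM. Qed.

Lemma volume_scale_le K S (a : R) (p : 'rV[R]_d) : compact K -> compact S -> 0 < a ->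
  (forall x, K x -> S (a *: x + p)) -> a ^+ d * volume K <= volume S.
Proof.
move=> cK cS a0 KS; have [mK _] := compact_tuple_set cK.
have [mS [M SM]] := compact_tuple_set cS.
have volE := lebesgue_tuple_affine (p 0) a0 mS.
have mpre : measurable (tuple_affine a (p 0) @^-1` tuple_set S).
  by rewrite -[X in measurable X]setTI; exact: measurable_tuple_affine.
have le1 : (vol (tuple_set K) <= vol (tuple_affine a (p 0%R) @^-1` tuple_set S))%E.
  apply: le_measure; rewrite ?inE// => t /KS; rewrite /tuple_set /=.
  by congr (S _); apply/rowP => i; rewrite !mxE tnth_mktuple.
rewrite /volume -lee_fin EFinM !fineK; [|exact: volume_fin..].
by rewrite volE lee_pmul2l// lte_fin exprn_gt0.
Qed.

Lemma volume_gt0 K (y : 'rV[R]_d) : compact K -> nbhs y K -> 0 < volume K.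
Proof.
move=> cK /nbhs_ballP[e e0 eK]; have [mK _] := compact_tuple_set cK.
rewrite /volume fine_gt0// -ge0_fin_numE// volume_fin// andbT.
apply: (@lebesgue_tuple_box_gt0 _ _ (y 0) (e / 2)) => //; first exact: divr_gt0.
move=> t yt; apply: eK; split=> // i j; rewrite ord1 mxE /ball/= distrC.
by apply: le_lt_trans (yt j) _; rewrite ltr_pdivrMr//; rewrite mulr_natr mulr2n ltrDl.
Qed.

Lemma Rintegral_tuple_dot K g : compact K -> 0 < volume K ->
  \int[vol]_(t in tuple_set K) tuple_dot (g 0) t = dot g (center_of_gravity K) * volume K.
Proof.
move=> cK V0; have [mK [M KM]] := compact_tuple_set cK.
have intt i : vol.-integrable (tuple_set K) (EFin \o (fun t => tnth t i : R)).
  apply: (@integrable_tuple_bounded _ _ M _ _ M) => //; first exact: measurable_tnth.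
  by move=> t /KM.
have H (s : seq 'I_d) :
    vol.-integrable (tuple_set K) (EFin \o (fun t => \sum_(i <- s) g 0 i * tnth t i)) /\
    \int[vol]_(t in tuple_set K) (\sum_(i <- s) g 0 i * tnth t i) =
    \sum_(i <- s) g 0 i * \int[vol]_(t in tuple_set K) (tnth t i : R).
  elim: s => [|i s [IH1 IH2]].
    rewrite big_nil; split.
      apply: (@integrable_tuple_bounded _ _ M _ _ 0) => //.
        by under eq_fun do rewrite big_nil; exact: measurable_cst.
      by move=> t _; rewrite big_nil normr0.
    by under eq_Rintegral do rewrite big_nil; rewrite Rintegral_cst// mul0r.
  have intg : vol.-integrable (tuple_set K) (EFin \o (fun t => g 0 i * tnth t i)).
    exact: (integrableZl mK (g 0 i) (intt i)).
  split.
    have := integrableD mK intg IH1.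
    congr (integrable _ _ _); apply/funext => t /=.
    by rewrite big_cons EFinD.
  under eq_Rintegral do rewrite big_cons.
  by rewrite RintegralD// RintegralZl// IH2 big_cons.
rewrite (H (index_enum 'I_d)).2 /dot mulr_suml; apply: eq_bigr => i _.
by rewrite mxE -mulrA divfK// gt_eqF.
Qed.

(** Separation: with [p] the projection of the center [c], the form [g = p - c] satisfies
    [g.p <= g.y] on [K]. Averaging over [K] replaces [y] by [c], so [|g|^2 <= 0]. *)
Lemma center_of_gravity_in K : compact K -> convex_set (K : set (convex_lmodType 'rV[R]_d)) ->
  0 < volume K -> K (center_of_gravity K).
Proof.
move=> cK cvxK V0; set c := center_of_gravity K.
have [mK [M KM]] := compact_tuple_set cK.
have K0 : K !=set0.
  have [e|/set0P//] := eqVneq K set0; move: V0.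
  rewrite /volume (_ : tuple_set K = set0) ?measure0 ?ltxx//.
  by rewrite e -subset0 => t.
have [Kp pP] := projP K0 cK cvxK c; move: (Defs.proj K c) Kp pP => p Kp pP.
suff -> : c = p by [].
pose g := p - c.
have : \int[vol]_(t in tuple_set K) dot g p <= \int[vol]_(t in tuple_set K) tuple_dot (g 0) t.
  apply: le_Rintegral => //.
  - exact: (@integrable_tuple_bounded _ _ M _ _ `|dot g p|).
  - apply: (@integrable_tuple_bounded _ _ M _ _ (\sum_i `|g 0 i| * `|M|)) => //.
      exact: measurable_tuple_dot.
    exact: tuple_dot_bounded.
  by move=> t Kt; rewrite tuple_dotE -subr_ge0 -dotNr -dotDr; exact: pP.
rewrite Rintegral_tuple_dot// Rintegral_cst// -/c ler_pM2r// -subr_ge0 -dotNr -dotDr.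
have -> : c - p = - g by rewrite /g opprB.
rewrite dotNr oppr_ge0 => le0.
have /eqP : dot g g == 0 by rewrite eq_le le0 dot_ge0.
rewrite -enorm_sq => /eqP; rewrite sqrf_eq0 => /eqP/enorm_eq0 /eqP.
by rewrite subr_eq0 => /eqP.
Qed.

Definition halfspace g (c : 'rV[R]_d) : set 'rV[R]_d := [set y | 0 <= dot g (y - c)].

Lemma closed_halfspace g c : closed (halfspace g c).
Proof.
have -> : halfspace g c = (fun y => dot g y) @^-1` `[dot g c, +oo[%classic.
  by apply/seteqP; split=> y; rewrite /halfspace /= in_itv /= andbT !dotE subr_ge0.
apply: closed_comp; last exact: interval_closed.
by move=> y _; exact: continuous_dot.
Qed.

Lemma convex_halfspace K g c : convex_set (K : set (convex_lmodType 'rV[R]_d)) ->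
  convex_set (K `&` halfspace g c : set (convex_lmodType 'rV[R]_d)).
Proof.
move=> cK x y l /set_mem[Kx gx] /set_mem[Ky gy]; apply/mem_set; split.
  by apply/set_mem/cK; exact: mem_set.
have l0 : 0 <= l%:num by []. have l1 : 0 <= 1 - l%:num by rewrite subr_ge0.
suff : 0 <= dot g ((l%:num *: (x : 'rV[R]_d) + (1 - l%:num) *: (y : 'rV[R]_d)) - c) by [].
by move: gx gy; rewrite /halfspace /= !dotE => gx gy; nra.
Qed.

(** Gruenbaum is used in both directions: for [g] it keeps the remaining body of positive volume, so
    that its own center of gravity is meaningful; for [- g] it bounds the discarded part from
    below. *)
Lemma volume_halfspace_gt0 K g : compact K -> convex_set (K : set (convex_lmodType 'rV[R]_d)) ->
  0 < volume K -> g != 0 ->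
  0 < volume (K `&` halfspace g (center_of_gravity K)) /\
  volume (K `&` halfspace g (center_of_gravity K)) <= (1 - (expR 1)^-1) * volume K.
Proof.
move=> cK cvxK V0 g0; set c := center_of_gravity K.
have [mK [M KM]] := compact_tuple_set cK.
have midK s t : tuple_set K s -> tuple_set K t ->
    tuple_set K [tuple (tnth s i + tnth t i) / 2 | i < d].
  move=> Ks Kt; have h2 : 0 <= (1 / 2 : R) <= 1 by lra.
  have := convex_setP cvxK Ks Kt h2; rewrite /tuple_set /=.
  by congr (K _); apply/rowP => i; rewrite !mxE tnth_mktuple; field.
have coord (h : 'rV[R]_d) : h != 0 -> exists i, h 0 i != 0.
  move=> h0; apply: contrapT => /forallNP hi; move/eqP: h0; apply.
  by apply/rowP => i; rewrite mxE; apply/eqP/negPn/negP; exact: hi.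
have gr (h : 'rV[R]_d) : h != 0 -> volume K <=
    expR 1 * fine (vol ([set t | dot h c < tuple_dot (h 0) t] `&` tuple_set K)).
  move=> h0; apply: (grunbaum mK KM midK); last exact: coord.
  exact: Rintegral_tuple_dot.
have cKH : compact (K `&` halfspace g c).
  apply: (subclosed_compact _ cK); last exact: subIsetl.
  apply: closedI; last exact: closed_halfspace.
  by apply: (compact_closed _ cK); exact: norm_hausdorff.
have [mKH [M' KHM]] := compact_tuple_set cKH.
have E0 : 0 < expR 1 :> R by exact: expR_gt0.
have mlt (h : 'rV[R]_d) : measurable ([set t | dot h c < tuple_dot (h 0) t] `&` tuple_set K).
  apply: measurableI => //.
  have := @measurable_tuple_dot_preimage _ _ (h 0) `](dot h c), +oo[%classic (measurable_itv _).
  by congr (measurable _); apply/seteqP; split=> t; rewrite /= in_itv/= andbT.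
have fin (h : 'rV[R]_d) : vol ([set t | dot h c < tuple_dot (h 0) t] `&` tuple_set K) \is a fin_num.
  by apply: (lebesgue_tuple_fin_num (mlt h) (M := M)) => t [_ /KM].
split.
  rewrite -(pmulr_rgt0 _ E0); apply: lt_le_trans V0 _; apply: le_trans (gr _ g0) _; rewrite ler_pM2l//.
  apply: fine_le; rewrite ?fin ?volume_fin//.
  apply: le_measure; rewrite ?inE// => t /= [/ltW lt Kt]; split=> //.
  by rewrite /halfspace/= !dotE -tuple_dotE subr_ge0.
have Ng0 : - g != 0 by rewrite oppr_eq0.
have cut := gr _ Ng0.
have -> : volume (K `&` halfspace g c) = volume K -
    fine (vol ([set t | dot (- g) c < tuple_dot ((- g) 0) t] `&` tuple_set K)).
  apply/eqP; rewrite eq_sym subr_eq; apply/eqP; rewrite /volume -fineD ?volume_fin//.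
  congr fine; rewrite -measureU//.
    congr (vol _); apply/seteqP; split=> t.
      move=> Kt; have [le|lt] := leP 0 (dot g (\row_i tnth t i - c)); first by left.
      right; split=> //=; rewrite tuple_dotE !dotNl ltrN2.
      by move: lt; rewrite dotDr dotNr subr_lt0.
    by move=> [[]|[]].
  rewrite -subset0 => t [[_ h1] [/= h2 _]].
  move: h1 h2; rewrite /halfspace /= tuple_dotE !dotNl ltrN2 dotDr dotNr subr_ge0.
  by rewrite leNgt => /negP.
rewrite mulrBl mul1r lerD2l lerN2 -(ler_pM2l E0) mulrA mulfV ?gt_eqF// mul1r.
exact: cut.
Qed.

End Volume.

(** * Oracle programs *)

Section Programs.
Context {R : realType} {n m : nat} (f : 'rV[R]_n -> 'rV[R]_m -> R)
  (gx : 'rV[R]_n -> 'rV[R]_m -> 'rV[R]_n) (gy : 'rV[R]_n -> 'rV[R]_m -> 'rV[R]_m).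
Local Notation run := (exec f gx gy).
Implicit Types S T : Type.

Lemma output_bind S T (p : prog R n m S) (q : S -> prog R n m T) :
  output (run (bind p q)) = output (run (q (output (run p)))).
Proof. by elim: p => [s|x y k IH|x y k IH] //=; exact: IH. Qed.

Lemma calls_x_bind S T (p : prog R n m S) (q : S -> prog R n m T) :
  calls_x (run (bind p q)) = (calls_x (run p) + calls_x (run (q (output (run p)))))%N.
Proof. by elim: p => [s|x y k IH|x y k IH] //=; rewrite /exec/= -!/(run _) IH. Qed.

Lemma calls_y_bind S T (p : prog R n m S) (q : S -> prog R n m T) :
  calls_y (run (bind p q)) = (calls_y (run p) + calls_y (run (q (output (run p)))))%N.
Proof. by elim: p => [s|x y k IH|x y k IH] //=; rewrite /exec/= -!/(run _) IH. Qed.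

Definition bindE := (output_bind, calls_x_bind, calls_y_bind).

(** Calls to the first oracle are counted exactly, calls to the second only from above, as [is_maxy]
    merely bounds the latter. *)
Lemma repeat_invariant S (step : S -> prog R n m S) (I : nat -> S -> Prop) (cx cy : nat) k i s :
  (forall j s, I j s ->
     [/\ I j.+1 (output (run (step s))),
         calls_x (run (step s)) = cx & (calls_y (run (step s)) <= cy)%N]) ->
  I i s ->
  [/\ I (i + k)%N (output (run (repeat k step s))),
      calls_x (run (repeat k step s)) = (k * cx)%N &
      (calls_y (run (repeat k step s)) <= k * cy)%N].
Proof.
move=> H; elim: k i s => [|k IH] i s Is; first by rewrite addn0.
have [I1 x1 y1] := H _ _ Is; have [I2 x2 y2] := IH _ _ I1.
by rewrite [repeat _ _ _]/= !bindE addnS -addSn mulSn mulSn x1 x2; split=> //; exact: leq_add.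
Qed.

End Programs.

(** * The center-of-gravity method *)

Section CeilingAndLimits.
Context {R : realType}.

Lemma ceiln_ge (x : R) : x <= (ceiln x)%:R.
Proof.
rewrite /ceiln natr_absz ger0_norm; last by rewrite le_max lexx.
by rewrite (le_trans (ceil_ge x))// ler_int le_max lexx orbT.
Qed.

Lemma ceiln_lt (x : R) : 0 <= x -> (ceiln x)%:R < x + 1.
Proof.
move=> x0; rewrite /ceiln natr_absz ger0_norm; last by rewrite le_max lexx.
have c0 : 0 <= Num.ceil x by rewrite ceil_ge0; lra.
rewrite max_r// -ltrBlDr; have := ceilB1_lt x.
by rewrite rmorphB /=.
Qed.

Lemma ceiln_le (x y : R) : x <= y -> (ceiln x <= ceiln y)%N.
Proof.
move=> xy; rewrite -(ler_nat R) /ceiln !natr_absz !ger0_norm ?le_max ?lexx// ler_int.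
by rewrite ge_max le_max lexx /= le_max le_ceil ?orbT.
Qed.

Lemma ler_of_forall_gt_lt1 (x v a b : R) : 0 < b -> a < 1 ->
  (forall a', a < a' -> a' < 1 -> x <= v + a' * b) -> x <= v + a * b.
Proof.
move=> b0 a1 H; apply/ler_addgt0Pr => e e0.
pose a' := Num.min ((a + 1) / 2) (a + e / b).
have aa' : a < a' by rewrite lt_min ltrDl divr_gt0// andbT; lra.
have a'1 : a' < 1 by rewrite gt_min; apply/orP; left; lra.
apply: le_trans (H a' aa' a'1) _; rewrite -addrA lerD2l.
apply: (@le_trans _ _ ((a + e / b) * b)).
  by rewrite ler_pM2r// ge_min lexx orbT.
by rewrite mulrDl divfK// gt_eqF.
Qed.

End CeilingAndLimits.

Section CenterOfGravityMethod.
Context {R : realType} {n m : nat} (pb : params R n m).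
Context (f : 'rV[R]_n -> 'rV[R]_m -> R) (gx : 'rV[R]_n -> 'rV[R]_m -> 'rV[R]_n)
  (gy : 'rV[R]_n -> 'rV[R]_m -> 'rV[R]_m).
Context (hs : setting pb f gx gy).
Local Notation X := (dom_x pb).
Local Notation Y := (dom_y pb).

Lemma Y_nonempty : Y !=set0.
Proof. by have [y [Yy _]] := Y_relint hs; exists y. Qed.

(** As the affine dimension equals [m], the affine hull is the whole space and the relative interior
    is the interior. *)
Lemma volume_Y_gt0 : 0 < volume Y.
Proof.
have [y [Yy near_y]] := Y_relint hs; apply: (volume_gt0 (y := y)).
  exact: Y_compact hs.
have [p [U [rkU hullE]]] := Y_dim hs.
have fullU : row_full U by rewrite /row_full rkU.
move: near_y; rewrite near_withinE; apply: filterS => y' /=; apply.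
rewrite hullE; exists (y' - p); last by rewrite addrC subrK.
by rewrite /= submx_full.
Qed.

Lemma f_le_shift x y z : X x -> Y y -> Y z -> f x z <= f x y + B pb.
Proof.
move=> Xx Yy Yz; apply: le_trans (gy_supergradient hs Xx Yy Yz) _.
rewrite lerD2l (le_trans (cauchy_schwarz _ _))// /B.
by rewrite ler_pM ?enorm_ge0//; [exact: gy_bounded hs _ _ Xx Yy|exact: Y_diam hs _ _ Yz Yy].
Qed.

Lemma le_primal x y : X x -> Y y -> f x y <= primal pb f x.
Proof.
move=> Xx Yy; apply: sup_upper_bound; last by exists y.
by split; [exists (f x y); exists y|exists (f x y + B pb) => _ [z Yz <-]; exact: f_le_shift].
Qed.

Lemma primal_le x (b : R) : (forall y, Y y -> f x y <= b) -> primal pb f x <= b.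
Proof.
move=> H; apply: ge_sup; last by move=> _ [y Yy <-]; exact: H.
by have [y Yy] := Y_nonempty; exists (f x y); exists y.
Qed.

Section Loop.
Context (x : 'rV[R]_n) (Xx : X x).
Let state := (set 'rV[R]_m * option (R * 'rV[R]_m))%type.

(** The value [False] before the first query makes the invariant below say that no point of [Y] has
    been discarded yet. *)
Let dominated (b : option (R * 'rV[R]_m)) z := if b is Some (v, _) then is_true (f x z <= v) else False.

(* A zero supergradient cuts nothing off, but then the query point is a
   maximizer: hence the first alternative of the last clause. *)
Let invariant (t : nat) (s : state) :=
  [/\ [/\ closed s.1, s.1 `<=` Y & convex_set (s.1 : set (convex_lmodType 'rV[R]_m))],
      0 < volume s.1,
      if s.2 is Some (v, y) then Y y /\ v = f x y else t = 0%N,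
      forall z, Y z -> ~ s.1 z -> dominated s.2 z &
      (forall z, Y z -> dominated s.2 z) \/
      volume s.1 <= (1 - (expR 1)^-1) ^+ t * volume Y].

Let q_ge0 : 0 <= 1 - (expR 1)^-1 :> R.
Proof. by rewrite subr_ge0 invf_le1 ?expR_gt0// -expR0 ler_expR. Qed.

Let invariant_step t s : invariant t s ->
  [/\ invariant t.+1 (output (exec f gx gy (cog_step x s))),
      calls_x (exec f gx gy (cog_step x s)) = 0%N &
      (calls_y (exec f gx gy (cog_step x s)) <= 1)%N].
Proof.
case: s => S b [[/= clS SY cvxS] V0 bP Sdom prog]; split=> //.
have cS : compact S by exact: subclosed_compact clS (Y_compact hs) SY.
set y := center_of_gravity S.
have Sy : S y by exact: center_of_gravity_in.
have Yy := SY _ Sy; pose g := gy x y.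
rewrite /exec /cog_step /= -/y -/g -/(halfspace g y).
have [v [w [-> Yw vE yv dom]]] : exists v w,
    [/\ better b (f x y, y) = (v, w), Y w, v = f x w, f x y <= v &
        forall z, dominated b z -> f x z <= v].
  case: b bP {Sdom prog} => [[v0 w0]|_].
    move=> [Yw0 v0E]; rewrite /better /=; case: ifP => [le|/negbT].
      by exists v0, w0.
    rewrite -ltNge => lt; exists (f x y), y; split=> // z /= h.
    by apply: le_trans h (ltW lt).
  by exists (f x y), y.
have cut z : Y z -> ~ halfspace g y z -> f x z <= v.
  move=> Yz /negP; rewrite /halfspace /= -ltNge => lt.
  apply: le_trans yv; apply: le_trans (gy_supergradient hs Xx Yy Yz) _.
  by rewrite gerDl ltW.
have [cH vH] : closed (S `&` halfspace g y) /\ convex_set (S `&` halfspace g y : set (convex_lmodType 'rV[R]_m)).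
  by split; [apply: closedI => //; exact: closed_halfspace|exact: convex_halfspace].
have domI z : Y z -> ~ (S `&` halfspace g y) z -> f x z <= v.
  move=> Yz; have [Sz|nSz] := pselect (S z); last by move=> _; exact/dom/Sdom.
  by move=> nH; apply: cut => // Hz; exact: nH.
have [g0|g0] := eqVneq g 0.
  have HT : halfspace g y = setT.
    by rewrite -subTset => z _; rewrite /halfspace /= g0 dot0l.
  have domY z : Y z -> f x z <= v.
    move=> Yz; apply: le_trans yv; apply: le_trans (gy_supergradient hs Xx Yy Yz) _.
    by rewrite -/g g0 dot0l addr0.
  split=> //=; [|by rewrite HT setIT|by left].
  by split=> // z [/SY].
have [kept0 kept] := volume_halfspace_gt0 cS cvxS V0 g0.
split=> //=; first by split=> // z [/SY].
case: prog => [all|prog]; first by left=> z /all; exact: dom.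
right; apply: le_trans kept _; rewrite exprS -mulrA ler_wpM2l//.
Qed.

Lemma cog_invariant (delta : R) : exists S b,
  [/\ output (exec f gx gy (repeat (cog_queries pb delta) (cog_step x) (Y, None))) = (S, b),
      invariant (cog_queries pb delta) (S, b),
      calls_x (exec f gx gy (repeat (cog_queries pb delta) (cog_step x) (Y, None))) = 0%N &
      (calls_y (exec f gx gy (repeat (cog_queries pb delta) (cog_step x) (Y, None))) <=
       cog_queries pb delta)%N].
Proof.
have I0 : invariant 0 (Y, None).
  split=> //=; [|exact: volume_Y_gt0|by right; rewrite expr0 mul1r].
  split=> //; last exact: Y_convex hs.
  by apply: (compact_closed _ (Y_compact hs)); exact: norm_hausdorff.
have [] := repeat_invariant (cog_queries pb delta) invariant_step I0.
rewrite add0n muln0 muln1; case: (output _) => S b.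
by move=> I1 cx cy; exists S, b.
Qed.

Context (B0 : 0 < B pb).

(** The query count solves this inequality in logarithms: [e / (e - 1)] is the inverse of the factor
    [1 - 1 / e] lost per cut. *)
Lemma cog_queries_pow delta : 0 < delta ->
  (1 - (expR 1)^-1) ^+ cog_queries pb delta <= (delta / B pb) ^+ m.
Proof.
move=> d0.
have E0 : 0 < expR 1 :> R by exact: expR_gt0.
have E1 : 1 < expR 1 :> R by rewrite -{1}expR0 ltr_expR.
have q0 : 0 < 1 - (expR 1)^-1 :> R by rewrite subr_gt0 invf_lt1.
have qE : 1 - (expR 1)^-1 = (expR 1 / (expR 1 - 1))^-1 :> R.
  by rewrite invf_div; field; rewrite gt_eqF//.
have lq : 0 < ln (expR 1 / (expR 1 - 1)) :> R.
  by rewrite ln_gt0// ltr_pdivlMr; lra.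
have a0 : 0 < delta / B pb by rewrite divr_gt0.
rewrite -ler_ln ?posrE ?exprn_gt0// !lnXn// qE lnV; last first.
  by rewrite posrE divr_gt0// subr_gt0.
have -> : delta / B pb = (B pb / delta)^-1 by rewrite invf_div.
rewrite lnV ?posrE ?divr_gt0// !mulNrn lerN2.
have := ceiln_ge (m%:R * ln (B pb / delta) / ln (expR 1 / (expR 1 - 1))).
rewrite -/(cog_queries pb delta) ler_pdivrMr// => h.
by rewrite -[leLHS]mulr_natl -[leRHS]mulr_natl.
Qed.

Lemma cog_maxy_delta_maximizer delta : 0 < delta ->
  [/\ delta_maximizer Y (f x) delta (output (exec f gx gy (cog_maxy pb x delta))),
      calls_x (exec f gx gy (cog_maxy pb x delta)) = 0%N &
      (calls_y (exec f gx gy (cog_maxy pb x delta)) <= cog_queries pb delta)%N].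
Proof.
move=> d0; have [S [b [oE inv cx cy]]] := cog_invariant delta.
rewrite /cog_maxy !bindE /= oE cx !addn0; split=> //=.
case: inv => [[/= clS SY cvxS] V0 bP Sdom prog].
have triv y : Y y -> B pb <= delta -> delta_maximizer Y (f x) delta y.
  move=> Yy Bd; split=> //; rewrite lerBlDl; apply: primal_le => z Yz.
  by apply: le_trans (f_le_shift Xx Yy Yz) _; rewrite lerD2l.
have cS : compact S by exact: subclosed_compact clS (Y_compact hs) SY.
(* [f x] varies by at most [B] on [Y], so for [B <= delta] any point of [Y] will do, including the
   default [get Y]. *)
have [Bd|dB] := leP (B pb) delta.
  apply: triv => //; case: b bP {oE Sdom prog} => [[v y] []//|_].
  by apply: getPex; exact: Y_nonempty.
(* With no query the previous bound would read [1 <= (delta / B) ^+ m], impossible for [delta < B]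
   and [1 <= m]. So a best query exists. *)
have T0 : cog_queries pb delta != 0%N.
  have := cog_queries_pow d0; apply: contraTneq => ->; rewrite expr0 -ltNge.
  rewrite exprn_ilt1//; last 2 first.
  - by rewrite divr_ge0// ltW.
  - by rewrite ltr_pdivrMr// mul1r.
  by rewrite -lt0n; exact: m_ge1 hs.
case: b bP Sdom prog {oE} => [[v y]|/eqP]; last by rewrite (negPf T0).
move=> [Yy vE] Sdom prog; split=> //; rewrite lerBlDl; apply: primal_le => z Yz.
rewrite -vE; case: prog => [all|prog].
  by apply: le_trans (all _ Yz) _; rewrite lerDl ltW.
pose a := delta / B pb; have a0 : 0 < a by rewrite divr_gt0.
have a1 : a < 1 by rewrite ltr_pdivrMr// mul1r.
(* At the ratio [a] itself the volume comparison is not strict; it is strict for each [a' > a], and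
   the bound passes to the limit. *)
suff H a' : a < a' -> a' < 1 -> f x z <= v + a' * B pb.
  by rewrite -(divfK (lt0r_neq0 B0) delta); exact: ler_of_forall_gt_lt1 H.
move=> aa' a'1; have a'0 : 0 < a' by apply: lt_trans aa'.
have a'01 : 0 <= a' <= 1 by rewrite !ltW.
have [u Yu nSu] : exists2 u, Y u & ~ S (a' *: u + (1 - a') *: z).
  apply: contrapT => nex.
  have sub u : Y u -> S (a' *: u + (1 - a') *: z).
    by move=> Yu; apply: contrapT => nS; apply: nex; exists u.
  have := volume_scale_le (Y_compact hs) cS a'0 sub.
  apply/negP; rewrite -ltNge; apply: le_lt_trans prog _.
  rewrite ltr_pM2r ?volume_Y_gt0//; apply: le_lt_trans (cog_queries_pow d0) _.
  by rewrite ltrXn2r// ?nnegrE ?ltW// -?lt0n; case: (m) (m_ge1 hs).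
clear prog; have Yw := convex_setP (Y_convex hs) Yu Yz a'01.
have := Sdom _ Yw nSu => /= wv.
have := f_strongly_concave hs Xx Yu Yz a'01; rewrite /= => sc.
have uz := f_le_shift Xx Yu Yz.
have nn : 0 <= nu pb / 2 * a' * (1 - a') * enorm (u - z) ^+ 2.
  apply: mulr_ge0; last exact: sqr_ge0.
  by rewrite !mulr_ge0 ?subr_ge0 ?(ltW a'0) ?(ltW a'1)// ltW ?(nu_gt0 hs).
have p : a' * f x z <= a' * (f x u + B pb) by rewrite ler_pM2l.
lra.
Qed.

End Loop.
End CenterOfGravityMethod.

(** * First-order inequalities and the accelerated block *)

Section FirstOrder.
Context {R : realType} {d : nat} (A : set 'rV[R]_d).
Context (cvxA : convex_set (A : set (convex_lmodType 'rV[R]_d))).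
Implicit Types (h : 'rV[R]_d -> R) (x y p q g : 'rV[R]_d) (c L K : R).

Definition first_order_convex (c : R) h (G : 'rV[R]_d -> 'rV[R]_d) :=
  forall p q, A p -> A q -> h p + dot (G p) (q - p) + c / 2 * enorm (q - p) ^+ 2 <= h q.

Definition first_order_smooth (L : R) h (G : 'rV[R]_d -> 'rV[R]_d) :=
  forall p q, A p -> A q -> h q <= h p + dot (G p) (q - p) + L / 2 * enorm (q - p) ^+ 2.

Lemma segment_in x y t : A x -> A y -> 0 <= t <= 1 -> A (x + t *: (y - x)).
Proof.
move=> Ax Ay t01; have := convex_setP cvxA Ay Ax t01.
by congr (A _); apply/rowP => i; rewrite !mxE; ring.
Qed.

(** One short step inside the neighbourhood suffices for the first-order inequality. The extra
    demand [t <= e] lets the factor [1 - t] of strong convexity be replaced by 1 at small cost. *)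
Lemma gradient_along h x g y (e : R) : is_gradient A h x g -> A x -> A y -> 0 < e ->
  exists t, [/\ 0 < t, t <= 1, t <= e &
    t * dot g (y - x) - e * t * enorm (y - x) <= h (x + t *: (y - x)) - h x].
Proof.
move=> gr Ax Ay e0; have := gr e e0; rewrite near_withinE => /nbhs_ballP[r r0 rP].
set D := enorm (y - x); have D0 : 0 <= D by exact: enorm_ge0.
pose t := Num.min (Num.min 1 e) (r / (D + 1)).
have t0 : 0 < t by rewrite !lt_min ltr01 e0 divr_gt0//; lra.
have t1 : t <= 1 by rewrite !ge_min lexx.
have te : t <= e by rewrite !ge_min lexx orbT.
have tr : t * (D + 1) <= r by rewrite -ler_pdivlMr ?ge_min ?lexx ?orbT//; lra.
exists t; split=> //.
have At : A (x + t *: (y - x)) by apply: segment_in => //; rewrite ltW.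
have : ball x r (x + t *: (y - x)).
  split=> // i j; rewrite ord1 /ball /=.
  have := coord_le_enorm (y - x) j; rewrite -/D => cle.
  rewrite !mxE opprD addrA subrr add0r normrN normrM (gtr0_norm t0).
  have := cle; rewrite !mxE => {}cle; nra.
move=> /rP /(_ At).
have -> : x + t *: (y - x) - x = t *: (y - x) by rewrite addrC addKr.
rewrite dotZr enormZ (gtr0_norm t0) -/D.
by rewrite ler_norml => /andP[+ _]; lra.
Qed.

Lemma strongly_convex_first_order (c : R) h G : strongly_convex A c h ->
  (forall x, A x -> is_gradient A h x (G x)) -> first_order_convex c h G.
Proof.
move=> sc gr x y Ax Ay; set g := G x; set D := enorm (y - x).
have D0 : 0 <= D by exact: enorm_ge0.
apply/ler_addgt0Pr => e e0.
(* With tolerance [e / k], the gradient error [D * (e / k)] and the loss from [1 - t] together stay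
   below [e]. *)
pose k := D + `|c| * D ^+ 2 + 1.
have cD : 0 <= `|c| * D ^+ 2 by rewrite mulr_ge0 ?sqr_ge0.
have k0 : 0 < k by rewrite /k; lra.
have [t [t0 t1 te H]] := gradient_along (gr x Ax) Ax Ay (divr_gt0 e0 k0).
have := sc y x t Ay Ax; rewrite (ltW t0) t1 => /(_ isT).
have -> : t *: y + (1 - t) *: x = x + t *: (y - x).
  by apply/rowP => i; rewrite !mxE; ring.
move: H; rewrite -/g -/D; set b := dot g _; set hp := h (x + _) => H1 H2.
have H3 : t * (b - e / k * D + c / 2 * (1 - t) * D ^+ 2) <= t * (h y - h x) by nra.
rewrite ler_pM2l// in H3.
have H4 : c / 2 * t * D ^+ 2 <= `|c| * D ^+ 2 * (e / k).
  have h1 : c * D ^+ 2 <= `|c| * D ^+ 2 by rewrite ler_wpM2r ?sqr_ge0// ler_norm.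
  have h2 : `|c| * D ^+ 2 * t <= `|c| * D ^+ 2 * (e / k) by rewrite ler_wpM2l.
  nra.
have H5 : (D + `|c| * D ^+ 2) * (e / k) <= e.
  rewrite mulrA ler_pdivrMr// mulrC ler_pM2l// /k; lra.
lra.
Qed.

Lemma le_of_le_add_invn (a b c : R) : (forall N : nat, a <= b + c / N.+1%:R) -> a <= b.
Proof.
move=> H; apply/ler_addgt0Pr => e e0; pose N := Num.truncn (`|c| / e).
apply: le_trans (H N) _; rewrite lerD2l ler_pdivrMr ?ltr0n//.
apply: le_trans (ler_norm _) _; rewrite mulrC -ler_pdivrMr// ltW//.
exact: truncnS_gt.
Qed.

Let node p q N (j : nat) := p + (j%:R / N.+1%:R) *: (q - p).

Let node_in p q N j : A p -> A q -> (j <= N.+1)%N -> A (node p q N j).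
Proof.
move=> Ap Aq jN; apply: segment_in => //.
by rewrite divr_ge0//= ler_pdivrMr ?ltr0n// mul1r ler_nat.
Qed.

Let node_step p q N j : node p q N j.+1 - node p q N j = N.+1%:R^-1 *: (q - p).
Proof.
rewrite /node opprD addrACA subrr add0r -scalerBl -mulrBl -natr1.
by rewrite addrAC subrr add0r mul1r.
Qed.

Let node0 p q N : node p q N 0 = p.
Proof. by rewrite /node mul0r scale0r addr0. Qed.

Let nodeN p q N : node p q N N.+1 = q.
Proof. by rewrite /node divff ?pnatr_eq0// scale1r addrC subrK. Qed.

Lemma first_order_convex_weaken c h G : 0 <= c -> first_order_convex c h G ->
  forall p q, A p -> A q -> h p + dot (G p) (q - p) <= h q.
Proof.
move=> c0 H p q Ap Aq; apply: le_trans (H p q Ap Aq).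
by rewrite lerDl mulr_ge0 ?sqr_ge0 ?divr_ge0.
Qed.

(* Summing the gradient inequality over a subdivision of the segment replaces
   the integral of the gradient along it. *)
Lemma lipschitz_gradient_smooth c L h G : 0 <= c -> first_order_convex c h G ->
  (forall x y, A x -> A y -> enorm (G x - G y) <= L * enorm (x - y)) ->
  first_order_smooth L h G.
Proof.
move=> c0 /(first_order_convex_weaken c0) cv lip p q Ap Aq.
set D := enorm (q - p); have D0 : 0 <= D by exact: enorm_ge0.
apply: (@le_of_le_add_invn _ _ (L / 2 * D ^+ 2)) => N.
pose b := dot (G p) (q - p); pose s : R := N.+1%:R^-1.
have s0 : 0 < s by rewrite invr_gt0 ltr0n.
have sN : s * N.+1%:R = 1 by rewrite mulVf// pnatr_eq0.
have H j : (j <= N.+1)%N ->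
    h (node p q N j) <= h p + j%:R * s * b + L * D ^+ 2 * s ^+ 2 * (j%:R * (j%:R + 1) / 2).
  elim: j => [|j IH] jN; first by rewrite node0 !mul0r mulr0 !addr0.
  have := cv _ _ (node_in Ap Aq jN) (node_in Ap Aq (ltnW jN)).
  rewrite -opprB dotNr node_step dotZr -/s.
  have := cauchy_schwarz (G (node p q N j.+1) - G p) (q - p); rewrite -/D.
  have := lip _ _ (node_in Ap Aq jN) Ap.
  rewrite {2}/node addrAC subrr add0r enormZ ger0_norm ?divr_ge0// -/s -/D => l1 cs.
  rewrite dotDl dotNl -/b in cs => l2.
  have := IH (ltnW jN); rewrite -(natr1 j) => {}IH.
  have l3 : enorm (G (node p q N j.+1) - G p) * D <= L * ((j%:R + 1) * s * D) * D.
    by rewrite natr1 ler_wpM2r.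
  set a1 := dot (G (node p q N j.+1)) (q - p) in cs l2.
  have l4 : s * (a1 - b) <= s * (L * ((j%:R + 1) * s * D) * D) by rewrite ler_pM2l//; lra.
  by nra.
have := H _ (leqnn _); rewrite nodeN (mulrC N.+1%:R s) sN mul1r.
have -> : L * D ^+ 2 * s ^+ 2 * (N.+1%:R * (N.+1%:R + 1) / 2) =
   L / 2 * D ^+ 2 * ((s * N.+1%:R) * (s * N.+1%:R + s)) by field.
by rewrite sN -/s -/b; lra.
Qed.

(** On each piece of a subdivision, convexity bounds the increment of [h1] by its gradient at the
    right end and that of [h2] from below by its gradient at the left end. The mismatch of the two
    nodes costs [L * D ^+ 2 * s ^+ 2] per piece, which vanishes in the limit after summation. *)
Lemma coupled_difference_le c L K h1 G1 h2 G2 : 0 <= c ->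
  first_order_convex c h1 G1 -> first_order_convex c h2 G2 ->
  (forall x y, A x -> A y -> enorm (G2 x - G2 y) <= L * enorm (x - y)) ->
  (forall x, A x -> enorm (G1 x - G2 x) <= K) ->
  forall p q, A p -> A q -> h1 q - h2 q <= h1 p - h2 p + K * enorm (q - p).
Proof.
move=> c0 /(first_order_convex_weaken c0) cv1 /(first_order_convex_weaken c0) cv2.
move=> lip GK p q Ap Aq.
set D := enorm (q - p); have D0 : 0 <= D by exact: enorm_ge0.
apply: (@le_of_le_add_invn _ _ (L * D ^+ 2)) => N.
pose s : R := N.+1%:R^-1.
have s0 : 0 < s by rewrite invr_gt0 ltr0n.
have sN : s * N.+1%:R = 1 by rewrite mulVf// pnatr_eq0.
have H j : (j <= N.+1)%N -> h1 (node p q N j) - h2 (node p q N j) <=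
    h1 p - h2 p + j%:R * (s * (K * D) + s ^+ 2 * (L * D ^+ 2)).
  elim: j => [|j IH] jN; first by rewrite node0 mul0r addr0.
  have := IH (ltnW jN); rewrite -(natr1 j) => {}IH.
  have := cv1 _ _ (node_in Ap Aq jN) (node_in Ap Aq (ltnW jN)).
  rewrite -opprB dotNr node_step dotZr -/s.
  have := cv2 _ _ (node_in Ap Aq (ltnW jN)) (node_in Ap Aq jN).
  rewrite node_step dotZr -/s.
  have := cauchy_schwarz (G1 (node p q N j.+1) - G2 (node p q N j.+1)) (q - p).
  have := cauchy_schwarz (G2 (node p q N j.+1) - G2 (node p q N j)) (q - p).
  have := lip _ _ (node_in Ap Aq jN) (node_in Ap Aq (ltnW jN)).
  rewrite node_step enormZ (gtr0_norm s0) -/D.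
  have := GK _ (node_in Ap Aq jN).
  rewrite !dotDl !dotNl.
  set a1 := dot (G1 (node p q N j.+1)) _; set a2 := dot (G2 (node p q N j.+1)) _.
  set a3 := dot (G2 (node p q N j)) _.
  set e1 := enorm (G1 _ - _); set e2 := enorm (G2 _ - _) => k1 k2 k3 k4 k5 k6.
  have k7 : s * (e1 * D) <= s * (K * D) by rewrite ler_pM2l// ler_wpM2r.
  have k8 : s * (e2 * D) <= s * (L * (s * D) * D) by rewrite ler_pM2l// ler_wpM2r.
  have k9 : s * (a1 - a2) <= s * (e1 * D) by rewrite ler_pM2l.
  have k10 : s * (a2 - a3) <= s * (e2 * D) by rewrite ler_pM2l.
  have k11 : s * (L * (s * D) * D) = s ^+ 2 * (L * D ^+ 2) by ring.
  lra.
have := H _ (leqnn _); rewrite nodeN.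
have -> : N.+1%:R * (s * (K * D) + s ^+ 2 * (L * D ^+ 2)) =
   (s * N.+1%:R) * (K * D + s * (L * D ^+ 2)) by ring.
by rewrite sN mul1r -/s; lra.
Qed.

End FirstOrder.

(** * The accelerated block *)

Section BlockAnalysis.
Context {R : realType} {n m : nat} (pb : params R n m).
Context (f : 'rV[R]_n -> 'rV[R]_m -> R) (gx : 'rV[R]_n -> 'rV[R]_m -> 'rV[R]_n)
  (gy : 'rV[R]_n -> 'rV[R]_m -> 'rV[R]_m).
Local Notation X := (dom_x pb).
Local Notation run := (exec f gx gy).
Context (cptX : compact X) (cvxX : convex_set (X : set (convex_lmodType 'rV[R]_n))).

Lemma convex_average (p q : 'rV[R]_n) (a b : R) : X p -> X q -> 0 <= a -> 0 < b ->
  X ((a + b)^-1 *: (a *: p + b *: q)).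
Proof.
move=> Xp Xq a0 b0; have ab0 : 0 < a + b by lra.
have t01 : 0 <= a / (a + b) <= 1.
  by rewrite divr_ge0 ?ler_pdivrMr//=; lra.
have := convex_setP cvxX Xp Xq t01; congr (X _).
rewrite scalerDr !scalerA; congr (_ *: _ + _ *: _); first by rewrite mulrC.
by field; rewrite gt_eqF.
Qed.

Context (gradF : 'rV[R]_n -> prog R n m 'rV[R]_n) (xbar : 'rV[R]_n) (gamma muF LF : R).
Context (F : 'rV[R]_n -> R) (G : 'rV[R]_n -> 'rV[R]_n).
Context (gradFP : forall p, X p -> [/\ output (run (gradF p)) = G p,
  calls_x (run (gradF p)) = 1%N & calls_y (run (gradF p)) = 0%N]).
Context (Xxbar : X xbar) (gamma0 : 0 < gamma) (muF0 : 0 <= muF) (LF0 : 0 < LF).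
Context (Fcvx : first_order_convex X muF F G) (Fsm : first_order_smooth X LF F G).

(** The estimate function in expanded form: [b_Gamma] and [b_r] are its coefficients. The program
    does not carry its constant term, which the invariant therefore quantifies existentially. *)
Let model (s : block_state R n) c x := b_Gamma s / 2 * dot x x - dot (b_r s) x + c.

Let invariant (i : nat) (s : block_state R n) :=
  [/\ b_A s = gamma * (i%:R * (i%:R + 3)) / (4 * LF),
      b_Gamma s = gamma + muF * b_A s,
      X (b_u s) /\ X (b_z s),
      forall x, X x -> 0 <= dot (b_Gamma s *: b_z s - b_r s) (x - b_z s) &
      exists c, b_A s * F (b_u s) <= model s c (b_z s) /\
        forall x, X x -> model s c x <= b_A s * F x + gamma / 2 * enorm (x - xbar) ^+ 2].

Let model_at_min s c x : X x ->
  (forall x, X x -> 0 <= dot (b_Gamma s *: b_z s - b_r s) (x - b_z s)) ->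
  model s c (b_z s) + b_Gamma s / 2 * enorm (x - b_z s) ^+ 2 <= model s c x.
Proof.
move=> Xx /(_ x Xx); rewrite /model enorm_sq !dotE (dotC x (b_z s)); lra.
Qed.

Let invariant_step i s : invariant i s ->
  [/\ invariant i.+1 (output (run (block_step pb gradF gamma muF LF i.+1 s))),
      calls_x (run (block_step pb gradF gamma muF LF i.+1 s)) = 1%N &
      calls_y (run (block_step pb gradF gamma muF LF i.+1 s)) = 0%N].
Proof.
case: s => A Gam u z r [/= AE GE [Xu Xz] opt [c [uc cF]]].
rewrite /block_step !bindE /=.
pose a := i.+2%:R * gamma / (2 * LF); rewrite -/a.
have a0 : 0 < a by rewrite divr_gt0 ?mulr_gt0// ltr0n.
have A0 : 0 <= A.
  by rewrite AE divr_ge0 ?mulr_ge0 ?addr_ge0 ?(ltW gamma0) ?(ltW LF0).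
have A'0 : 0 < A + a by lra.
have [x1 x1E] : exists x1, x1 = (A + a)^-1 *: (A *: u + a *: z) by eexists.
rewrite -x1E.
have Xx1 : X x1 by rewrite x1E; exact: convex_average.
have [-> -> ->] := gradFP Xx1.
split=> //=; set g := G x1.
set Gam' := Gam + muF * a; set r' := r + a *: (muF *: x1 - g).
have muA : 0 <= muF * A by rewrite mulr_ge0.
have mua : 0 <= muF * a by rewrite mulr_ge0// ltW.
have Gam0 : 0 < Gam by rewrite GE ltr_wpDr.
have Gam'0 : 0 < Gam' by rewrite ltr_wpDr.
have X0 : X !=set0 by exists xbar.
have [Xz' pz'] := projP X0 cptX cvxX (Gam'^-1 *: r').
move: (Defs.proj X _) Xz' pz' => z' Xz' pz'.
have [u' u'D] : exists u', u' = (A + a)^-1 *: (A *: u + a *: z') by eexists.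
rewrite -u'D.
have Xu' : X u' by rewrite u'D; exact: convex_average.
have opt' x : X x -> 0 <= dot (Gam' *: z' - r') (x - z').
  move=> /pz'; have -> : Gam' *: z' - r' = Gam' *: (z' - Gam'^-1 *: r').
    by rewrite scalerBr scalerA mulfV ?gt_eqF// scale1r.
  by rewrite dotZl; exact: mulr_ge0 (ltW Gam'0).
pose c' := c + a * (F x1 - dot g x1 + muF / 2 * dot x1 x1).
pose s := BlockState A Gam u z r; pose s' := BlockState (A + a) Gam' u' z' r'.
have modelE x : model s' c' x =
    model s c x + a * (F x1 + dot g (x - x1) + muF / 2 * enorm (x - x1) ^+ 2).
  by rewrite /model /s' /s /= /c' /Gam' /r' enorm_sq !dotE (dotC x x1); field.
split=> //=.
- by rewrite AE /a -(natr1 i.+1) -natr1; field; rewrite gt_eqF.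
- by rewrite /Gam' GE; ring.
exists c'; split; last first.
  move=> x Xx; rewrite -/s' modelE.
  have := cF x Xx; have := Fcvx Xx1 Xx; rewrite -/g => h1.
  have : a * (F x1 + dot g (x - x1) + muF / 2 * enorm (x - x1) ^+ 2) <= a * F x.
    by rewrite ler_pM2l.
  by rewrite mulrDl -/s; lra.
rewrite -/s' modelE.
have h1 := model_at_min (s := s) c Xz' opt; rewrite /= in h1.
have h2 : muF / 2 * enorm (z' - x1) ^+ 2 >= 0 by rewrite mulr_ge0 ?divr_ge0 ?sqr_ge0.
have h3 := Fcvx Xx1 Xu; rewrite -/g in h3.
have h4 : muF / 2 * enorm (u - x1) ^+ 2 >= 0 by rewrite mulr_ge0 ?divr_ge0 ?sqr_ge0.
have h5 := Fsm Xx1 Xu'; rewrite -/g in h5.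
have u'E : (A + a) * dot g u' = A * dot g u + a * dot g z'.
  by rewrite u'D !dotE mulVKf// gt_eqF.
have diffE : u' - x1 = (a / (A + a)) *: (z' - z).
  by rewrite u'D x1E; apply/rowP => j; rewrite !mxE; field; rewrite gt_eqF.
(* The condition that the step size has to meet. With [gamma] for [Gam] and in units of
   [gamma ^+ 2 / (4 * LF)] it reads [(i + 2)^2 <= (i + 1) (i + 4)]; the step performed is number
   [i.+1], hence the shift. *)
have h6 : LF * a ^+ 2 <= (A + a) * Gam.
  have : LF * a ^+ 2 <= (A + a) * gamma.
    have -> : LF * a ^+ 2 = gamma ^+ 2 / (4 * LF) * (i.+2%:R * i.+2%:R).
      by rewrite /a; field; rewrite gt_eqF.
    have -> : (A + a) * gamma = gamma ^+ 2 / (4 * LF) * (i.+1%:R * (i.+1%:R + 3)).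
      by rewrite AE /a -(natr1 i.+1) -natr1; field; rewrite gt_eqF.
    apply: ler_wpM2l; first by rewrite divr_ge0 ?sqr_ge0// mulr_ge0// ltW.
    by rewrite -(natr1 i.+1) -natr1; have := ler0n R i; nra.
  by move/le_trans; apply; rewrite ler_pM2l// GE lerDl.
have h7 : (A + a) * (LF / 2 * enorm (u' - x1) ^+ 2) <= Gam / 2 * enorm (z' - z) ^+ 2.
  have aA0 : 0 <= a / (A + a) by rewrite divr_ge0// ltW.
  rewrite diffE enormZ ger0_norm// exprMn.
  have -> : (A + a) * (LF / 2 * ((a / (A + a)) ^+ 2 * enorm (z' - z) ^+ 2)) =
     (LF * a ^+ 2) / (A + a) * (enorm (z' - z) ^+ 2 / 2) by field; rewrite gt_eqF.
  have -> : Gam / 2 * enorm (z' - z) ^+ 2 = Gam * (enorm (z' - z) ^+ 2 / 2) by ring.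
  apply: ler_wpM2r.
    by rewrite divr_ge0 ?sqr_ge0.
  by rewrite ler_pdivrMr// [leRHS]mulrC.
have h8 : (A + a) * F u' <= (A + a) * (F x1 + dot g (u' - x1) + LF / 2 * enorm (u' - x1) ^+ 2).
  by rewrite ler_pM2l.
have h9 : A * (F x1 + dot g (u - x1)) <= A * F u by apply: ler_wpM2l => //; lra.
have h10 : 0 <= a * (muF / 2 * enorm (z' - x1) ^+ 2) by rewrite mulr_ge0// ltW.
move: h8 h9; rewrite !dotDr !dotNr => h8 h9.
apply: le_trans h8 _; move: u'E h1 h7 h10 uc h9 => /=.
set X1 := dot g u'; set X2 := dot g u; set X3 := dot g z'; set X4 := dot g x1.
set N1 := enorm (u' - x1) ^+ 2; set N2 := enorm (z' - z) ^+ 2; set N3 := enorm (z' - x1) ^+ 2.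
set M1 := model _ _ _; set M2 := model _ _ _ => u'E k1 k7 k10 kuc k9.
have k8 : (A + a) * X1 = A * X2 + a * X3 by [].
lra.
Qed.

Lemma block_iterP k :
  [/\ invariant k (output (run (block_iter pb gradF xbar gamma muF LF k))),
      calls_x (run (block_iter pb gradF xbar gamma muF LF k)) = k &
      calls_y (run (block_iter pb gradF xbar gamma muF LF k)) = 0%N].
Proof.
elim: k => [|k [IH1 IH2 IH3]].
  split=> //; split=> //=; rewrite ?mul0r ?mulr0 ?mul0r ?addr0//.
    by move=> x _; rewrite subrr dot0l.
  exists (gamma / 2 * dot xbar xbar); split=> [|x _]; rewrite /model /= ?enorm_sq !dotE.
    by rewrite ?mul0r; lra.
  by rewrite ?mul0r (dotC xbar x); lra.
rewrite (_ : block_iter _ _ _ _ _ _ k.+1 = bind (block_iter pb gradF xbar gamma muF LF k)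
  (block_step pb gradF gamma muF LF k.+1))//.
move: (invariant_step IH1) IH2 IH3; rewrite !bindE => -[I1 x1 y1] IH2 IH3.
by rewrite IH2 IH3 x1 y1 addn1 addn0.
Qed.

Lemma blockP k : exists u z,
  let A := gamma * (k%:R * (k%:R + 3)) / (4 * LF) in
  [/\ output (run (block pb gradF xbar gamma muF LF k)) = (u, z, A),
      X u /\ X z,
      forall x, X x -> A * F u + (gamma + muF * A) / 2 * enorm (x - z) ^+ 2 <=
        A * F x + gamma / 2 * enorm (x - xbar) ^+ 2,
      calls_x (run (block pb gradF xbar gamma muF LF k)) = k &
      calls_y (run (block pb gradF xbar gamma muF LF k)) = 0%N].
Proof.
have [] := block_iterP k; rewrite /block !bindE /=.
case: (output _) => A Gam u z r [/= AE GE [Xu Xz] opt [c [uc cF]]] cx cy.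
exists u, z; rewrite -AE -GE !addn0; split=> // x Xx.
apply: le_trans (cF x Xx); apply: le_trans (model_at_min (s := BlockState A Gam u z r) c Xx opt).
by rewrite /= lerD2r.
Qed.

End BlockAnalysis.

Section Comparison.
Context {R : realType} {d : nat} (A : set 'rV[R]_d).
Context (cvxA : convex_set (A : set (convex_lmodType 'rV[R]_d))).

(* Testing against [v + s (x - v)] instead of [x] absorbs the quadratic term
   into the strong convexity, so that no minimizer is needed. *)
Lemma comparator_shift (c beta e0 E s : R) (F : 'rV[R]_d -> R) u v :
  strongly_convex A c F -> A v -> 0 <= s <= 1 -> beta * s <= c / 2 * (1 - s) ->
  (forall x, A x -> F u <= F x + beta * enorm (x - v) ^+ 2 + e0) ->
  (forall x, A x -> F v <= F x + E) ->
  forall x, A x -> F u <= F x + ((1 - s) * E + e0).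
Proof.
move=> sc Av s01 bs uP vP x Ax; have s0 : 0 <= s by case/andP: s01.
have s1 : 0 <= 1 - s by rewrite subr_ge0; case/andP: s01.
have Axs := convex_setP cvxA Ax Av s01.
have := uP _ Axs; have := sc x v s Ax Av s01; have := vP _ Ax.
have -> : s *: x + (1 - s) *: v - v = s *: (x - v).
  by apply/rowP => i; rewrite !mxE; ring.
rewrite enormZ exprMn real_normK ?num_real// => h1 h2 h3.
have D0 : 0 <= enorm (x - v) ^+ 2 by rewrite sqr_ge0.
have h4 : beta * s * (s * enorm (x - v) ^+ 2) <= c / 2 * (1 - s) * (s * enorm (x - v) ^+ 2).
  by apply: ler_wpM2r => //; exact: mulr_ge0.
have h5 : (1 - s) * F v <= (1 - s) * (F x + E) by apply: ler_wpM2l.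
nra.
Qed.

End Comparison.

(** * The saddle problem *)

Section SaddleProblem.
Context {R : realType} {n m : nat} (pb : params R n m).
Context (f : 'rV[R]_n -> 'rV[R]_m -> R) (gx : 'rV[R]_n -> 'rV[R]_m -> 'rV[R]_n)
  (gy : 'rV[R]_n -> 'rV[R]_m -> 'rV[R]_m).
Context (hs : setting pb f gx gy).
Local Notation X := (dom_x pb).
Local Notation Y := (dom_y pb).
Local Notation P := (primal pb f).

Lemma compact_X : compact X.
Proof.
apply: bounded_closed_compact; last exact: X_closed hs.
exact: diameter_bounded_set (X_diam hs).
Qed.

Lemma L_gt0 : 0 < L pb.
Proof. exact: lt_le_trans (mu_gt0 hs) (mu_le_L hs). Qed.

Lemma chi_ge0 : 0 <= chi pb.
Proof. by rewrite divr_ge0 ?sqr_ge0// mulr_ge0// ltW ?(mu_gt0 hs) ?(nu_gt0 hs). Qed.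

Lemma chibar_ge1 : 1 <= chibar pb. Proof. by rewrite lerDl chi_ge0. Qed.

Lemma kappa_ge1 : 1 <= kappa pb.
Proof. by rewrite ler_pdivlMr ?(mu_gt0 hs)// mul1r; exact: mu_le_L hs. Qed.

Lemma f_first_order_convex y : Y y -> first_order_convex X (mu pb) (f^~ y) (gx^~ y).
Proof.
move=> Yy; apply: strongly_convex_first_order; first exact: X_convex hs.
  exact: f_strongly_convex hs y Yy.
by case: (f_smooth hs Yy).
Qed.

Lemma f_first_order_smooth y : Y y -> first_order_smooth X (L pb) (f^~ y) (gx^~ y).
Proof.
move=> Yy; apply: (@lipschitz_gradient_smooth _ _ _ (X_convex hs) _ _ _ _ (ltW (mu_gt0 hs))
  (f_first_order_convex Yy)).
by case: (f_smooth hs Yy).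
Qed.

Lemma primal_strongly_convex : strongly_convex X (mu pb) P.
Proof.
move=> x y t Xx Xy t01; apply: (primal_le hs) => z Yz.
apply: le_trans (f_strongly_convex hs Yz Xx Xy t01) _.
have h1 := le_primal hs Xx Yz; have h2 := le_primal hs Xy Yz.
case/andP: t01 => t0 t1; rewrite lerD2r lerD//; first exact: ler_wpM2l.
by apply: ler_wpM2l => //; rewrite subr_ge0.
Qed.

(* Strong concavity at the midpoint of [y] and a competitor [z] yields
   [f v z - f v y + nu / 4 |z - y|^2 <= 2 delta], where the left-over quadratic
   absorbs the coupling term; no exact maximizer of [f v] is involved. *)
Lemma primal_upper x v y delta : X x -> X v -> delta_maximizer Y (f v) delta y ->
  P x <= f x y + 2 * delta + mu pb * chi pb * enorm (x - v) ^+ 2.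
Proof.
move=> Xx Xv [Yy dy]; apply: (primal_le hs) => z Yz.
have n0 := nu_gt0 hs; have m0 := mu_gt0 hs.
have cpl : f x z - f x y <= f v z - f v y + `|ell pb| * enorm (z - y) * enorm (x - v).
  have [_ lip] := f_smooth hs Yy.
  apply: (coupled_difference_le (X_convex hs) (ltW m0) (f_first_order_convex Yz)
    (f_first_order_convex Yy) lip) => //.
  move=> p Xp; apply: le_trans (f_coupling hs Xp Yz Yy) _.
  by rewrite ler_wpM2r ?enorm_ge0// ler_norm.
have h2 : 0 <= (1 / 2 : R) <= 1 by lra.
have mid := f_strongly_concave hs Xv Yz Yy h2.
have := le_primal hs Xv (convex_setP (Y_convex hs) Yz Yy h2).
have -> : mu pb * chi pb = ell pb ^+ 2 / nu pb.
  by rewrite /chi; field; rewrite !gt_eqF.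
set D := enorm (z - y) in cpl mid *; set r := enorm (x - v) in cpl *.
rewrite /= in mid; move: dy; rewrite -/(P v) => dy up.
have key : `|ell pb| * D * r <= nu pb / 4 * D ^+ 2 + ell pb ^+ 2 / nu pb * r ^+ 2.
  have e2 : ell pb ^+ 2 = `|ell pb| ^+ 2 by rewrite real_normK ?num_real.
  rewrite e2; set l := `|ell pb|.
  have := sqr_ge0 (nu pb * D / 2 - l * r) => sq.
  rewrite -(ler_pM2l n0).
  have -> : nu pb * (nu pb / 4 * D ^+ 2 + l ^+ 2 / nu pb * r ^+ 2) =
    (nu pb * D / 2 - l * r) ^+ 2 + nu pb * (l * D * r) by field; rewrite gt_eqF.
  lra.
lra.
Qed.

(* The comparator [x + t (x' - x)] with [t = 1 / (1 + 2 chi)] makes the error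
   [mu chi |t (x' - x)|^2] cancel against the strong convexity of [f^~ y]. *)
Lemma Gap_bound x y delta E : X x -> 0 <= delta ->
  delta_maximizer Y (f x) delta y ->
  (forall x', X x' -> P x <= P x' + E) ->
  Gap pb f x y <= delta + (1 + 2 * chi pb) * (E + 2 * delta).
Proof.
move=> Xx d0 yP xP; have [Yy dy] := yP.
have c0 := chi_ge0; have m0 := mu_gt0 hs.
pose c := 1 + 2 * chi pb; have c1 : 0 < c by rewrite /c; lra.
rewrite /Gap lerBlDl -lerBlDr.
apply: lb_le_inf; first by exists (f x y), x.
move=> _ [x' Xx' <-]; rewrite lerBlDr.
have t01 : 0 <= c^-1 <= 1.
  by rewrite invr_ge0 (ltW c1) invf_le1// /c lerDl mulr_ge0.
have Xt := convex_setP (X_convex hs) Xx' Xx t01.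
have h1 := xP _ Xt; have h2 := primal_upper Xt Xx yP.
have h3 := f_strongly_convex hs Yy Xx' Xx t01.
have h4 := le_primal hs Xx Yy.
move: h2; have -> : c^-1 *: x' + (1 - c^-1) *: x - x = c^-1 *: (x' - x).
  by apply/rowP => i; rewrite !mxE; ring.
rewrite enormZ exprMn real_normK ?num_real// => h2.
set D := enorm (x' - x) ^+ 2 in h2 h3; have D0 : 0 <= D by rewrite sqr_ge0.
have h5 : mu pb * chi pb * (c^-1 ^+ 2 * D) = mu pb / 2 * c^-1 * (1 - c^-1) * D.
  have c1' : 1 + 2 * chi pb != 0 by rewrite gt_eqF.
  by rewrite /c; field.
have h6 : c^-1 * (f x y - f x' y) <= E + 2 * delta.
  by move: h1 h2 h3 h4 h5; rewrite -/(P x); lra.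
have h7 : f x y - f x' y <= c * (E + 2 * delta).
  by rewrite -ler_pdivrMl.
move: dy; rewrite -/(P x) -/c; lra.
Qed.

(** * Initialization by restarted blocks *)

Section Initialization.
Context (y0 : 'rV[R]_m) (Yy0 : Y y0).
Local Notation run := (exec f gx gy).
Local Notation F := (f^~ y0).
Local Notation k0 := (ceiln (Num.sqrt (8 * kappa pb))).

(** The length [k0] is chosen so that the final weight [A] is at least 1: [k0 ^+ 2 >= 8 * kappa] and
    [4 * L = mu / 2 * (8 * kappa)]. Dividing the block inequality by [A] leaves at most the original
    proximal term. *)
Lemma init_runP v : X v ->
  [/\ X (output (run (init_run pb y0 v))),
      forall x, X x -> F (output (run (init_run pb y0 v))) <= F x + mu pb / 4 * enorm (x - v) ^+ 2,
      calls_x (run (init_run pb y0 v)) = k0 &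
      calls_y (run (init_run pb y0 v)) = 0%N].
Proof.
move=> Xv; have m0 := mu_gt0 hs; have L0 := L_gt0.
have h2 : 0 < mu pb / 2 by rewrite divr_gt0.
have gP p : X p -> [/\ output (run (CallX p y0 Ret)) = gx p y0,
    calls_x (run (CallX p y0 Ret)) = 1%N & calls_y (run (CallX p y0 Ret)) = 0%N] by [].
have [u [z [oE [Xu Xz] uz cx cy]]] := blockP compact_X (X_convex hs) gP Xv h2 (ltW m0) L0
  (f_first_order_convex Yy0) (f_first_order_smooth Yy0) k0.
rewrite /init_run; move: oE cx cy; rewrite !bindE => -> -> -> /=; rewrite addn0.
split=> // x Xx; have := uz x Xx.
set A := mu pb / 2 * _ / _ => {}uz.
have A1 : 1 <= A.
  have k8 : 8 * kappa pb <= (k0)%:R ^+ 2.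
    have e : Num.sqrt (8 * kappa pb) ^+ 2 = 8 * kappa pb.
      by rewrite sqr_sqrtr// mulr_ge0// (le_trans ler01 kappa_ge1).
    rewrite -[leLHS]e.
    by apply: lerXn2r; rewrite ?nnegrE ?sqrtr_ge0 ?ler0n ?ceiln_ge.
  rewrite ler_pdivlMr ?mulr_gt0// mul1r.
  have -> : 4 * L pb = mu pb / 2 * (8 * kappa pb) by rewrite /kappa; field; rewrite gt_eqF.
  by rewrite ler_pM2l//; have := ler0n R k0; nra.
have A0 : 0 < A by apply: lt_le_trans A1.
have nn : 0 <= (mu pb / 2 + mu pb * A) / 2 * enorm (x - z) ^+ 2.
  apply: mulr_ge0; last exact: sqr_ge0.
  apply: divr_ge0 => //; apply: addr_ge0; first exact: ltW.
  by apply: mulr_ge0; exact: ltW.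
rewrite -(ler_pM2l A0).
have D0 : 0 <= mu pb / 4 * enorm (x - v) ^+ 2.
  by apply: mulr_ge0; [rewrite divr_ge0// ltW|exact: sqr_ge0].
have D1 : mu pb / 4 * enorm (x - v) ^+ 2 <= A * (mu pb / 4 * enorm (x - v) ^+ 2).
  by rewrite ler_peMl.
move: A nn uz D1 {A0 A1} => A; lra.
Qed.

Context (B0 : 0 < B pb).
Local Notation j0 := (ceiln (log2_plus (mu pb * R_x pb ^+ 2 / (4 * B pb)))).

Let target_reached : mu pb * R_x pb ^+ 2 / 4 / 2 ^+ j0 <= B pb.
Proof.
have m0 := mu_gt0 hs.
rewrite ler_pdivrMr ?exprn_gt0//.
set t := mu pb * R_x pb ^+ 2 / (4 * B pb).
have -> : mu pb * R_x pb ^+ 2 / 4 = B pb * t by rewrite /t; field; rewrite gt_eqF.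
rewrite ler_pM2l//.
have [t0|t0] := leP t 0; first by rewrite (le_trans t0)// exprn_ge0.
have := ceiln_ge (log2_plus t); set j := ceiln _ => jt.
have l2 : 0 < ln 2 :> R by rewrite ln_gt0// ltr1n.
have : ln t / ln 2 <= j%:R by apply: le_trans jt; rewrite le_max lexx orbT.
rewrite ler_pdivrMr// mulr_natl -lnXn//.
by rewrite ler_ln ?posrE ?exprn_gt0.
Qed.

(** Each run after the first halves the error in [F], until it is below [B]. Passing to [P] costs
    another [B], since [F <= P <= F + B] on [X]. *)
Lemma initializationP v : X v ->
  [/\ X (output (run (initialization pb y0 v))),
      forall x, X x -> P (output (run (initialization pb y0 v))) <= P x + 2 * B pb,
      calls_x (run (initialization pb y0 v)) = ((j0 + 2) * k0)%N &
      calls_y (run (initialization pb y0 v)) = 0%N].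
Proof.
move=> Xv; have m0 := mu_gt0 hs.
pose E i : R := mu pb * R_x pb ^+ 2 / 4 / 2 ^+ i.
have E0 i : 0 <= E i.
  by rewrite divr_ge0 ?exprn_ge0// divr_ge0// mulr_ge0 ?sqr_ge0// ltW.
have ES i : E i.+1 = E i / 2 by rewrite /E (exprSr 2 i) invfM mulrA.
(* Nothing is known about the starting point. The first run reaches [E 0] through the diameter of
   [X], so the index lags by one. *)
pose I (i : nat) u := X u /\ (i = 0%N \/ forall x, X x -> F u <= F x + E i.-1).
have step i u : I i u ->
    [/\ I i.+1 (output (run (init_run pb y0 u))),
        calls_x (run (init_run pb y0 u)) = k0 & (calls_y (run (init_run pb y0 u)) <= 0)%N].
  move=> [Xu uP]; have [Xo oP cx cy] := init_runP Xu; rewrite cy; split=> //; split=> //.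
  right => x Xx /=; case: i uP => [_|i [//|uP]].
    apply: le_trans (oP x Xx) _; rewrite lerD2l /E expr0 divr1.
    have := X_diam hs Xx Xu; have := enorm_ge0 (x - u) => d0 dR.
    have : enorm (x - u) ^+ 2 <= R_x pb ^+ 2.
      by apply: lerXn2r; rewrite ?nnegrE// (le_trans d0).
    by move=> h; rewrite [leRHS]mulrAC ler_pM2l// divr_gt0.
  (* [2 / 3] balances [mu / 4 * s] against [mu / 2 * (1 - s)]; the error is then divided by 3,
     better than the halving claimed. *)
  have s01 : 0 <= (2 / 3 : R) <= 1 by lra.
  have bs : mu pb / 4 * (2 / 3) <= mu pb / 2 * (1 - 2 / 3) by lra.
  have oP' x' : X x' -> F (output (run (init_run pb y0 u))) <=
      F x' + mu pb / 4 * enorm (x' - u) ^+ 2 + 0 by move=> /oP; rewrite addr0.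
  have := comparator_shift (X_convex hs) (f_strongly_convex hs Yy0) Xu s01 bs oP' uP Xx.
  move/le_trans; apply; rewrite lerD2l.
  by rewrite ES; have := E0 i; rewrite /=; lra.
have I0 : I 0%N v by split=> //; left.
have [] := repeat_invariant (1 + j0) step I0; rewrite add0n muln0 leqn0 => I1 cx /eqP cy.
have [I2 cx2 cy2] := step _ _ I1.
rewrite (_ : initialization pb y0 v =
  bind (repeat (1 + j0) (init_run pb y0) v) (init_run pb y0))//.
rewrite output_bind calls_x_bind calls_y_bind cx cy cx2.
move: cy2; rewrite leqn0 => /eqP ->.
case: I2 => Xw [//|wP]; split=> //; last by rewrite -mulSnr add1n addn2.
move=> x Xx; set w := output _.
apply: (@le_trans _ _ (F w + B pb)).
  by apply: (primal_le hs) => y Yy; have := f_le_shift hs Xw Yy0 Yy.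
have := wP x Xx => /= {}wP.
have : E (1 + j0)%N <= B pb.
  apply: le_trans target_reached; rewrite add1n ES -/(E j0).
  by have := E0 j0; lra.
by have := le_primal hs Xx Yy0; lra.
Qed.

End Initialization.
End SaddleProblem.

(** * The two-point algorithm *)

Section TwoPointAnalysis.
Context {R : realType} {n m : nat} (pb : params R n m).
Context (f : 'rV[R]_n -> 'rV[R]_m -> R) (gx : 'rV[R]_n -> 'rV[R]_m -> 'rV[R]_n)
  (gy : 'rV[R]_n -> 'rV[R]_m -> 'rV[R]_m).
Context (hs : setting pb f gx gy).
Local Notation X := (dom_x pb).
Local Notation Y := (dom_y pb).
Local Notation P := (primal pb f).
Local Notation run := (exec f gx gy).
Local Notation Gam := (Gam pb).
Local Notation LPhi := (LPhi pb).
Local Notation APhi := (APhi pb).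
Local Notation theta := (theta pb).
Local Notation K := (outer_K pb).

Lemma Gam_gt0 : 0 < Gam.
Proof. by rewrite mulr_gt0 ?(mu_gt0 hs)// (lt_le_trans ltr01 (chibar_ge1 hs)). Qed.

Lemma LPhi_ge1 : 1 <= LPhi.
Proof.
rewrite /Defs.LPhi lerDl; apply: divr_ge0; first exact: ltW (L_gt0 hs).
by apply: mulr_ge0 => //; exact: ltW Gam_gt0.
Qed.

(** The reason for the factor 2 in [inner_k]: it gives [inner_k ^+ 2 >= 4 * LPhi], and with it
    [theta >= 1 / 2]. *)
Lemma APhi_ge1 : 1 <= APhi.
Proof.
have l1 := LPhi_ge1; have l0 : 0 < LPhi by apply: lt_le_trans l1.
have h : 4 * LPhi <= (inner_k pb)%:R ^+ 2.
  have e : (2 * Num.sqrt LPhi) ^+ 2 = 4 * LPhi by rewrite exprMn sqr_sqrtr ?ltW//; ring.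
  rewrite -[leLHS]e; apply: lerXn2r; rewrite ?nnegrE ?mulr_ge0 ?sqrtr_ge0 ?ler0n//.
  exact: ceiln_ge.
rewrite /Defs.APhi ler_pdivlMr ?mulr_gt0// mul1r; apply: le_trans h _.
by have := ler0n R (inner_k pb); nra.
Qed.

Lemma theta_gt0 : 0 < theta.
Proof. by have h := APhi_ge1; rewrite divr_gt0; lra. Qed.

Lemma theta_lt1 : theta < 1.
Proof. by have h := APhi_ge1; rewrite ltr_pdivrMr; lra. Qed.

Lemma theta_ge_half : 1 / 2 <= theta.
Proof. by have h := APhi_ge1; rewrite ler_pdivlMr; lra. Qed.

(** What the factor 8 in [outer_K] buys: it makes the weight at the end of a stage at least [4 / mu]
    and the accumulated maximization error small. *)
Lemma outer_K_sq : 64 * chibar pb <= theta * K%:R ^+ 2.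
Proof.
have t0 := theta_gt0; have c0 : 0 <= chibar pb by rewrite (le_trans ler01 (chibar_ge1 hs)).
have ct : 0 <= chibar pb / theta by rewrite divr_ge0// ltW.
have h : 64 * (chibar pb / theta) <= K%:R ^+ 2.
  have e : (8 * Num.sqrt (chibar pb / theta)) ^+ 2 = 64 * (chibar pb / theta).
    by rewrite exprMn sqr_sqrtr//; ring.
  rewrite -[leLHS]e; apply: lerXn2r; rewrite ?nnegrE ?mulr_ge0 ?sqrtr_ge0 ?ler0n//.
  exact: ceiln_ge.
have := h; rewrite -(ler_pM2l t0).
by have -> : theta * (64 * (chibar pb / theta)) = 64 * chibar pb by field; rewrite gt_eqF.
Qed.

Lemma outer_K_ge8 : 8 <= K%:R :> R.
Proof.
have h := outer_K_sq; have c1 := chibar_ge1 hs; have t1 := theta_lt1; have t0 := theta_gt0.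
have k0 : 0 <= K%:R :> R by [].
have h1 : theta * K%:R ^+ 2 <= K%:R ^+ 2 by rewrite ler_piMl ?sqr_ge0// ltW.
have h2 : 8 ^+ 2 <= K%:R ^+ 2 :> R by apply: le_trans h1; apply: le_trans h; lra.
by move: h2; rewrite ler_pXn2r ?nnegrE.
Qed.

Lemma c_delta_gt0 : 0 < c_delta pb.
Proof.
have k8 := outer_K_ge8; have c1 := chibar_ge1 hs.
apply: divr_gt0; first by apply: lt_le_trans c1.
by apply: mulr_gt0 => //; apply: exprn_gt0; apply: lt_le_trans k8.
Qed.

(** Times [E], the left side is the total effect of the [K] inexact maximizations of a stage. *)
Lemma c_delta_le : c_delta pb * (2 * K%:R) <= 1 / 128.
Proof.
have k8 := outer_K_ge8; have k0 : 0 < K%:R :> R by apply: lt_le_trans k8.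
have -> : c_delta pb * (2 * K%:R) = chibar pb / (2 * K%:R ^+ 2).
  by rewrite /c_delta; field; rewrite gt_eqF.
rewrite ler_pdivrMr ?mulr_gt0 ?exprn_gt0//.
have h := outer_K_sq; have t1 := theta_lt1.
have h1 : theta * K%:R ^+ 2 <= K%:R ^+ 2 by rewrite ler_piMl ?sqr_ge0// ltW.
by move: h h1; set k2 := K%:R ^+ 2; lra.
Qed.

Context (maxy : 'rV[R]_n -> R -> prog R n m 'rV[R]_m) (N_y : R -> nat).
Context (maxyP : is_maxy pb f gx gy maxy N_y).

Section Step.
Context (A a : R) (u z : 'rV[R]_n) (y : 'rV[R]_m).
Context (A0 : 0 <= A) (a0 : 0 < a) (aE : a ^+ 2 = theta * (A + a) / (4 * Gam)).
Context (Xu : X u) (Xz : X z) (Yy : Y y).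
Local Notation w p := ((A + a)^-1 *: (A *: u + a *: p)).

Let Ap0 : 0 < A + a. Proof. by rewrite ltr_wpDl. Qed.

Let w_in p : X p -> X (w p).
Proof. by move=> Xp; exact: (convex_average (X_convex hs)). Qed.

Let w_sub p q : w q - w p = (a / (A + a)) *: (q - p).
Proof. by apply/rowP => j; rewrite !mxE; field; rewrite gt_eqF. Qed.

Let Phi p := (A + a) / theta * f (w p) y + 1 / 2 * enorm (p - z) ^+ 2.
Let gradPhi p := ((A + a) / theta * (a / (A + a))) *: gx (w p) y + (p - z).

(** The equation defining [a], rewritten as the factor by which the curvature of [f] is scaled
    inside [Phi]. *)
Let step_curvature : (A + a) / theta * (a / (A + a)) ^+ 2 = 1 / (4 * Gam).
Proof.
have g0 := Gam_gt0; have t0 := theta_gt0; have ap0 := Ap0.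
rewrite expr_div_n aE; field.
by rewrite !gt_eqF.
Qed.

(** One identity serves both [Phi_convex] (with [c = mu]) and [Phi_smooth] (with [c = L]): the
    second-order remainder of [Phi] is a positive multiple of that of [f]. *)
Let Phi_remainder c p q :
  Phi q - (Phi p + dot (gradPhi p) (q - p) + (1 + c / (4 * Gam)) / 2 * enorm (q - p) ^+ 2) =
  (A + a) / theta *
  (f (w q) y - (f (w p) y + dot (gx (w p) y) (w q - w p) + c / 2 * enorm (w q - w p) ^+ 2)).
Proof.
rewrite w_sub enormZ exprMn real_normK ?num_real// /gradPhi /Phi.
have -> : q - z = (p - z) + (q - p) by rewrite [RHS]addrC subrKA.
move: (p - z) (q - p) => v d; rewrite !enorm_sq !dotE (dotC d v).
have sc := step_curvature.
have -> : (1 + c / (4 * Gam)) / 2 * dot d d = 1 / 2 * dot d d +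
    c / 2 * ((A + a) / theta * (a / (A + a)) ^+ 2 * dot d d).
  by rewrite sc; field; rewrite gt_eqF ?Gam_gt0.
by field; rewrite !gt_eqF ?theta_gt0 ?Ap0.
Qed.

Let Phi_convex : first_order_convex X (1 + mu pb / (4 * Gam)) Phi gradPhi.
Proof.
move=> p q Xp Xq; rewrite -subr_ge0 Phi_remainder mulr_ge0//.
  by rewrite divr_ge0// ltW ?theta_gt0.
by rewrite subr_ge0; apply: (f_first_order_convex hs Yy); exact: w_in.
Qed.

Let Phi_smooth : first_order_smooth X LPhi Phi gradPhi.
Proof.
move=> p q Xp Xq; rewrite -subr_le0 Phi_remainder mulr_ge0_le0//.
  by rewrite divr_ge0// ltW ?theta_gt0.
by rewrite subr_le0; apply: (f_first_order_smooth hs Yy); exact: w_in.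
Qed.

Context (delta : R) (yP : delta_maximizer Y (f (w z)) delta y).

Let progPhi p := let! g := CallX (w p) y Ret in
  Ret (((A + a) / theta * (a / (A + a))) *: g + (p - z)).

Lemma two_point_block : exists p z',
  [/\ output (run (block pb progPhi z 1 (1 + mu pb / (4 * Gam)) LPhi (inner_k pb))) = (p, z', APhi),
      X p /\ X z',
      forall x, X x -> (A + a) * (P (w p) - P x) + 1 / 2 * enorm (x - z') ^+ 2 <=
         A * (P u - P x) + 1 / 2 * enorm (x - z) ^+ 2 + 2 * delta * (A + a),
      calls_x (run (block pb progPhi z 1 (1 + mu pb / (4 * Gam)) LPhi (inner_k pb))) = inner_k pb &
      calls_y (run (block pb progPhi z 1 (1 + mu pb / (4 * Gam)) LPhi (inner_k pb))) = 0%N].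
Proof.
have g0 := Gam_gt0; have t0 := theta_gt0; have ap0 := Ap0; have m0 := mu_gt0 hs.
have muG : 0 <= mu pb / (4 * Gam) by apply: divr_ge0; [exact: ltW|apply: mulr_ge0 => //; exact: ltW].
have muF0 : 0 <= 1 + mu pb / (4 * Gam) by rewrite addr_ge0.
have l0 : 0 < LPhi by apply: lt_le_trans LPhi_ge1.
have gP p : X p -> [/\ output (run (progPhi p)) = gradPhi p,
    calls_x (run (progPhi p)) = 1%N & calls_y (run (progPhi p)) = 0%N] by [].
have [p [z' [oE [Xp Xz'] pz' cx cy]]] := blockP (compact_X hs) (X_convex hs) gP Xz ltr01 muF0 l0
  Phi_convex Phi_smooth (inner_k pb).
have AE : 1 * ((inner_k pb)%:R * ((inner_k pb)%:R + 3)) / (4 * LPhi) = APhi by rewrite mul1r.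
rewrite AE in oE pz'.
exists p, z'; split=> // x Xx.
have main := pz' x Xx.
have a1 := APhi_ge1.
have thE : theta * (1 + APhi) = APhi by rewrite /Defs.theta divfK// gt_eqF; lra.
have nn : 0 <= mu pb / (4 * Gam) * APhi * enorm (x - z') ^+ 2.
  by apply: mulr_ge0; [apply: mulr_ge0 => //; lra|exact: sqr_ge0].
have xz0 : 0 <= enorm (x - z) ^+ 2 by exact: sqr_ge0.
(* The block inequality divided by [1 + APhi], with the strong convexity constant of [Phi] lowered
   to 1. The proximal part of [theta * Phi x] restores the missing [theta / 2 * |x - z|^2], so the
   distance terms telescope with coefficient [1 / 2]. *)
have main' : theta * Phi p + 1 / 2 * enorm (x - z') ^+ 2 <=
    theta * Phi x + (1 - theta) / 2 * enorm (x - z) ^+ 2.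
  have ap1 : 0 < 1 + APhi by lra.
  rewrite -(ler_pM2l ap1).
  have -> : (1 + APhi) * (theta * Phi p + 1 / 2 * enorm (x - z') ^+ 2) =
    theta * (1 + APhi) * Phi p + (1 + APhi) / 2 * enorm (x - z') ^+ 2 by field.
  have -> : (1 + APhi) * (theta * Phi x + (1 - theta) / 2 * enorm (x - z) ^+ 2) =
    theta * (1 + APhi) * Phi x + ((1 + APhi) - theta * (1 + APhi)) / 2 * enorm (x - z) ^+ 2.
    by field.
  rewrite thE; lra.
have PhiE q : theta * Phi q = (A + a) * f (w q) y + theta / 2 * enorm (q - z) ^+ 2.
  by rewrite /Phi; field; rewrite gt_eqF.
rewrite !PhiE in main'.
have Xwp := w_in Xp; have Xwz := w_in Xz; have Xwx := w_in Xx.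
have up := primal_upper hs Xwp Xwz yP.
have low : (A + a) * f (w x) y <= A * P u + a * P x.
  have t01 : 0 <= A / (A + a) <= 1.
    by apply/andP; split; [rewrite divr_ge0// ltW|rewrite ler_pdivrMr// mul1r lerDl ltW].
  have := f_strongly_convex hs Yy Xu Xx t01.
  have -> : (A / (A + a)) *: u + (1 - A / (A + a)) *: x = w x.
    by apply/rowP => j; rewrite !mxE; field; rewrite gt_eqF.
  have q0 : 0 <= mu pb / 2 * (A / (A + a)) * (1 - A / (A + a)) * enorm (u - x) ^+ 2.
    case/andP: t01 => t01 t02; apply: mulr_ge0; last exact: sqr_ge0.
    by apply: mulr_ge0; [apply: mulr_ge0 => //; lra|lra].
  move=> cvx; have {}cvx := le_trans cvx (_ : _ <= A / (A + a) * f u y + (1 - A / (A + a)) * f x y).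
  have {}cvx : f (w x) y <= A / (A + a) * f u y + (1 - A / (A + a)) * f x y by apply: cvx; lra.
  have : (A + a) * f (w x) y <= A * f u y + a * f x y.
    have -> : A * f u y + a * f x y =
      (A + a) * (A / (A + a) * f u y + (1 - A / (A + a)) * f x y) by field; rewrite gt_eqF.
    by rewrite ler_pM2l.
  have h1 : A * f u y <= A * P u by rewrite ler_wpM2l// (le_primal hs).
  have h2 : a * f x y <= a * P x by rewrite ler_pM2l// (le_primal hs).
  lra.
(* Uses the step equation and [mu * chi <= Gam]. The proximal part of [theta * Phi p] contributes
   [theta / 2 * |p - z|^2], which covers it. *)
have quad : (A + a) * (mu pb * chi pb * enorm (w p - w z) ^+ 2) <= theta / 4 * enorm (p - z) ^+ 2.
  rewrite w_sub enormZ exprMn real_normK ?num_real//.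
  have e : (A + a) * (a / (A + a)) ^+ 2 = theta / (4 * Gam).
    by rewrite expr_div_n aE; field; rewrite !gt_eqF.
  rewrite mulrCA (mulrA (A + a)) e mulrA; apply: ler_wpM2r; first exact: sqr_ge0.
  have -> : theta / 4 = Gam * (theta / (4 * Gam)) by field; rewrite gt_eqF.
  apply: ler_wpM2r; first by apply: divr_ge0; [exact: ltW|apply: mulr_ge0 => //; exact: ltW].
  by rewrite /Defs.Gam /chibar mulrDr mulr1 lerDr ltW.
have thq : 0 <= theta * enorm (p - z) ^+ 2 by apply: mulr_ge0; [exact: ltW|exact: sqr_ge0].
have up' : (A + a) * P (w p) <= (A + a) * (f (w p) y + 2 * delta +
    mu pb * chi pb * enorm (w p - w z) ^+ 2) by rewrite ler_pM2l.
lra.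
Qed.

End Step.

(** The positive root of a quadratic in [a]; its existence gives the [get] of the program its
    meaning. *)
Lemma exists_step_length A : 0 <= A ->
  exists a, 0 < a /\ a ^+ 2 = theta * (A + a) / (4 * Gam).
Proof.
move=> A0; have g0 := Gam_gt0; have t0 := theta_gt0.
pose t := theta / (4 * Gam); have tp : 0 < t by apply: divr_gt0 => //; exact: mulr_gt0.
have d0 : 0 <= t ^+ 2 + 4 * t * A.
  by apply: addr_ge0; [exact: sqr_ge0|apply: mulr_ge0 => //; apply: mulr_ge0 => //; exact: ltW].
pose s := Num.sqrt (t ^+ 2 + 4 * t * A).
have s2 : s ^+ 2 = t ^+ 2 + 4 * t * A by rewrite sqr_sqrtr.
have s0 : 0 <= s by exact: sqrtr_ge0.
exists ((t + s) / 2); split; first by lra.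
have -> : theta * (A + (t + s) / 2) / (4 * Gam) = t * (A + (t + s) / 2).
  by rewrite /t; field; rewrite gt_eqF.
have -> : ((t + s) / 2) ^+ 2 = (t ^+ 2 + 2 * t * s + s ^+ 2) / 4 by field.
by rewrite s2; field.
Qed.

Lemma two_point_stepP delta A u z : 0 < delta -> 0 <= A -> X u -> X z ->
  exists a u' z', [/\
    output (run (two_point_step pb maxy delta (A, u, z))) = (A + a, u', z'),
    0 < a /\ a ^+ 2 = theta * (A + a) / (4 * Gam),
    X u' /\ X z',
    forall x, X x -> (A + a) * (P u' - P x) + 1 / 2 * enorm (x - z') ^+ 2 <=
      A * (P u - P x) + 1 / 2 * enorm (x - z) ^+ 2 + 2 * delta * (A + a) &
    calls_x (run (two_point_step pb maxy delta (A, u, z))) = inner_k pb /\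
    (calls_y (run (two_point_step pb maxy delta (A, u, z))) <= N_y delta)%N].
Proof.
move=> d0 A0 Xu Xz; rewrite /two_point_step.
have /= [] := @getPex _ [set a : R | 0 < a /\ a ^+ 2 = theta * (A + a) / (4 * Gam)]
  (exists_step_length A0).
move: (get _) => a a0 aE.
have Xw : X ((A + a)^-1 *: (A *: u + a *: z)) by exact: (convex_average (X_convex hs)).
have [yP cx cy] := maxyP Xw d0.
move: yP cx cy; lazy beta iota zeta; rewrite output_bind calls_x_bind calls_y_bind.
move: (output (run (maxy _ delta))) => y yP cx cy.
have [p [z' [oE [Xp Xz'] main cx' cy']]] := two_point_block A0 a0 aE Xu Xz yP.1 yP.
exists a, ((A + a)^-1 *: (A *: u + a *: p)), z'.
rewrite output_bind calls_x_bind calls_y_bind oE cx cx' cy' /= !addn0 add0n; split=> //; split=> //.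
exact: (convex_average (X_convex hs)).
Qed.

(** Telescoping the descent of the steps bounds [P u - P x] by [|x - w|^2 / (2 A)] plus the
    maximization errors. Once [A >= 4 / mu], the first term has weight [mu / 8] and strong convexity
    of [P] absorbs it. *)
Lemma stageP E w : 0 < E -> X w -> (forall x, X x -> P w <= P x + E) ->
  [/\ X (output (run (stage pb maxy E w))),
      forall x, X x -> P (output (run (stage pb maxy E w))) <= P x + E / 2,
      calls_x (run (stage pb maxy E w)) = (K * inner_k pb)%N &
      (calls_y (run (stage pb maxy E w)) <= K * N_y (c_delta pb * E))%N].
Proof.
move=> E0 Xw wP; have g0 := Gam_gt0; have t0 := theta_gt0; have m0 := mu_gt0 hs.
set delta := c_delta pb * E; have d0 : 0 < delta by exact: mulr_gt0 c_delta_gt0 E0.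
(* [a^2 = theta (A + a) / (4 Gam)] forces the growth [A_i >= i^2 tau]. *)
pose tau := theta / (16 * Gam); have tau0 : 0 < tau by apply: divr_gt0 => //; exact: mulr_gt0.
pose I (i : nat) (s : R * 'rV[R]_n * 'rV[R]_n) :=
  [/\ i%:R ^+ 2 * tau <= s.1.1, X s.1.2, X s.2 &
   forall x, X x -> s.1.1 * (P s.1.2 - P x) + 1 / 2 * enorm (x - s.2) ^+ 2 <=
     1 / 2 * enorm (x - w) ^+ 2 + 2 * delta * i%:R * s.1.1].
have step i s : I i s -> [/\ I i.+1 (output (run (two_point_step pb maxy delta s))),
    calls_x (run (two_point_step pb maxy delta s)) = inner_k pb &
    (calls_y (run (two_point_step pb maxy delta s)) <= N_y delta)%N].
  case: s => [[A u] z] [/= Ai Xu Xz main].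
  have A0 : 0 <= A by apply: le_trans Ai; apply: mulr_ge0; [exact: sqr_ge0|exact: ltW].
  have [a [u' [z' [-> [a0 aE] [Xu' Xz'] desc [cx cy]]]]] := two_point_stepP d0 A0 Xu Xz.
  split=> //; split=> //=.
    have aE' : a ^+ 2 = 4 * tau * (A + a) by rewrite aE /tau; field; rewrite gt_eqF.
    have a4 : 4 * tau <= a.
      by rewrite -(ler_pM2r a0) -expr2 aE' ler_pM2l ?lerDr// mulr_gt0.
    (* Completing the square in [a^2 = 4 tau (A + a)] gives [(a - 2 tau)^2 = 4 tau A + 4 tau^2]. So
       [A >= i^2 tau] yields [a >= 2 (i + 1) tau], and [A + a = a^2 / (4 tau)] gains the next
       square. *)
    have it : 2 * i%:R * tau <= a - 2 * tau.
      rewrite -(@ler_pXn2r _ 2) ?nnegrE//; last 2 first.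
      - by apply: mulr_ge0; [exact: mulr_ge0|exact: ltW].
      - by lra.
      have -> : (2 * i%:R * tau) ^+ 2 = 4 * tau * (i%:R ^+ 2 * tau) by ring.
      have -> : (a - 2 * tau) ^+ 2 = 4 * tau * (A + a) - 4 * tau * a + 4 * tau ^+ 2.
        by rewrite -aE'; ring.
      have : 4 * tau * (i%:R ^+ 2 * tau) <= 4 * tau * A by rewrite ler_pM2l// mulr_gt0.
      have := sqr_ge0 tau; lra.
    have t4 : 0 < 4 * tau by exact: mulr_gt0.
    rewrite -natr1 -(ler_pM2l t4) -aE'.
    have -> : 4 * tau * ((i%:R + 1) ^+ 2 * tau) = (2 * i%:R * tau + 2 * tau) ^+ 2 by ring.
    apply: lerXn2r; rewrite ?nnegrE//; last by lra.
      by apply: addr_ge0; [apply: mulr_ge0; [exact: mulr_ge0|exact: ltW]|apply: mulr_ge0 => //; exact: ltW].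
    exact: ltW.
  move=> x Xx; apply: le_trans (desc x Xx) _.
  have := main x Xx.
  have : 2 * delta * i%:R * A <= 2 * delta * i%:R * (A + a).
    by apply: ler_wpM2l; [apply: mulr_ge0 => //; apply: mulr_ge0 => //; exact: ltW|rewrite lerDl ltW].
  rewrite -natr1; lra.
have I0 : I 0%N (0, w, w).
  split=> //=; first by rewrite expr0n mul0r.
  by move=> x _; rewrite mul0r add0r mulr0 addr0.
have [] := repeat_invariant K step I0; rewrite add0n.
rewrite /stage !bindE; case: (output (run (repeat _ _ _))) => [[A u] z] [/= AK Xu Xz main] cx cy.
rewrite cx !addn0; split=> //.
have k8 := outer_K_ge8; have ks := outer_K_sq; have c1 := chibar_ge1 hs.
have A4 : 4 / mu pb <= A.
  apply: le_trans AK; rewrite /tau.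
  have -> : 4 / mu pb = (64 * chibar pb) / (16 * Gam).
    by rewrite /Defs.Gam; field; rewrite !gt_eqF//; lra.
  have -> : K%:R ^+ 2 * (theta / (16 * Gam)) = theta * K%:R ^+ 2 / (16 * Gam) by ring.
  apply: ler_wpM2r => //.
  by rewrite invr_ge0; apply: mulr_ge0 => //; exact: ltW.
have A0 : 0 < A by apply: lt_le_trans A4; exact: divr_gt0.
have uP x : X x -> P u <= P x + mu pb / 8 * enorm (x - w) ^+ 2 + E / 128.
  move=> Xx; have mx := main x Xx.
  have h1 : 0 <= 1 / 2 * enorm (x - z) ^+ 2 by apply: mulr_ge0 => //; exact: sqr_ge0.
  have h2 : 1 / 2 * enorm (x - w) ^+ 2 <= A * (mu pb / 8 * enorm (x - w) ^+ 2).
    have -> : 1 / 2 * enorm (x - w) ^+ 2 = 4 / mu pb * (mu pb / 8 * enorm (x - w) ^+ 2).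
      by field; rewrite gt_eqF.
    apply: ler_wpM2r => //.
    by apply: mulr_ge0; [apply: divr_ge0 => //; exact: ltW|exact: sqr_ge0].
  have h3 : 2 * delta * K%:R * A <= A * (E / 128).
    have -> : 2 * delta * K%:R * A = A * (c_delta pb * (2 * K%:R) * E) by rewrite /delta; ring.
    rewrite ler_pM2l//; have -> : E / 128 = 1 / 128 * E by field.
    by rewrite ler_pM2r//; exact: c_delta_le.
  have -> : P x + mu pb / 8 * enorm (x - w) ^+ 2 + E / 128 =
    A^-1 * (A * P x + A * (mu pb / 8 * enorm (x - w) ^+ 2) + A * (E / 128)).
    by field; rewrite gt_eqF.
  rewrite ler_pdivlMl//; lra.
(* [4 / 5] balances [mu / 8 * s] against [mu / 2 * (1 - s)]; the result [E / 5 + E / 128] is below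
   [E / 2]. *)
have s01 : 0 <= (4 / 5 : R) <= 1 by lra.
have bs : mu pb / 8 * (4 / 5) <= mu pb / 2 * (1 - 4 / 5) by lra.
move=> x Xx.
apply: le_trans (comparator_shift (X_convex hs) (primal_strongly_convex hs) Xw s01 bs uP wP Xx) _.
lra.
Qed.

(** The lower bound on the accuracy, half the exit threshold, persists because a stage runs only
    above the threshold. It bounds every requested [delta] from below, so monotonicity of [N_y]
    bounds every call by the worst one. *)
Lemma while_loopP eps fuel E w : 0 < eps ->
  eps / (12 * chibar pb ^+ 2) < E -> X w -> (forall x, X x -> P w <= P x + E) ->
  E / 2 ^+ fuel <= eps / (6 * chibar pb ^+ 2) ->
  (forall d d' : R, 0 < d -> d <= d' -> (N_y d' <= N_y d)%N) ->
  exists E' w' s, [/\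
    output (run (while_loop pb maxy eps fuel E w)) = Some (E', w'),
    eps / (12 * chibar pb ^+ 2) < E' <= eps / (6 * chibar pb ^+ 2),
    X w' /\ forall x, X x -> P w' <= P x + E',
    (s <= fuel)%N /\ calls_x (run (while_loop pb maxy eps fuel E w)) = (s * (K * inner_k pb))%N &
    (calls_y (run (while_loop pb maxy eps fuel E w)) <=
      s * (K * N_y (c_delta pb * (eps / (12 * chibar pb ^+ 2)))))%N].
Proof.
move=> eps0 + + + + Nmono; have c0 : 0 < chibar pb by apply: lt_le_trans (chibar_ge1 hs).
have half : eps / (12 * chibar pb ^+ 2) = eps / (6 * chibar pb ^+ 2) / 2.
  by field; rewrite gt_eqF.
set lo := eps / (12 * _) in half *; set hi := eps / (6 * _) in half *.
have lo0 : 0 < lo by apply: divr_gt0 => //; apply: mulr_gt0 => //; exact: exprn_gt0.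
elim: fuel E w => [|fuel IH] E w Elo Xw wP Efuel.
  have Ehi : E <= hi by move: Efuel; rewrite expr0 divr1.
  by exists E, w, 0%N; rewrite /= -/hi ltNge Ehi /= Elo; split.
have [Ehi|Ehi] := leP E hi.
  by exists E, w, 0%N; rewrite /= -/hi ltNge Ehi /= Elo; split.
have E0 : 0 < E by apply: lt_trans Elo.
have [Xw' w'P cx cy] := stageP E0 Xw wP.
have -> : while_loop pb maxy eps fuel.+1 E w =
    bind (stage pb maxy E w) (while_loop pb maxy eps fuel (E / 2)).
  by rewrite /= -/hi Ehi.
rewrite output_bind calls_x_bind calls_y_bind.
have Elo' : lo < E / 2 by rewrite half; lra.
have Efuel' : E / 2 / 2 ^+ fuel <= hi by move: Efuel; rewrite exprS invfM mulrA.
have [E' [w'' [s [-> EE [Xw'' w''P] [sf cx'] cy']]]] := IH _ _ Elo' Xw' w'P Efuel'.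
exists E', w'', s.+1; split=> //; first by split=> //; rewrite cx cx' mulSn.
rewrite mulSn leq_add// (leq_trans cy)// leq_mul2l; apply/orP; right; apply: Nmono.
  exact: mulr_gt0 c_delta_gt0 lo0.
by rewrite ler_pM2l ?c_delta_gt0// ltW.
Qed.

End TwoPointAnalysis.

(** * Call counts *)

Section NumericalBounds.
Context {R : realType}.

Lemma half_le_ln2 : 1 / 2 <= ln 2 :> R.
Proof.
rewrite -ler_expR lnK ?posrE//.
have h : 1 - 1 / 2 <= expR (- (1 / 2)) :> R by exact: expR_ge1Dx.
have e0 : 0 < expR (1 / 2) :> R by exact: expR_gt0.
have e : expR (- (1 / 2)) * expR (1 / 2) = 1 :> R by rewrite -expRD addNr expR0.
by nra.
Qed.

Lemma ln_pow2_le (x : R) (k : nat) : 0 < x -> x <= 2 ^+ k -> ln x <= k%:R.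
Proof.
move=> x0 xk; apply: (@le_trans _ _ (ln (2 ^+ k))).
  by rewrite ler_ln ?posrE ?exprn_gt0.
rewrite lnXn// -[leRHS]mulr1 mulr_natl; apply: ler_wMn2r.
by have := @le_ln1Dx R 1; rewrite (_ : 1 + 1 = 2)//; apply.
Qed.

Lemma log2_le_ln (x : R) : 0 <= ln x -> ln x / ln 2 <= 2 * ln x.
Proof.
move=> x0; have h := half_le_ln2.
have l0 : 0 < ln 2 :> R by apply: lt_le_trans h.
by rewrite ler_pdivrMr//; nra.
Qed.

(** The logarithm is [- ln (1 - 1 / e)], at least [1 / e], and [e <= 4] follows from
    [expR (1 / 2) <= 2]. *)
Lemma quarter_le_ln_cog_rate : 1 / 4 <= ln (expR 1 / (expR 1 - 1)) :> R.
Proof.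
have e0 : 0 < expR 1 :> R by exact: expR_gt0.
have e1 : 1 < expR 1 :> R by rewrite -{1}expR0 ltr_expR.
have e4 : expR 1 <= 4 :> R.
  have := half_le_ln2; rewrite -ler_expR lnK ?posrE// => h.
  have -> : expR 1 = expR (1 / 2) ^+ 2 :> R by rewrite -expRM_natl; congr expR; field.
  have := expR_ge0 (1 / 2 : R); nra.
have -> : expR 1 / (expR 1 - 1) = (1 - (expR 1)^-1)^-1 :> R.
  by field; rewrite !gt_eqF//; lra.
have i0 : 1 / 4 <= (expR 1)^-1 :> R by rewrite div1r lef_pV2 ?posrE.
have q0 : 0 < 1 - (expR 1)^-1 :> R by rewrite subr_gt0 invf_lt1.
rewrite lnV ?posrE//.
have := @le_ln1Dx R (- (expR 1)^-1); rewrite ltrN2 invf_lt1// => /(_ e1); lra.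
Qed.

Lemma sqrt_le_mul (x y a : R) : 0 <= a -> 0 <= y -> x <= a ^+ 2 * y -> Num.sqrt x <= a * Num.sqrt y.
Proof.
move=> a0 y0 h; rewrite -[a in leRHS](ger0_norm a0) -sqrtr_sqr -sqrtrM ?sqr_ge0//.
exact: ler_wsqrtr.
Qed.

End NumericalBounds.

Section Complexity.
Context {R : realType} {n m : nat} (pb : params R n m).
Context (f : 'rV[R]_n -> 'rV[R]_m -> R) (gx : 'rV[R]_n -> 'rV[R]_m -> 'rV[R]_n)
  (gy : 'rV[R]_n -> 'rV[R]_m -> 'rV[R]_m).
Context (hs : setting pb f gx gy).
Local Notation X := (dom_x pb).
Local Notation Y := (dom_y pb).
Local Notation run := (exec f gx gy).
Local Notation K := (outer_K pb).

Let c1 : 1 <= chibar pb := chibar_ge1 hs.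
Let c0 : 0 < chibar pb. Proof. exact: lt_le_trans c1. Qed.
Let sc1 : 1 <= Num.sqrt (chibar pb).
Proof. by rewrite -[leLHS]sqrtr1; exact: ler_wsqrtr. Qed.

Lemma outer_K_le : K%:R <= 13 * Num.sqrt (chibar pb).
Proof.
have t2 := theta_ge_half hs; have t0 := theta_gt0 hs.
have q0 : 0 <= 8 * Num.sqrt (chibar pb / theta pb) by rewrite mulr_ge0 ?sqrtr_ge0.
have h := ceiln_lt q0; rewrite -/K in h.
have : Num.sqrt (chibar pb / theta pb) <= 3 / 2 * Num.sqrt (chibar pb).
  apply: sqrt_le_mul; [lra|exact: ltW|].
  rewrite ler_pdivrMr// -mulrA mulrCA; rewrite ler_peMr//; first exact: ltW.
  by lra.
by move: h sc1; lra.
Qed.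

Lemma inner_k_le : (inner_k pb)%:R <= 3 * Num.sqrt (LPhi pb).
Proof.
have l1 := LPhi_ge1 hs.
have q0 : 0 <= 2 * Num.sqrt (LPhi pb) by rewrite mulr_ge0 ?sqrtr_ge0.
have h := ceiln_lt q0; rewrite -/(inner_k pb) in h.
have : 1 <= Num.sqrt (LPhi pb) by rewrite -[leLHS]sqrtr1; exact: ler_wsqrtr.
by move: h; lra.
Qed.

(** The product under the root is [chibar * LPhi = 1 + chi + kappa / 4], at most
    [9 / 4 * (kappa + chi)] as [kappa >= 1]. The constant rounds up [13 * 3 * 3 / 2]. *)
Lemma outer_inner_le : K%:R * (inner_k pb)%:R <= 59 * Num.sqrt (kappa pb + chi pb).
Proof.
have m0 := mu_gt0 hs; have x0 := chi_ge0 hs; have k1 := kappa_ge1 hs.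
apply: (@le_trans _ _ (13 * Num.sqrt (chibar pb) * (3 * Num.sqrt (LPhi pb)))).
  by apply: ler_pM => //; [exact: outer_K_le|exact: inner_k_le].
have -> : 13 * Num.sqrt (chibar pb) * (3 * Num.sqrt (LPhi pb)) =
    39 * (Num.sqrt (chibar pb) * Num.sqrt (LPhi pb)) by ring.
rewrite -sqrtrM ?(ltW c0)//.
have -> : chibar pb * LPhi pb = 1 + chi pb + kappa pb / 4.
  by rewrite /LPhi /Gam /kappa -/(chibar pb); field; rewrite !gt_eqF.
have kc0 : 0 <= kappa pb + chi pb by lra.
have : Num.sqrt (1 + chi pb + kappa pb / 4) <= 3 / 2 * Num.sqrt (kappa pb + chi pb).
  by apply: sqrt_le_mul => //; lra.
have := sqrtr_ge0 (kappa pb + chi pb); lra.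
Qed.

Section Accuracy.
Context (eps : R) (eps0 : 0 < eps) (epsB : eps < B pb).

Let B0 : 0 < B pb. Proof. exact: lt_trans epsB. Qed.
Let T : R := B pb * chibar pb / eps.
Let T1 : 1 < T.
Proof.
rewrite ltr_pdivlMr// mul1r; apply: lt_le_trans epsB _.
by rewrite ler_peMr// ltW.
Qed.
Let T0 : 0 < T. Proof. exact: lt_trans T1. Qed.
Let lnT0 : 0 <= ln T. Proof. by apply: ln_ge0; exact: ltW. Qed.
Let LambdaE : Lambda pb eps = 1 + ln T. Proof. by []. Qed.

(** The number of halvings from the initial [2 * B] to the exit threshold [eps / (6 * chibar ^+ 2)];
    it serves as fuel. *)
Definition stage_bound : nat := ceiln (ln (12 * B pb * chibar pb ^+ 2 / eps) / ln 2).

Let W : R := 12 * B pb * chibar pb ^+ 2 / eps.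
Let W1 : 1 <= W.
Proof.
have -> : W = 12 * chibar pb * T by rewrite /W /T; field; rewrite gt_eqF.
have : 1 <= chibar pb * T by rewrite -[leLHS]mulr1 ler_pM// ltW.
by lra.
Qed.
Let W0 : 0 < W. Proof. exact: lt_le_trans W1. Qed.
Let W2 : ln W <= 4 + 2 * ln T.
Proof.
have WT : W <= 12 * T ^+ 2.
  have -> : 12 * T ^+ 2 = W * (B pb / eps) by rewrite /W /T; field; rewrite gt_eqF.
  by rewrite ler_peMr ?(ltW W0)// ler_pdivlMr// mul1r ltW.
have T2 : 0 < 12 * T ^+ 2 by apply: mulr_gt0 => //; exact: exprn_gt0.
apply: (@le_trans _ _ (ln (12 * T ^+ 2))).
  by rewrite ler_ln.
rewrite lnM ?posrE ?exprn_gt0// lnXn// -[ln T *+ 2]mulr_natl lerD2r.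
by apply: ln_pow2_le => //; lra.
Qed.

Lemma stage_bound_le : stage_bound%:R <= 9 * Lambda pb eps.
Proof.
have lW0 : 0 <= ln W by exact: ln_ge0.
have q0 : 0 <= ln W / ln 2 by rewrite divr_ge0// (le_trans _ half_le_ln2)// divr_ge0.
have h : stage_bound%:R < ln W / ln 2 + 1 by exact: ceiln_lt.
have h2 := log2_le_ln lW0.
rewrite LambdaE; move: h h2 W2 lnT0; rewrite -/W; lra.
Qed.

Lemma stage_bound_pow : 2 * B pb / 2 ^+ stage_bound <= eps / (6 * chibar pb ^+ 2).
Proof.
have l2 : 0 < ln 2 :> R by apply: lt_le_trans half_le_ln2.
have : ln W / ln 2 <= stage_bound%:R by exact: ceiln_ge.
rewrite ler_pdivrMr// [leRHS]mulr_natl -lnXn//.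
rewrite ler_ln ?posrE ?exprn_gt0// => h.
rewrite ler_pdivrMr ?exprn_gt0//.
apply: (@le_trans _ _ (eps / (6 * chibar pb ^+ 2) * W)).
  have -> : eps / (6 * chibar pb ^+ 2) * W = 2 * B pb; last by [].
  by rewrite /W; field; rewrite !gt_eqF.
apply: ler_wpM2l => //; apply: divr_ge0; first exact: ltW.
by apply: mulr_ge0 => //; exact: sqr_ge0.
Qed.

(** Origin of the constant and of the power 5/2: the right side is [eps / (48 K^3 chibar)], where
    [48 <= 2^6] and [K^3 <= 2^12 chibar^(3/2)]. *)
Lemma smallest_accuracy_ge :
  eps / (2 ^+ 18 * chibar pb `^ (5 / 2)) <= c_delta pb * (eps / (12 * chibar pb ^+ 2)).
Proof.
have k8 := outer_K_ge8 hs; have K0 : 0 < K%:R :> R by apply: lt_le_trans k8.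
have s2 : Num.sqrt (chibar pb) ^+ 2 = chibar pb by rewrite sqr_sqrtr// ltW.
have s0 : 0 < Num.sqrt (chibar pb) by apply: lt_le_trans sc1.
have -> : chibar pb `^ (5 / 2) = chibar pb ^+ 2 * Num.sqrt (chibar pb).
  have -> : (5 / 2 : R) = 2%:R + 2^-1 by field.
  rewrite powRD; last by rewrite gt_eqF ?implybT.
  by rewrite powR_mulrn ?(ltW c0)// powR12_sqrt// ltW.
have -> : c_delta pb * (eps / (12 * chibar pb ^+ 2)) = eps / (48 * K%:R ^+ 3 * chibar pb).
  by rewrite /c_delta; field; rewrite !gt_eqF.
rewrite ler_pM2l// lef_pV2 ?posrE ?mulr_gt0 ?exprn_gt0//.
have K3 : K%:R ^+ 3 <= 16 ^+ 3 * (chibar pb * Num.sqrt (chibar pb)).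
  have -> : 16 ^+ 3 * (chibar pb * Num.sqrt (chibar pb)) = (16 * Num.sqrt (chibar pb)) ^+ 3.
    have s3 : Num.sqrt (chibar pb) ^+ 3 = chibar pb * Num.sqrt (chibar pb) by rewrite exprSr s2.
    by rewrite exprMn s3.
  have sK : K%:R <= 16 * Num.sqrt (chibar pb) by have := outer_K_le; lra.
  by apply: lerXn2r => //; rewrite nnegrE; lra.
have p0 : 0 < chibar pb * Num.sqrt (chibar pb) * chibar pb by rewrite !mulr_gt0.
apply: (@le_trans _ _ (2 ^+ 6 * (16 ^+ 3 * (chibar pb * Num.sqrt (chibar pb))) * chibar pb)).
  rewrite ler_pM2r//; apply: ler_pM => //.
  by rewrite -natrX ler_nat.
have -> : 2 ^+ 6 * (16 ^+ 3 * (chibar pb * Num.sqrt (chibar pb))) * chibar pb =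
  (2 ^+ 6 * 16 ^+ 3) * (chibar pb ^+ 2 * Num.sqrt (chibar pb)) by rewrite expr2; ring.
have -> : 2 ^+ 6 * 16 ^+ 3 = 2 ^+ 18 :> R; last by [].
by have -> : 16 = 2 ^+ 4 :> R; [rewrite -natrX|rewrite -exprM -exprD].
Qed.

(** The logarithm of [B / delta] is at most [18 + 5 / 2 * ln T], the cut rate costs a factor 4 and
    rounding up at most [m]: [4 * 18 + 1 = 73]. *)
Lemma cog_queries_le : (cog_queries pb (eps / (2 ^+ 18 * chibar pb `^ (5 / 2))))%:R <=
  73 * m%:R * Lambda pb eps.
Proof.
set d := eps / _; have p0 : 0 < chibar pb `^ (5 / 2) by exact: powR_gt0.
have d0 : 0 < d by apply: divr_gt0 => //; exact: mulr_gt0.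
have BdE : B pb / d = 2 ^+ 18 * (B pb * chibar pb `^ (5 / 2) / eps).
  by rewrite /d; field; rewrite !gt_eqF.
have Bd : 1 <= B pb / d.
  rewrite BdE.
  have h : 1 <= chibar pb `^ (5 / 2) by rewrite -{1}(powRr0 (chibar pb)); apply: ler_powR => //; lra.
  have h2 : 1 <= B pb / eps by rewrite ler_pdivlMr// mul1r ltW.
  have -> : B pb * chibar pb `^ (5 / 2) / eps = B pb / eps * chibar pb `^ (5 / 2) by ring.
  have : 1 <= B pb / eps * chibar pb `^ (5 / 2) by rewrite -[leLHS]mulr1 ler_pM.
  by lra.
have lBd : ln (B pb / d) <= 18 + 5 / 2 * ln T.
  have TT : B pb * chibar pb `^ (5 / 2) / eps <= T `^ (5 / 2).
    have -> : T = (B pb / eps) * chibar pb by rewrite /T; ring.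
    have be : 0 < B pb / eps by exact: divr_gt0.
    rewrite powRM ?(ltW be) ?(ltW c0)//.
    have -> : B pb * chibar pb `^ (5 / 2) / eps = B pb / eps * chibar pb `^ (5 / 2) by ring.
    rewrite ler_pM2r//.
    have h2 : 1 <= B pb / eps by rewrite ler_pdivlMr// mul1r ltW.
    by rewrite -{1}(powRr1 (le_trans ler01 h2)); apply: ler_powR => //; lra.
  have Tp0 : 0 < T `^ (5 / 2) by exact: powR_gt0.
  apply: (@le_trans _ _ (ln (2 ^+ 18 * T `^ (5 / 2)))).
    have Bp0 : 0 < B pb / d by apply: lt_le_trans Bd.
    rewrite ler_ln ?posrE//; last by apply: mulr_gt0.
    by rewrite BdE ler_pM2l.
  rewrite lnM ?posrE// ln_powR lerD2r.
  exact: ln_pow2_le.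
have q4 := @quarter_le_ln_cog_rate R.
have r0 : 0 < ln (expR 1 / (expR 1 - 1)) :> R by apply: lt_le_trans q4.
have l0 : 0 <= ln (B pb / d) by exact: ln_ge0.
have ml0 : 0 <= m%:R * ln (B pb / d) by exact: mulr_ge0.
have q0 : 0 <= m%:R * ln (B pb / d) / ln (expR 1 / (expR 1 - 1)) by rewrite divr_ge0// ltW.
have h := ceiln_lt q0; rewrite -/(cog_queries pb d) in h.
have h2 : m%:R * ln (B pb / d) / ln (expR 1 / (expR 1 - 1)) <= 4 * (m%:R * ln (B pb / d)).
  by rewrite ler_pdivrMr//; nra.
have m1 : 1 <= m%:R :> R by rewrite ler1n; exact: m_ge1 hs.
have h3 : m%:R * ln (B pb / d) <= m%:R * (18 + 5 / 2 * ln T) by rewrite ler_wpM2l.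
have mT : 0 <= m%:R * ln T by exact: mulr_ge0.
by rewrite LambdaE; move: h h2 h3 mT m1; lra.
Qed.

Context (y0 : 'rV[R]_m) (v : 'rV[R]_n) (Yy0 : Y y0) (Xv : X v).

(** There are [j + 2] runs of length [k], with [j + 2 <= 3 * (1 + log_plus t)] and
    [k <= 4 * Num.sqrt (kappa pb)]. *)
Lemma init_cost_le : (init_cost pb f gx gy y0 v)%:R <=
  12 * Num.sqrt (kappa pb) * (1 + log_plus (mu pb * R_x pb ^+ 2 / B pb)).
Proof.
have k1 := kappa_ge1 hs; have m0 := mu_gt0 hs.
rewrite /init_cost; have [_ _ -> _] := initializationP hs Yy0 B0 Xv.
set j := ceiln _; set k := ceiln _.
have sk1 : 1 <= Num.sqrt (kappa pb) by rewrite -[leLHS]sqrtr1; exact: ler_wsqrtr.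
have kle : k%:R <= 4 * Num.sqrt (kappa pb).
  have h := ceiln_lt (sqrtr_ge0 (8 * kappa pb)); rewrite -/k in h.
  have : Num.sqrt (8 * kappa pb) <= 3 * Num.sqrt (kappa pb) by apply: sqrt_le_mul; lra.
  lra.
set t := mu pb * R_x pb ^+ 2 / B pb.
have t0 : 0 <= t by apply: divr_ge0; [apply: mulr_ge0; [exact: ltW|exact: sqr_ge0]|exact: ltW].
have lt0 : 0 <= log_plus t by rewrite le_max lexx.
have jle : j%:R <= 2 * log_plus t + 1.
  have l0 : 0 <= log2_plus (mu pb * R_x pb ^+ 2 / (4 * B pb)) by rewrite le_max lexx.
  have h := ceiln_lt l0; rewrite -/j in h.
  suff : log2_plus (mu pb * R_x pb ^+ 2 / (4 * B pb)) <= 2 * log_plus t by lra.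
  have -> : mu pb * R_x pb ^+ 2 / (4 * B pb) = t / 4 by rewrite /t; field; rewrite gt_eqF.
  rewrite /log2_plus ge_max mulr_ge0//=.
  have l2 : 0 < ln 2 :> R by apply: lt_le_trans half_le_ln2.
  have [n0|/ltW p0] := leP (ln (t / 4)) 0.
    apply: (@le_trans _ _ 0); last by rewrite mulr_ge0.
    by rewrite pmulr_lle0// invr_gt0.
  apply: le_trans (log2_le_ln p0) _; rewrite ler_pM2l// le_max; apply/orP; right.
  have [tz|tp] := eqVneq t 0; first by rewrite tz mul0r.
  have tp0 : 0 < t by rewrite lt_def tp.
  have t40 : 0 < t / 4 by exact: divr_gt0.
  by rewrite ler_ln ?posrE//; lra.
rewrite natrM natrD.
apply: (@le_trans _ _ ((3 * (1 + log_plus t)) * (4 * Num.sqrt (kappa pb)))).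
  by apply: ler_pM => //; lra.
by rewrite le_eqVlt; apply/orP; left; apply/eqP; ring.
Qed.

Lemma two_point_bounds (maxy : 'rV[R]_n -> R -> prog R n m 'rV[R]_m) (N_y : R -> nat) :
  is_maxy pb f gx gy maxy N_y ->
  (forall d d' : R, 0 < d -> d <= d' -> (N_y d' <= N_y d)%N) ->
  two_point_succeeds pb f gx gy maxy eps y0 v
    (531 * Num.sqrt (kappa pb + chi pb) * Lambda pb eps)
    (118 * Num.sqrt (1 + chi pb) * Lambda pb eps *
      (N_y (eps / (2 ^+ 18 * chibar pb `^ (5 / 2))))%:R).
Proof.
move=> maxyP Nmono; exists stage_bound.
have [Xw wP cxi cyi] := initializationP hs Yy0 B0 Xv.
have lo2B : eps / (12 * chibar pb ^+ 2) < 2 * B pb.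
  have cc : 1 <= chibar pb ^+ 2 by exact: exprn_ege1.
  rewrite ltr_pdivrMr; last by apply: mulr_gt0 => //; exact: exprn_gt0.
  by have := epsB; have := B0; nra.
have [E' [w' [s [oE /andP[lo hi] [Xw' w'P] [sf cxs] cys]]]] :=
  while_loopP hs maxyP eps0 lo2B Xw wP stage_bound_pow Nmono.
have E'0 : 0 < E' by apply: lt_trans lo; apply: divr_gt0 => //; apply: mulr_gt0 => //; exact: exprn_gt0.
have cd0 := c_delta_gt0 hs.
have d0 : 0 < c_delta pb * E' by exact: mulr_gt0.
have [yP cxm cym] := maxyP w' _ Xw' d0.
exists w', (output (run (maxy w' (c_delta pb * E')))).
rewrite /= in yP cxm cym *.
have Gle := Gap_bound hs Xw' (ltW d0) yP w'P.
move: cxi cyi oE cxs cys; rewrite /init_cost.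
have -> : two_point pb maxy eps y0 v stage_bound =
  bind (initialization pb y0 v) (fun w => bind (while_loop pb maxy eps stage_bound (2 * B pb) w)
    (fun r => match r with None => Ret None | Some (E, xhat) =>
      let! yhat := maxy xhat (c_delta pb * E) in Ret (Some (xhat, yhat)) end)) by [].
move: (initialization pb y0 v) => pinit cxi cyi oE cxs cys.
rewrite 2!output_bind 2!calls_x_bind 2!calls_y_bind oE.
rewrite output_bind calls_x_bind calls_y_bind cyi cxs cxm.
move: yP Gle cym; set yhat := output _ => yP Gle cym.
have L1 : 1 <= Lambda pb eps by rewrite LambdaE lerDl.
split=> //; first by split=> //; case: yP.
- apply: le_trans Gle _.
  have k8 := outer_K_ge8 hs; have cd := c_delta_le hs; have x0 := chi_ge0 hs.
  have cd' : c_delta pb <= 1 / 2048 by nra.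
  have dE : c_delta pb * E' <= E' / 10.
    by apply: (@le_trans _ _ (1 / 2048 * E')); [rewrite ler_pM2r|lra].
  have cE : chibar pb * E' <= eps / 6.
    apply: (@le_trans _ _ (chibar pb * (eps / (6 * chibar pb ^+ 2)))); first by rewrite ler_pM2l.
    have -> : chibar pb * (eps / (6 * chibar pb ^+ 2)) = eps / 6 / chibar pb.
      by field; rewrite gt_eqF.
    have e6 : 0 <= eps / 6 by rewrite divr_ge0// ltW.
    by rewrite ler_pdivrMr//; apply: ler_peMr.
  have -> : 1 + 2 * chi pb = 2 * chibar pb - 1 by rewrite /chibar; ring.
  move: (c_delta pb * E') dE (ltW d0) => d dE d0'.
  have h : chibar pb * d <= chibar pb * (E' / 10) by rewrite ler_pM2l.
  have : d <= chibar pb * d by rewrite ler_peMl.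
  lra.
- rewrite /= !addn0 natrD addrAC subrr add0r ger0_norm// natrM natrM.
  apply: (@le_trans _ _ (9 * Lambda pb eps * (59 * Num.sqrt (kappa pb + chi pb)))).
    apply: ler_pM => //; last exact: outer_inner_le.
    by apply: le_trans stage_bound_le; rewrite ler_nat.
  by rewrite le_eqVlt; apply/orP; left; apply/eqP; ring.
rewrite /= add0n addn0.
set N := N_y (eps / (2 ^+ 18 * _)).
have low : eps / (2 ^+ 18 * chibar pb `^ (5 / 2)) <= c_delta pb * (eps / (12 * chibar pb ^+ 2)).
  exact: smallest_accuracy_ge.
have a0 : 0 < eps / (2 ^+ 18 * chibar pb `^ (5 / 2)).
  by apply: divr_gt0 => //; apply: mulr_gt0 => //; exact: powR_gt0.
have N1 : (N_y (c_delta pb * (eps / (12 * chibar pb ^+ 2)))%R <= N)%N by exact: Nmono.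
have N2 : (calls_y (run (maxy w' (c_delta pb * E')%R)) <= N)%N.
  apply: leq_trans cym _; apply: Nmono => //; apply: le_trans low _.
  by rewrite ler_pM2l// ltW.
(* [K] maximizations in each of the [s] stages, and a last one for [yhat]; this gives the constant
   [118 = 9 * 13 + 1]. *)
apply: (@le_trans _ _ ((s * K + 1) * N)%N%:R).
  rewrite ler_nat mulnDl mul1n -mulnA; apply: leq_add => //.
  by apply: leq_trans cys _; rewrite leq_mul2l leq_mul2l N1 !orbT.
rewrite natrM; apply: ler_wpM2r => //; rewrite natrD natrM.
have := sc1; have h1 : s%:R * K%:R <= 9 * Lambda pb eps * (13 * Num.sqrt (chibar pb)).
  apply: ler_pM => //; last exact: outer_K_le.
  by apply: le_trans stage_bound_le; rewrite ler_nat.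
rewrite -/(chibar pb) => sc1'; have : 1 <= Num.sqrt (chibar pb) * Lambda pb eps.
  by rewrite -[leLHS]mulr1; apply: ler_pM.
lra.
Qed.

End Accuracy.
End Complexity.

Theorem theorem4 (R : realType) :
  exists C0 Cx Cy Cm C : R,
    [/\ 0 < C0, 0 < Cx, 0 < Cy, 0 < Cm & 0 < C] /\
    forall (n m : nat) (pb : params R n m)
      (f : 'rV[R]_n -> 'rV[R]_m -> R)
      (gx : 'rV[R]_n -> 'rV[R]_m -> 'rV[R]_n)
      (gy : 'rV[R]_n -> 'rV[R]_m -> 'rV[R]_m),
    setting pb f gx gy ->
    forall (y0 : 'rV[R]_m) (v : 'rV[R]_n) (eps : R),
    dom_y pb y0 -> dom_x pb v -> 0 < eps < B pb ->
    let tx := Cx * Num.sqrt (kappa pb + chi pb) * Lambda pb eps in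
    [/\ (init_cost pb f gx gy y0 v)%:R <=
          C0 * Num.sqrt (kappa pb) *
          (1 + log_plus (mu pb * R_x pb ^+ 2 / B pb)),
        two_point_succeeds pb f gx gy (cog_maxy pb) eps y0 v tx
          (Cy * m%:R * Num.sqrt (1 + chi pb) * Lambda pb eps ^+ 2) &
        forall (maxy : 'rV[R]_n -> R -> prog R n m 'rV[R]_m) (N_y : R -> nat),
          is_maxy pb f gx gy maxy N_y ->
          (forall d d' : R, 0 < d -> d <= d' -> (N_y d' <= N_y d)%N) ->
          two_point_succeeds pb f gx gy maxy eps y0 v tx
            (Cm * Num.sqrt (1 + chi pb) * Lambda pb eps *
             (N_y (eps / (C * chibar pb `^ (5 / 2))))%:R)].
Proof.
(* [531 = 9 * 59] multiplies the bounds on the number of stages and on the gradients per stage;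
   [118 * 73] multiplies the number of maximizations by the queries of each. *)
exists 12, 531, (118 * 73), 118, (2 ^+ 18); split; first by split.
move=> n m pb f gx gy hs y0 v eps Yy0 Xv /andP[eps0 epsB] tx.
have B0 : 0 < B pb by apply: lt_trans epsB.
split; [by have := init_cost_le hs eps0 epsB Yy0 Xv| |]; last first.
  by move=> maxy N_y maxyP Nmono; exact: two_point_bounds.
have cogP : is_maxy pb f gx gy (cog_maxy pb) (cog_queries pb).
  by move=> x delta Xx d0; exact: cog_maxy_delta_maximizer.
have cog_mono (d d' : R) : 0 < d -> d <= d' -> (cog_queries pb d' <= cog_queries pb d)%N.
  move=> d0 dd'; apply: ceiln_le; have d'0 : 0 < d' by apply: lt_le_trans dd'.
  have q4 := @quarter_le_ln_cog_rate R.
  rewrite ler_pM2r ?invr_gt0 ?(lt_le_trans _ q4)//; apply: ler_wpM2l => //.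
  by rewrite ler_ln ?posrE ?divr_gt0// ler_pM2l// lef_pV2.
have [fuel [xhat [yhat [h1 h2 h3 h4 h5]]]] := two_point_bounds hs eps0 epsB Yy0 Xv cogP cog_mono.
exists fuel, xhat, yhat; split=> //; apply: le_trans h5 _.
have s0 : 0 <= Num.sqrt (1 + chi pb) by exact: sqrtr_ge0.
have L0 : 0 <= Lambda pb eps.
  have := stage_bound_le hs eps0 epsB; have := ler0n R (stage_bound pb eps); lra.
apply: (@le_trans _ _ (118 * Num.sqrt (1 + chi pb) * Lambda pb eps * (73 * m%:R * Lambda pb eps))).
  apply: ler_wpM2l; last by have := cog_queries_le hs eps0 epsB.
  by apply: mulr_ge0 => //; exact: mulr_ge0.
by rewrite le_eqVlt; apply/orP; left; apply/eqP; ring.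
Qed.
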